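(* Assume (A1)–(A4) and fix $k\in[p]$. Then for any $\xi>1$, $$\big\|\hat{\mathbf b}_k\,\mathrm{sgn}(\mathbf u_k^{\mathrm T}\hat{\mathbf u}_k)-\mathbf b(\hat{\mathbf u}_k)\big\|_\infty=\widetilde O_{\mathbb P}\Big\{\frac{\sqrt n\rho_n}{\Delta_n^2}\max\Big(\frac1{q_n},\frac{\sqrt{n\rho_n}}{\Delta_n}\Big)(\log n)^\xi\Big\}.$$ Furthermore, if $(n\rho_n)^{3/2}/\Delta_n^2\to0$, then the bias-corrected eigenvector $\hat{\mathbf u}_k^{(c)}:=\hat{\mathbf u}_k-\hat{\mathbf b}_k$ has zero second-order bias: $\mathbf b(\hat{\mathbf u}_k^{(c)})=\mathbf 0_n$.
   Context: Setting: $d$ fixed; $\mathbf P\in\mathbb R^{n\times n}$ deterministic symmetric of rank $d$; $\mathbf A=\mathbf P+\mathbf E$ with $\mathbf E=[E_{ij}]$ random symmetric, upper-triangular entries independent, mean zero, $\sigma_{ij}^2=\mathrm{var}(E_{ij})$. Nonzero eigenvalues of $\mathbf P$: $\lambda_1\ge\dots\ge\lambda_d$, orthonormal eigenvectors $\mathbf u_1,\dots,\mathbf u_d$, $\mathbf U_{\mathbf P}=[\mathbf u_1,\dots,\mathbf u_d]$; $p,q$ the numbers of positive/negative eigenvalues. Let $\lambda_1(\mathbf A)\ge\dots\ge\lambda_n(\mathbf A)$ be the eigenvalues of $\mathbf A$ with orthonormal eigenvectors $\hat{\mathbf u}_1,\dots,\hat{\mathbf u}_n$; $\mathbf U_{\mathbf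 A}=[\hat{\mathbf u}_1,\dots,\hat{\mathbf u}_p,\hat{\mathbf u}_{n-q+1},\dots,\hat{\mathbf u}_n]$, $\mathbf S_{\mathbf A}=\mathrm{diag}(\lambda_1(\mathbf A),\dots,\lambda_p(\mathbf A),\lambda_{n-q+1}(\mathbf A),\dots,\lambda_n(\mathbf A))$; for $m\in[d]$, $\hat\lambda_m$ denotes the $m$-th diagonal entry of $\mathbf S_{\mathbf A}$ and (in the formula for $\hat{\mathbf b}_k$) $\hat{\mathbf u}_m$ the $m$-th column of $\mathbf U_{\mathbf A}$. Let $\hat{\mathbf P}=\mathbf U_{\mathbf A}\mathbf S_{\mathbf A}\mathbf U_{\mathbf A}^{\mathrm T}=[\hat p_{ij}]$, $\mathbf D:=\mathbb E\mathbf E^2=\mathrm{diag}(\sum_j\sigma_{1j}^2,\dots,\sum_j\sigma_{nj}^2)$, $\hat{\mathbf D}=\mathrm{diag}(\sum_j(A_{1j}-\hat p_{1j})^2,\dots,\sum_j(A_{nj}-\hat p_{nj})^2)$, $$\mathbf b(\hat{\mathbf u}_k)=\Big(\mathbf I_n-\tfrac32\mathbf u_k\mathbf u_k^{\mathrm T}+\sum_{m\in[d]\setminus\{k\}}\frac{\lambda_m\mathbf u_m\mathbf u_m^{\mathrm T}}{\lambda_k-\lambda_m}\Big)\frac{\mathbf D\mathbf u_k}{\lambda_k^2},\quad \hat{\mathbf b}_k=\Big(\mathbf I_n-\tfrac32\hat{\mathbf u}_k\hat{\mathbf u}_k^{\mathrm T}+\sum_{m\in[d]\setminus\{k\}}\frac{\hat\lambda_m\hat{\mathbf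 u}_m\hat{\mathbf u}_m^{\mathrm T}}{\hat\lambda_k-\hat\lambda_m}\Big)\frac{\hat{\mathbf D}\hat{\mathbf u}_k}{\hat\lambda_k^2}.$$ General notion of second-order bias: if an estimator $\tilde{\mathbf u}_k$ of $\mathbf u_k$ admits an expansion $\tilde{\mathbf u}_k\mathrm{sgn}(\mathbf u_k^{\mathrm T}\tilde{\mathbf u}_k)-\mathbf u_k=\boldsymbol\psi_k(\mathbf E)+\mathbf q_k(\mathbf E)+\mathbf t_k$ with $\boldsymbol\psi_k$ linear in $\mathbf E$, $\mathbf q_k$ quadratic in $\mathbf E$, and for each $i$: $\mathbf e_i^{\mathrm T}\boldsymbol\psi_k(\mathbf E)=O_{\mathbb P}(\rho_n^{1/2}/\Delta_n)$, $\mathbf e_i^{\mathrm T}\mathbf q_k(\mathbf E)=O_{\mathbb P}(\sqrt n\rho_n/\Delta_n^2)$, $\mathbf e_i^{\mathrm T}\mathbf t_k=o_{\mathbb P}(\sqrt n\rho_n/\Delta_n^2)$, then its second-order bias is $\mathbf b(\tilde{\mathbf u}_k)=\mathbb E\mathbf q_k(\mathbf E)$ (for $\tilde{\mathbf u}_k=\hat{\mathbf u}_k$ this is the formula above). Norms: $\|\cdot\|_\infty$ vector max-norm, $\|\cdot\|_2$ spectral, $\|\mathbf M\|_{2\to\infty}$ max row Euclidean norm. $\widetilde O_{\mathbb P}(Y_n)$: bounded by $K_cY_n$ with probability $\ge1-n^{-c}$ for every $c>0$ and $n\ge N_c$. (A1) Constants $\beta_\Delta,C_1,C_2,c>0$ and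 $\rho_n\in(0,1]$ with $n\rho_n=\omega(n^c)$ and $C_1n^{\beta_\Delta}\sqrt{n\rho_n}\le\min_k|\lambda_k|\le\max_k|\lambda_k|\le C_2n^{\beta_\Delta}\sqrt{n\rho_n}$. (A2) $\Delta_n:=\min(\min_k|\lambda_k|,\min_{k\le d-1}|\lambda_k-\lambda_{k+1}|)\ge\delta_0\min_k|\lambda_k|$, $\delta_0>0$ constant. (A3) Constant $\epsilon\in(0,1/2]$, $q_n\in[n^\epsilon,\sqrt n]$, constant $C>0$: $\mathbb E E_{ij}^2\le C\rho_n$, $\mathbb E|E_{ij}|^p\le C^p(n\rho_n)^{p/2}/(nq_n^{p-2})$ for $3\le p\le(2\log n)^{A_0\log\log n}$, $A_0\ge11$. (A4) $\|\mathbf U_{\mathbf P}\|_{2\to\infty}\le C_\mu\sqrt{d/n}$ for a constant $C_\mu\ge1$. *)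

(* Defs.v *)
From HB Require Import structures.
From mathcomp Require Import all_boot all_order all_algebra.
From mathcomp Require Import all_classical all_reals all_analysis.
Set Implicit Arguments. Unset Strict Implicit. Unset Printing Implicit Defensive.
Import Order.TTheory GRing.Theory Num.Theory.
Import numFieldNormedType.Exports.
Local Open Scope classical_set_scope.
Local Open Scope ring_scope.

Section Defs.
Variable R : realType.

(* expectation of a real random variable (used only for integrable ones) *)
Definition expectR d (T : measurableType d) (P : probability T R) (X : T -> R) : R :=
  fine (\int[P]_w (X w)%:E).

Definition varR d (T : measurableType d) (P : probability T R) (X : T -> R) : R :=
  expectR P (fun w => (X w - expectR P X) ^+ 2).

Definition mutually_independent d (T : measurableType d) (P : probability T R)
  (I : finType) (J : pred I) (X : I -> T -> R) : Prop :=
  forall B : I -> set R, (forall i, measurable (B i)) ->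
    fine (P [set w | forall i, J i -> B i (X i w)])
    = \prod_(i | J i) fine (P [set w | B i (X i w)]).

Definition OtildeP d (Om : nat -> measurableType d)
  (Pr : forall n, probability (Om n) R)
  (X : forall n, Om n -> R) (Y : nat -> R) : Prop :=
  forall c : R, 0 < c -> exists K : R, exists N : nat, forall n : nat, (N <= n)%N ->
    ((1 - powR (n%:R) (- c))%:E <= Pr n [set w | (`|X n w| <= K * Y n)%R])%E.

Definition OP d (Om : nat -> measurableType d)
  (Pr : forall n, probability (Om n) R)
  (X : forall n, Om n -> R) (Y : nat -> R) : Prop :=
  forall e : R, 0 < e -> exists M : R, exists N : nat, forall n : nat, (N <= n)%N ->
    (Pr n [set w | (M * Y n < `|X n w|)%R] <= e%:E)%E.

Definition oP d (Om : nat -> measurableType d)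
  (Pr : forall n, probability (Om n) R)
  (X : forall n, Om n -> R) (Y : nat -> R) : Prop :=
  forall dl : R, 0 < dl -> forall e : R, 0 < e -> exists N : nat, forall n : nat,
    (N <= n)%N -> (Pr n [set w | (dl * Y n < `|X n w|)%R] <= e%:E)%E.

(* i-th coordinate (i a fixed natural number) of a column vector of size n;
   0 if i >= n *)
Definition coordn n (v : 'cV[R]_n) (i : nat) : R :=
  \sum_(j < n | (j : nat) == i) v j 0.

Definition vinf n (v : 'cV[R]_n) : R := \big[Num.max/0]_(i < n) `|v i 0|.

Definition two_to_inf n m (M : 'M[R]_(n, m)) : R :=
  \big[Num.max/0]_(i < n) Num.sqrt (\sum_(j < m) M i j ^+ 2).

Definition Delta d (lam : 'I_d -> R) : R :=
  \big[Num.min/ \big[Num.max/0]_(k < d) `|lam k|]_(k < d)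
    Num.min `|lam k|
      (\big[Num.min/ `|lam k|]_(k' < d | (k' : nat).+1 == k) `|lam k' - lam k|).

Definition min_abs d (lam : 'I_d -> R) : R :=
  \big[Num.min/ \big[Num.max/0]_(k < d) `|lam k|]_(k < d) `|lam k|.

(* selection of the p largest and q smallest eigen-indices of an n x n matrix:
   column m (0-based) of U_A is hat u_{m} if m < p, hat u_{n-d+m} otherwise *)
Definition sel (n p d : nat) (m : nat) : nat := if (m < p)%N then m else (n - d + m)%N.

(* U_A from a full eigenvector matrix V (columns = hat u_1..hat u_n) *)
Definition UAof n p d (V : 'M[R]_n) : 'M[R]_(n, d) :=
  \matrix_(i < n, m < d) \sum_(j < n | (j : nat) == sel n p d m) V i j.

(* diagonal of S_A from the eigenvalues mu of A (mu nonincreasing) *)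
Definition SAof n p d (mu : 'I_n -> R) : 'I_d -> R :=
  fun m => \sum_(j < n | (j : nat) == sel n p d m) mu j.

Definition diagv d (s : 'I_d -> R) : 'M[R]_d := diag_mx (\row_m s m).

Definition Phat n p d (V : 'M[R]_n) (mu : 'I_n -> R) : 'M[R]_n :=
  @UAof n p d V *m diagv (@SAof n p d mu) *m (@UAof n p d V)^T.

Definition Dhat n (A Ph : 'M[R]_n) : 'M[R]_n :=
  diag_mx (\row_i \sum_(j < n) (A i j - Ph i j) ^+ 2).

Definition Dof n (sig2 : 'I_n -> 'I_n -> R) : 'M[R]_n :=
  diag_mx (\row_i \sum_(j < n) sig2 i j).

Definition bias_formula n d (U : 'M[R]_(n, d)) (lam : 'I_d -> R) (D : 'M[R]_n)
  (k : 'I_d) : 'cV[R]_n :=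
  (lam k ^+ 2)^-1 *:
   ((1%:M - (3 / 2 : R) *: (col k U *m (col k U)^T)
     + \sum_(m < d | m != k) (lam m / (lam k - lam m)) *: (col m U *m (col m U)^T))
    *m D *m col k U).

Definition linE n (L : 'I_n -> 'I_n -> 'I_n -> R) (M : 'M[R]_n) : 'cV[R]_n :=
  \col_i \sum_(j < n) \sum_(l < n) L i j l * M j l.

Definition quadE n (Q : 'I_n -> 'I_n -> 'I_n -> 'I_n -> 'I_n -> R) (M : 'M[R]_n)
  : 'cV[R]_n :=
  \col_i \sum_(j < n) \sum_(l < n) \sum_(j' < n) \sum_(l' < n)
     Q i j l j' l' * M j l * M j' l'.

Definition second_order_bias_is d (Om : nat -> measurableType d)
  (Pr : forall n, probability (Om n) R)
  (E : forall n, Om n -> 'M[R]_n) (u : forall n, 'cV[R]_n)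
  (ut : forall n, Om n -> 'cV[R]_n) (rho Dl : nat -> R)
  (b : forall n, 'cV[R]_n) : Prop :=
  exists (L : forall n, 'I_n -> 'I_n -> 'I_n -> R)
         (Q : forall n, 'I_n -> 'I_n -> 'I_n -> 'I_n -> 'I_n -> R),
  let psi := fun n w => linE (L n) (E n w) in
  let qq := fun n w => quadE (Q n) (E n w) in
  let t := fun n w => Num.sg (((u n)^T *m ut n w) 0 0) *: ut n w - u n
                       - psi n w - qq n w in
  [/\ forall i : nat, OP Pr (fun n w => coordn (psi n w) i)
                            (fun n => Num.sqrt (rho n) / Dl n),
      forall i : nat, OP Pr (fun n w => coordn (qq n w) i)
                            (fun n => Num.sqrt n%:R * rho n / Dl n ^+ 2),
      forall i : nat, oP Pr (fun n w => coordn (t n w) i)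
                            (fun n => Num.sqrt n%:R * rho n / Dl n ^+ 2) &
      forall n (i : 'I_n), (\int[Pr n]_w ((qq n w) i 0)%:E = (b n i 0)%:E)%E].

End Defs.

(* Main.v *)
Require Import Defs.
From HB Require Import structures.
From mathcomp Require Import all_boot all_order all_algebra.
From mathcomp Require Import all_classical all_reals all_analysis.
From mathcomp Require Import measurable_realfun ring lra zify.
Import Order.TTheory GRing.Theory Num.Theory.
Import numFieldNormedType.Exports.
Local Open Scope ring_scope.

(** The noise is handled through two events.  Mixed moments of the entries of
    [E], which factor by independence and vanish as soon as some edge is used
    once, are summed along walks; a Markov bound of order about [log n] then
    gives, with probability at least [1 - n^-c], an operator norm
    [tau = K sqrt (n rho) log n], entries [|(E^r u_l)_i| <= tau^r nu] with
    [nu] of order [n^(-1/2)], and row sums of [E_ij^2] close to their means.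
    Plain second moments give log-free bounds at a fixed entry on an event of
    probability [1 - e].

    On these events everything is deterministic.  Weyl's inequality locates the
    eigenvalues of [A].  Iterating the eigen-equation [uh = (P uh + E uh) / lh]
    expresses an entry of [uh] through the [E^r u_l] with [r] below a fixed
    order, because [(tau / Delta)^r] eventually beats [n^(-1/2)]; this gives both
    [|uh_i - u_i| <= C nu tau / Delta] and the second-order expansion of [uh_i].
    The entrywise closeness of [Phat] to [P] makes [Dhat] close to [D], and the
    bias formula is stable under these perturbations.

    For the corrected eigenvector the quadratic form is the quadratic part of
    the expansion with [E^2] replaced by its off-diagonal part, which has mean
    zero; the diagonal part [sum_l E_jl^2] concentrates around [D_j] and is
    cancelled by the estimated bias. *)

Set Implicit Arguments.
Unset Strict Implicit.
Unset Printing Implicit Defensive.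

(** * Weyl's inequality *)

(** Put [r = sqrt (n rho) / Delta] and let [nu], of order [n^(-1/2)], bound the entries of the
    signal eigenvectors. The size allowed for a second-order remainder is [r^2 nu] up to a constant,
    so a logarithm is harmless only next to a further factor [r], [1 / q_n] or [n^(-1/2)]. Bounding
    the forms [u_l^T E u_l'] by the operator norm would leave an error of order [r^2 (log n)^2 nu],
    which is too large. Their second moment shows that they are smaller by a factor [n^(-1/2)], and
    this is why the expansion keeps a separate scale [gam] for them next to the scale [delta] of the
    operator norm. The linear and quadratic terms themselves must be bounded in probability without
    any logarithm, which the high-moment event cannot give; since only a fixed coordinate is asked
    for there, a Markov bound on second moments is enough, and both events are intersected for the
    remainder. *)

Section KernelVector.
Variable F : fieldType.

Lemma kernel_vector a b (M : 'M[F]_(a, b)) : (b < a)%N ->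
  exists2 c : 'rV[F]_a, c != 0 & c *m M = 0.
Proof.
move=> ba; have nz : kermx M != 0.
  rewrite -mxrank_eq0 mxrank_ker subn_eq0 -ltnNge.
  by apply: leq_ltn_trans ba; exact: rank_leq_col.
exists (nz_row (kermx M)); first by rewrite nz_row_eq0.
by apply/sub_kermxP; exact: nz_row_sub.
Qed.

(** There are fewer linear conditions, indexed by [S2], than free coordinates, indexed by [S1]. This
    is the dimension count of the min-max principle, phrased with index sets instead of
    subspaces. *)
Lemma kernel_vector_support a b (M : 'M[F]_(a, b)) (S1 : {set 'I_a}) (S2 : {set 'I_b}) :
  (#|S2| < #|S1|)%N ->
  exists c : 'cV[F]_a, [/\ c != 0, forall i, i \notin S1 -> c i 0 = 0 &
    forall j, j \in S2 -> (M^T *m c) j 0 = 0].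
Proof.
move=> S21; pose M' := \matrix_(i < #|S1|, j < #|S2|) M (enum_val i) (enum_val j).
have [y y0 yM] := kernel_vector M' S21.
pose c : 'cV[F]_a := \col_i \sum_(k < #|S1| | enum_val k == i) y 0 k.
exists c; split.
- have [k yk] : exists k, y 0 k != 0.
    apply/existsP; apply: contra_neqT y0; rewrite negb_exists => /forallP y0.
    by apply/rowP => k; rewrite mxE; apply/eqP; rewrite -[_ == _]negbK y0.
  apply: contra_neq yk => /matrixP/(_ (enum_val k) 0); rewrite !mxE; apply: etrans.
  by rewrite (big_pred1 k) // => k'; rewrite /= (inj_eq enum_val_inj).
- move=> i iS; rewrite mxE big1 // => k /eqP E; case/negP: iS.
  by rewrite -E enum_valP.
- move=> j jS; rewrite mxE; under eq_bigr => i _ do rewrite !mxE mulr_sumr big_mkcond.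
  rewrite exchange_big /=.
  have /matrixP/(_ 0 (enum_rank_in jS j)) := yM; rewrite !mxE; apply: etrans.
  apply: eq_bigr => k _; rewrite -big_mkcond /= (big_pred1 (enum_val k)).
    by rewrite mxE enum_rankK_in // mulrC.
  by move=> i; rewrite /= eq_sym.
Qed.

End KernelVector.

(** * Scalar products of column vectors, with norms bounded through their squares *)

Section Dot.
Variable R : rcfType.

Definition dot n (x y : 'cV[R]_n) : R := \sum_i x i 0 * y i 0.

Lemma dotE n (x y : 'cV[R]_n) : (x^T *m y) 0 0 = dot x y.
Proof. by rewrite mxE; apply: eq_bigr => i _; rewrite mxE. Qed.

Lemma dotC n (x y : 'cV[R]_n) : dot x y = dot y x.
Proof. by apply: eq_bigr => i _; rewrite mulrC. Qed.

Lemma dotDr n (x y z : 'cV[R]_n) : dot x (y + z) = dot x y + dot x z.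
Proof. by rewrite -big_split; apply: eq_bigr => i _; rewrite mxE mulrDr. Qed.

Lemma dotZr n a (x y : 'cV[R]_n) : dot x (a *: y) = a * dot x y.
Proof. by rewrite mulr_sumr; apply: eq_bigr => i _; rewrite mxE mulrCA. Qed.

Lemma dotDl n (x y z : 'cV[R]_n) : dot (x + y) z = dot x z + dot y z.
Proof. by rewrite dotC dotDr !(dotC z). Qed.

Lemma dotZl n a (x y : 'cV[R]_n) : dot (a *: x) y = a * dot x y.
Proof. by rewrite dotC dotZr dotC. Qed.

Lemma dotNr n (x y : 'cV[R]_n) : dot x (- y) = - dot x y.
Proof. by rewrite -scaleN1r dotZr mulN1r. Qed.

Lemma dotBr n (x y z : 'cV[R]_n) : dot x (y - z) = dot x y - dot x z.
Proof. by rewrite dotDr dotNr. Qed.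

Lemma dotBl n (x y z : 'cV[R]_n) : dot (x - y) z = dot x z - dot y z.
Proof. by rewrite dotC dotBr !(dotC z). Qed.

Lemma dot_sumr n (I : Type) (s : seq I) (Q : pred I) (x : 'cV[R]_n) (y : I -> 'cV[R]_n) :
  dot x (\sum_(i <- s | Q i) y i) = \sum_(i <- s | Q i) dot x (y i).
Proof.
elim/big_rec2: _ => [|i a b Qi <-]; last by rewrite dotDr.
by apply: big1 => i _; rewrite mxE mulr0.
Qed.

Lemma dot_mulmx m n (x : 'cV[R]_m) (M : 'M[R]_(m, n)) (y : 'cV[R]_n) :
  dot x (M *m y) = dot (M^T *m x) y.
Proof. by rewrite -!dotE trmx_mul trmxK mulmxA. Qed.

Lemma dot_ge0 n (x : 'cV[R]_n) : 0 <= dot x x.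
Proof. by apply: sumr_ge0 => i _; rewrite -expr2 sqr_ge0. Qed.

Lemma dot_eq0 n (x : 'cV[R]_n) : (dot x x == 0) = (x == 0).
Proof.
apply/eqP/eqP => [|->]; last by apply: big1 => i _; rewrite mxE mulr0.
move/eqP; rewrite psumr_eq0 => [/allP H|i _]; last by rewrite -expr2 sqr_ge0.
apply/colP => i; rewrite mxE; have := H i; rewrite mem_index_enum mulf_eq0 orbb.
by move=> /(_ isT)/eqP.
Qed.

Lemma dot_CS n (x y : 'cV[R]_n) : dot x y ^+ 2 <= dot x x * dot y y.
Proof.
have [->|x0] := eqVneq x 0.
  have z (z : 'cV[R]_n) : dot 0 z = 0 by apply: big1 => i _; rewrite mxE mul0r.
  by rewrite !z expr0n mul0r.
have xx : 0 < dot x x by rewrite lt_neqAle eq_sym dot_eq0 x0 dot_ge0.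
have := dot_ge0 (dot x x *: y - dot x y *: x).
rewrite !(dotBl, dotBr, dotZl, dotZr) (dotC y x).
have -> : dot x x * (dot x x * dot y y - dot x y * dot x y) -
  dot x y * (dot x x * dot x y - dot x y * dot x x) =
  dot x x * (dot x x * dot y y - dot x y ^+ 2) by ring.
by rewrite pmulr_rge0 // subr_ge0.
Qed.

Lemma dot_le n (x y : 'cV[R]_n) a b : 0 <= a -> 0 <= b ->
  dot x x <= a ^+ 2 -> dot y y <= b ^+ 2 -> `|dot x y| <= a * b.
Proof.
move=> a0 b0 xa yb; rewrite -(ger0_norm (mulr_ge0 a0 b0)) -ler_sqr ?nnegrE //.
rewrite !real_normK ?num_real // exprMn; apply: le_trans (dot_CS x y) _.
by rewrite ler_pM ?dot_ge0.
Qed.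

(** Minkowski's inequality with both sides squared. Norm bounds are kept in this form, so that
    square roots stay out of the algebra. *)
Lemma sqrt_dotD n (x y : 'cV[R]_n) a b : 0 <= a -> 0 <= b ->
  dot x x <= a ^+ 2 -> dot y y <= b ^+ 2 -> dot (x + y) (x + y) <= (a + b) ^+ 2.
Proof.
move=> a0 b0 xa yb; rewrite !(dotDl, dotDr) (dotC y x).
have := dot_le a0 b0 xa yb; rewrite ler_norml => /andP[_ h].
rewrite (_ : (a + b) ^+ 2 = a ^+ 2 + b ^+ 2 + a * b *+ 2); last by ring.
lra.
Qed.

Lemma entry_le n (x : 'cV[R]_n) a i : 0 <= a -> dot x x <= a ^+ 2 -> `|x i 0| <= a.
Proof.
move=> a0 xa; rewrite -(ger0_norm a0) -ler_sqr ?nnegrE // !real_normK ?num_real //.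
apply: le_trans xa; rewrite /dot (bigD1 i) //= -expr2 lerDl.
by apply: sumr_ge0 => j _; rewrite -expr2 sqr_ge0.
Qed.

Lemma dot_diag n (s : 'I_n -> R) (x : 'cV[R]_n) :
  dot x (diag_mx (\row_m s m) *m x) = \sum_m s m * x m 0 ^+ 2.
Proof.
apply: eq_bigr => m _; rewrite mul_diag_mx !mxE mulrCA; congr (_ * _).
Qed.

Lemma bessel n d (U : 'M[R]_(n, d)) (x : 'cV[R]_n) : U^T *m U = 1%:M ->
  dot (U^T *m x) (U^T *m x) <= dot x x.
Proof.
move=> UU; pose y := U^T *m x; rewrite -/y.
have e1 : dot x (U *m y) = dot y y by rewrite dot_mulmx.
have e2 : dot (U *m y) (U *m y) = dot y y by rewrite dot_mulmx mulmxA UU mul1mx.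
have := dot_ge0 (x - U *m y).
rewrite !(dotBl, dotBr) (dotC (U *m y) x) e1 e2; lra.
Qed.

End Dot.

(** * Comparison of eigenvalues through a common test vector *)

Section Weyl.
Variables (R : rcfType) (n d : nat).
Variables (U : 'M[R]_(n, d)) (lam : 'I_d -> R) (E V : 'M[R]_n) (mu : 'I_n -> R) (tau : R).
Hypothesis UU : U^T *m U = 1%:M.
Hypothesis VV : V^T *m V = 1%:M.
Hypothesis AE : U *m diag_mx (\row_m lam m) *m U^T + E = V *m diag_mx (\row_m mu m) *m V^T.
Hypothesis tau0 : 0 <= tau.
Hypothesis Etau : forall x, dot (E *m x) (E *m x) <= tau ^+ 2 * dot x x.

Lemma opnorm_dot x y a b : 0 <= a -> 0 <= b ->
  dot x x <= a ^+ 2 -> dot y y <= b ^+ 2 -> `|dot x (E *m y)| <= tau * (a * b).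
Proof.
move=> a0 b0 xa yb; rewrite mulrCA; apply: dot_le => //; first exact: mulr_ge0.
by apply: le_trans (Etau y) _; rewrite exprMn ler_wpM2l // exprn_ge0.
Qed.

Lemma quad_form_E x : `|dot x (E *m x)| <= tau * dot x x.
Proof.
have := @opnorm_dot x x (Num.sqrt (dot x x)) (Num.sqrt (dot x x)).
by rewrite -expr2 !sqr_sqrtr ?dot_ge0 // sqrtr_ge0 lexx; apply.
Qed.

Lemma quad_form_split x : \sum_j mu j * (V^T *m x) j 0 ^+ 2 =
  \sum_l lam l * (U^T *m x) l 0 ^+ 2 + dot x (E *m x).
Proof.
rewrite -!dot_diag -!(dot_mulmx x) -dotDr; congr (dot x _).
by rewrite !mulmxA -mulmxDl AE.
Qed.

(** Take a combination [x] of the [u_l] with [l] in [SU] that is orthogonal to the eigenvectors of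
    [A] indexed by [SV]. On it the form of [A] is at least [alpha - tau] and at most [beta] times
    [dot x x]. *)
Lemma weyl_lower (SU : {set 'I_d}) (SV : {set 'I_n}) alpha beta :
  (#|SV| < #|SU|)%N -> (forall l, l \in SU -> alpha <= lam l) ->
  (forall j, j \notin SV -> mu j <= beta) -> alpha <= beta + tau.
Proof.
move=> card la mb; have [c [c0 cS cM]] := kernel_vector_support (U^T *m V) card.
pose x := U *m c.
have Ux : U^T *m x = c by rewrite /x mulmxA UU mul1mx.
have xx : dot x x = dot c c by rewrite {1}/x dotC dot_mulmx Ux.
have Vx j : j \in SV -> (V^T *m x) j 0 = 0.
  by move=> /cM; rewrite trmx_mul trmxK /x mulmxA.
have VxVx : dot (V^T *m x) (V^T *m x) = dot x x.
  by rewrite -dot_mulmx mulmxA (mulmx1C VV) mul1mx.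
have xx0 : 0 < dot x x by rewrite xx lt_neqAle eq_sym dot_eq0 c0 dot_ge0.
have := quad_form_split x; rewrite Ux.
have h1 : \sum_j mu j * (V^T *m x) j 0 ^+ 2 <= beta * dot x x.
  rewrite -VxVx mulr_sumr; apply: ler_sum => j _; rewrite -expr2.
  have [/Vx ->|/mb h] := boolP (j \in SV); first by rewrite expr0n !mulr0.
  by rewrite ler_wpM2r // sqr_ge0.
have h2 : alpha * dot x x <= \sum_l lam l * c l 0 ^+ 2.
  rewrite xx mulr_sumr; apply: ler_sum => l _; rewrite -expr2.
  have [/la h|/cS ->] := boolP (l \in SU); last by rewrite expr0n !mulr0.
  by rewrite ler_wpM2r // sqr_ge0.
have := quad_form_E x; rewrite ler_norml => /andP[h3 _] h4.
rewrite -(ler_pM2r xx0) mulrDl; lra.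
Qed.

(** The roles of the two bases are exchanged. The columns of [U] need not span the whole space, so
    [U^T x] may be shorter than [x], and Bessel's inequality then calls for [0 <= alpha]. *)
Lemma weyl_upper (SU : {set 'I_d}) (SV : {set 'I_n}) alpha beta :
  (#|SU| < #|SV|)%N -> 0 <= alpha -> (forall l, l \notin SU -> lam l <= alpha) ->
  (forall j, j \in SV -> beta <= mu j) -> beta <= alpha + tau.
Proof.
move=> card a0 la mb; have [c [c0 cS cM]] := kernel_vector_support (V^T *m U) card.
pose x := V *m c.
have Vx : V^T *m x = c by rewrite /x mulmxA VV mul1mx.
have xx : dot x x = dot c c by rewrite {1}/x dotC dot_mulmx Vx.
have Ux l : l \in SU -> (U^T *m x) l 0 = 0.
  by move=> /cM; rewrite trmx_mul trmxK /x mulmxA.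
have xx0 : 0 < dot x x by rewrite xx lt_neqAle eq_sym dot_eq0 c0 dot_ge0.
have := quad_form_split x; rewrite Vx.
have h1 : \sum_l lam l * (U^T *m x) l 0 ^+ 2 <= alpha * dot x x.
  apply: le_trans (ler_wpM2l a0 (bessel x UU)).
  rewrite mulr_sumr; apply: ler_sum => l _; rewrite -expr2.
  have [/Ux ->|/la h] := boolP (l \in SU); first by rewrite expr0n !mulr0.
  by rewrite ler_wpM2r // sqr_ge0.
have h2 : beta * dot x x <= \sum_j mu j * c j 0 ^+ 2.
  rewrite xx mulr_sumr; apply: ler_sum => j _; rewrite -expr2.
  have [/mb h|/cS ->] := boolP (j \in SV); last by rewrite expr0n !mulr0.
  by rewrite ler_wpM2r // sqr_ge0.
have := quad_form_E x; rewrite ler_norml => /andP[_ h3] h4.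
rewrite -(ler_pM2r xx0) mulrDl; lra.
Qed.

End Weyl.

(** * Iterates of a matrix on a vector *)

Section Powv.
Variable R : rcfType.

Definition powv n (Z : 'M[R]_n) (r : nat) (y : 'cV[R]_n) : 'cV[R]_n := iter r (mulmx Z) y.

Lemma powvSr n (Z : 'M[R]_n) r y : powv Z r.+1 y = powv Z r (Z *m y).
Proof. exact: iterSr. Qed.

Lemma powvD n (Z : 'M[R]_n) r x y : powv Z r (x + y) = powv Z r x + powv Z r y.
Proof. by elim: r => //= r ->; rewrite mulmxDr. Qed.

Lemma powvZ n (Z : 'M[R]_n) r a y : powv Z r (a *: y) = a *: powv Z r y.
Proof. by elim: r => //= r ->; rewrite scalemxAr. Qed.

Lemma powv_sum n (Z : 'M[R]_n) r (I : Type) (s : seq I) (Q : pred I) (y : I -> 'cV[R]_n) :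
  powv Z r (\sum_(i <- s | Q i) y i) = \sum_(i <- s | Q i) powv Z r (y i).
Proof. by elim: r => //= r ->; rewrite mulmx_sumr. Qed.

Lemma powv_scale n (Z : 'M[R]_n) r a y : powv (a *: Z) r y = a ^+ r *: powv Z r y.
Proof.
elim: r => [|r IH] /=; first by rewrite scale1r.
by rewrite IH -scalemxAr -scalemxAl scalerA exprSr.
Qed.

Lemma powv_norm n (Z : 'M[R]_n) r y tau :
  (forall x, dot (Z *m x) (Z *m x) <= tau ^+ 2 * dot x x) ->
  dot (powv Z r y) (powv Z r y) <= (tau ^+ r) ^+ 2 * dot y y.
Proof.
move=> H; elim: r => [|r IH]; first by rewrite expr0 expr1n mul1r.
apply: le_trans (H _) _; have := ler_wpM2l (sqr_ge0 tau) IH.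
by rewrite mulrA -exprMn -exprS.
Qed.

Lemma dot_powv n (Z : 'M[R]_n) r x y : Z^T = Z ->
  dot (powv Z r x) y = dot x (powv Z r y).
Proof.
move=> Zs; elim: r x y => // r IH x y.
by rewrite [in RHS]powvSr -IH /= dotC dot_mulmx Zs dotC.
Qed.

End Powv.

(** * Weyl's inequality for the eigenvalues selected at both ends of the spectrum *)

Section WeylSelected.
Variables (R : rcfType) (n d p : nat).
Variables (U : 'M[R]_(n, d)) (lam : 'I_d -> R) (E V : 'M[R]_n) (mu : 'I_n -> R) (tau : R).
Hypothesis UU : U^T *m U = 1%:M.
Hypothesis VV : V^T *m V = 1%:M.
Hypothesis AE : U *m diag_mx (\row_m lam m) *m U^T + E = V *m diag_mx (\row_m mu m) *m V^T.
Hypothesis tau0 : 0 <= tau.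
Hypothesis Etau : forall x, dot (E *m x) (E *m x) <= tau ^+ 2 * dot x x.
Hypothesis lam_sign : forall m : 'I_d, ((m < p)%N -> 0 < lam m) /\ ((p <= m)%N -> lam m < 0).
Hypothesis lam_mono : forall m m' : 'I_d, (m <= m')%N -> lam m' <= lam m.
Hypothesis mu_mono : forall i j : 'I_n, (i <= j)%N -> mu j <= mu i.

Lemma orthonormal_dim : (d <= n)%N.
Proof.
rewrite -(mxrank1 R d) -UU; apply: leq_trans (mxrankM_maxr _ _) _.
exact: rank_leq_row.
Qed.

Lemma card_ord_lt N k : (k <= N)%N -> #|[set l : 'I_N | (l < k)%N]| = k.
Proof.
move=> kN; rewrite -sum1_card; transitivity (\sum_(i < k) 1)%N.
  by rewrite (big_ord_widen N (fun=> 1%N) kN); apply: eq_bigl => l; rewrite inE.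
by rewrite big_const_ord iter_addn mul1n addn0.
Qed.

Lemma card_ord_ge N k : (k <= N)%N -> #|[set l : 'I_N | (k <= l)%N]| = (N - k)%N.
Proof.
move=> kN; have := cardsC [set l : 'I_N | (l < k)%N]; rewrite card_ord_lt // card_ord.
have -> : ~: [set l : 'I_N | (l < k)%N] = [set l : 'I_N | (k <= l)%N].
  by apply/setP => l; rewrite !inE -leqNgt.
by lia.
Qed.

(** Negation exchanges the two ends of the spectrum and gives the negative eigenvalues the sign that
    [weyl_upper] asks for. *)
Let AEN : U *m diag_mx (\row_m (- lam m)) *m U^T + (- E) =
  V *m diag_mx (\row_m (- mu m)) *m V^T.
Proof.
have N k (s : 'I_k -> R) : diag_mx (\row_m (- s m)) = - diag_mx (\row_m s m).
  by apply/matrixP => i j; rewrite !mxE mulNrn.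
by rewrite !N !mulmxN !mulNmx -opprD AE.
Qed.

Let EtauN x : dot (- E *m x) (- E *m x) <= tau ^+ 2 * dot x x.
Proof. by rewrite mulNmx -scaleN1r dotZl dotZr mulrA mulrNN !mul1r. Qed.

(** Positive eigenvalues are counted from the top, negative ones from the bottom. The [n - d]
    eigenvalues of [A] in between are not matched with any [lam m]. *)
Lemma weyl_selected (m : 'I_d) (j : 'I_n) :
  (j : nat) = (if (m < p)%N then m : nat else (n - d + m)%N) -> `|mu j - lam m| <= tau.
Proof.
have dn := orthonormal_dim; have md := ltn_ord m; have jn := ltn_ord j.
case: ifP => mp jE.
- have lm : 0 < lam m := (lam_sign m).1 mp.
  rewrite ler_distl; apply/andP; split.
  + rewrite lerBlDr; apply: (weyl_lower UU VV AE tau0 Etau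
      (SU := [set l : 'I_d | (l < m.+1)%N]) (SV := [set l : 'I_n | (l < m)%N])).
    * by rewrite !card_ord_lt //; lia.
    * by move=> l; rewrite inE ltnS => /lam_mono.
    * by move=> l; rewrite inE -leqNgt -jE => /mu_mono.
  + apply: (weyl_upper UU VV AE tau0 Etau
      (SU := [set l : 'I_d | (l < m)%N]) (SV := [set l : 'I_n | (l < m.+1)%N])).
    * by rewrite !card_ord_lt //; lia.
    * exact: ltW.
    * by move=> l; rewrite inE -leqNgt => /lam_mono.
    * by move=> l; rewrite inE ltnS -jE => /mu_mono.
- have pm : (p <= m)%N by rewrite leqNgt mp.
  have lm : lam m < 0 := (lam_sign m).2 pm.
  rewrite ler_distl; apply/andP; split.
  + suff : - mu j <= - lam m + tau by lra.
    apply: (weyl_upper UU VV AEN tau0 EtauN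
      (SU := [set l : 'I_d | (m.+1 <= l)%N]) (SV := [set l : 'I_n | (j <= l)%N])).
    * by rewrite !card_ord_ge //; lia.
    * by rewrite oppr_ge0 ltW.
    * by move=> l; rewrite inE -ltnNge ltnS lerN2 => /lam_mono.
    * by move=> l; rewrite inE lerN2 => /mu_mono.
  + suff : - lam m <= - mu j + tau by lra.
    apply: (weyl_lower UU VV AEN tau0 EtauN
      (SU := [set l : 'I_d | (m <= l)%N]) (SV := [set l : 'I_n | (j.+1 <= l)%N])).
    * by rewrite !card_ord_ge //; lia.
    * by move=> l; rewrite inE lerN2 => /lam_mono.
    * by move=> l; rewrite inE -ltnNge ltnS lerN2 => /mu_mono.
Qed.

End WeylSelected.

(** * Uniform big-O calculus *)

Section BigO.
Variables (R : realFieldType) (T : Type).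
Implicit Types f g h : T -> R.

(* [T] will index the size [n], the outcome [w] and an entry at once, so that the
   constant is uniform in all three. *)
Definition bO f g := exists2 K : R, 0 <= K & forall t, `|f t| <= K * g t.

Lemma bO_ext f f' g : (forall t, f t = f' t) -> bO f g -> bO f' g.
Proof. by move=> e [K K0 H]; exists K => // t; rewrite -e. Qed.

Lemma bO_le f g h : bO f g -> (forall t, g t <= h t) -> bO f h.
Proof.
move=> [K K0 H] gh; exists K => // t; apply: le_trans (H t) _.
by rewrite ler_wpM2l.
Qed.

Lemma bO_leZ f g h (C : R) : 0 <= C -> bO f g -> (forall t, g t <= C * h t) -> bO f h.
Proof.
move=> C0 [K K0 H] gh; exists (K * C) => [|t]; first exact: mulr_ge0.
by apply: le_trans (H t) _; rewrite -mulrA ler_wpM2l.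
Qed.

Lemma bO_bound f g (K : R) : 0 <= K -> (forall t, `|f t| <= K * g t) -> bO f g.
Proof. by exists K. Qed.

Lemma bO_leE f g : (forall t, `|f t| <= g t) -> bO f g.
Proof. by move=> H; exists 1 => // t; rewrite mul1r. Qed.

Lemma bO_norm f f' g : bO f' g -> (forall t, `|f t| <= `|f' t|) -> bO f g.
Proof. by move=> [K K0 H] ff; exists K => // t; apply: le_trans (ff t) (H t). Qed.

Lemma bO_add f f' g : bO f g -> bO f' g -> bO (fun t => f t + f' t) g.
Proof.
move=> [K K0 H] [K' K'0 H']; exists (K + K') => [|t]; first exact: addr_ge0.
by rewrite mulrDl; apply: le_trans (ler_normD _ _) _; exact: lerD.
Qed.

Lemma bO_opp f g : bO f g -> bO (fun t => - f t) g.
Proof. by move=> [K K0 H]; exists K => // t; rewrite normrN. Qed.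

Lemma bO_sub f f' g : bO f g -> bO f' g -> bO (fun t => f t - f' t) g.
Proof. by move=> Hf /bO_opp Hf'; exact: (bO_add Hf Hf'). Qed.

Lemma bO_mul f f' g g' : bO f g -> bO f' g' -> bO (fun t => f t * f' t) (fun t => g t * g' t).
Proof.
move=> [K K0 H] [K' K'0 H']; exists (K * K') => [|t]; first exact: mulr_ge0.
by rewrite normrM mulrACA; apply: ler_pM.
Qed.

Lemma bO_mul1 f f' g : bO f (fun=> 1) -> bO f' g -> bO (fun t => f t * f' t) g.
Proof. by move=> Hf Hf'; apply: (bO_le (bO_mul Hf Hf')) => t; rewrite mul1r. Qed.

Lemma bO_cst (c : R) : bO (fun=> c) (fun=> 1).
Proof. by exists `|c| => // t; rewrite mulr1. Qed.

Lemma bO_Z (c : R) f g : bO f g -> bO (fun t => c * f t) g.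
Proof. exact: bO_mul1 (bO_cst c). Qed.

Lemma bO_X f g r : bO f g -> bO (fun t => f t ^+ r) (fun t => g t ^+ r).
Proof.
move=> [K K0 H]; exists (K ^+ r) => [|t]; first exact: exprn_ge0.
by rewrite normrX -exprMn lerXn2r ?nnegrE // (le_trans (normr_ge0 _) (H t)).
Qed.

Lemma bO_sum (I : eqType) (s : seq I) (Q : pred I) (f : I -> T -> R) g :
  (forall t, 0 <= g t) -> (forall i, Q i -> bO (f i) g) ->
  bO (fun t => \sum_(i <- s | Q i) f i t) g.
Proof.
move=> g0 H; elim: s => [|i s IH].
  by exists 0 => // t; rewrite big_nil normr0 mul0r.
case: (boolP (Q i)) => Qi; last by apply: bO_ext IH => t; rewrite big_cons (negPf Qi).
by apply: bO_ext (bO_add (H i Qi) IH) => t; rewrite big_cons Qi.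
Qed.

Lemma bO_inv f (c : R) : 0 < c -> (forall t, c <= `|f t|) -> bO (fun t => (f t)^-1) (fun=> 1).
Proof.
move=> c0 H; exists c^-1 => [|t]; first by rewrite invr_ge0 ltW.
rewrite mulr1 normfV lef_pV2 ?posrE //; exact: lt_le_trans (H t).
Qed.

End BigO.

(** * Entrywise expansion of a perturbed eigenvector *)

(* All quantities are divided by the eigengap: eigenvalues and gaps of the signal
   are at least [1] and the noise has operator norm at most [delta <= 1/4]. *)
Section Eigenvector.
Variables (R : rcfType) (T : Type) (d : nat) (m : 'I_d) (n : T -> nat).
Variables (U : forall t, 'M[R]_(n t, d)) (lam : T -> 'I_d -> R) (E : forall t, 'M[R]_(n t)).
Variables (uh : forall t, 'cV[R]_(n t)) (lh : T -> R) (delta : T -> R) (lam_ratio : R).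
Hypothesis UU : forall t, (U t)^T *m U t = 1%:M.
Hypothesis Esym : forall t, (E t)^T = E t.
Hypothesis Edelta : forall t x, dot (E t *m x) (E t *m x) <= delta t ^+ 2 * dot x x.
Hypothesis eig : forall t,
  U t *m diag_mx (\row_l lam t l) *m (U t)^T *m uh t + E t *m uh t = lh t *: uh t.
Hypothesis uh1 : forall t, dot (uh t) (uh t) = 1.
Hypothesis delta01 : forall t, 0 <= delta t <= 1 / 4.
Hypothesis lam_ge : forall t l, 1 <= `|lam t l|.
Hypothesis lam_le : forall t l, `|lam t l| <= lam_ratio.
Hypothesis lam_gap : forall t l l', l != l' -> 1 <= `|lam t l - lam t l'|.
Hypothesis lh_close : forall t, `|lh t - lam t m| <= delta t.
Hypothesis sgn : forall t, 0 <= dot (col m (U t)) (uh t).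

Let u t l := col l (U t).
(** [a] collects the coordinates of [uh] in the signal basis. The unknown [w] is later replaced by
    [xx + yy], linear and quadratic in [E]; the division in [yy] comes from the second step of the
    iterated eigen-equation. *)
Let a l t := dot (u t l) (uh t).
Let w l t := dot (u t l) (E t *m uh t).
Let xx l t := dot (u t l) (E t *m u t m).
Let yy l t := dot (u t l) (E t *m (E t *m u t m)) / lam t m.

Let d0 t : 0 <= delta t. Proof. by case/andP: (delta01 t). Qed.
Let d1 t : delta t <= 1 / 4. Proof. by case/andP: (delta01 t). Qed.

Let dot_u t l l' : dot (u t l) (u t l') = (l == l')%:R.
Proof.
have := UU t => /matrixP/(_ l l'); rewrite !mxE => <-.
by apply: eq_bigr => i _; rewrite !mxE.
Qed.

Let UTx t x l : ((U t)^T *m x) l 0 = dot (u t l) x.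
Proof. by rewrite mxE; apply: eq_bigr => i _; rewrite !mxE. Qed.

Let Pu t : U t *m diag_mx (\row_l lam t l) *m (U t)^T *m uh t =
  \sum_l (lam t l * a l t) *: u t l.
Proof.
apply/colP => i; rewrite -!mulmxA mxE summxE; apply: eq_bigr => l _.
by rewrite mul_diag_mx mxE UTx !mxE mulrC.
Qed.

Let lh_inv t : 1 / 2 <= `|lh t|.
Proof.
have := lam_ge t m; have := lh_close t; have := d1 t.
have := ler_normB (lh t) (lh t - lam t m); rewrite subKr.
lra.
Qed.

Let lh0 t : lh t != 0.
Proof. by rewrite -normr_gt0 (lt_le_trans _ (lh_inv t)) //; lra. Qed.

Let lam0 t l : lam t l != 0.
Proof. by rewrite -normr_gt0 (lt_le_trans ltr01 (lam_ge t l)). Qed.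

Let bO_lhV : bO (fun t => (lh t)^-1) (fun=> 1).
Proof. by apply: (@bO_inv _ _ _ (1 / 2)) => //; lra. Qed.

Let bO_lamV l : bO (fun t => (lam t l)^-1) (fun=> 1).
Proof. by apply: (@bO_inv _ _ _ 1) => //. Qed.

Let bO_lam l : bO (fun t => lam t l) (fun=> 1).
Proof.
exists `|lam_ratio| => // t; rewrite mulr1; apply: le_trans (lam_le t l) _; exact: ler_norm.
Qed.

Let lh_gap t l : l != m -> 1 / 2 <= `|lh t - lam t l|.
Proof.
move=> lm; have := lam_gap t lm; have := lh_close t; have := d1 t.
have := ler_normB (lh t - lam t l) (lh t - lam t m).
rewrite (_ : lh t - lam t l - (lh t - lam t m) = - (lam t l - lam t m)); last by ring.
rewrite normrN; lra.
Qed.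

Let bO_gapV l : l != m -> bO (fun t => (lh t - lam t l)^-1) (fun=> 1).
Proof. by move=> lm; apply: (@bO_inv _ _ _ (1 / 2)) => [|t]; [lra|exact: lh_gap]. Qed.

Let bO_gap0V l : l != m -> bO (fun t => (lam t m - lam t l)^-1) (fun=> 1).
Proof.
by move=> lm; apply: (@bO_inv _ _ _ 1) => // t; apply: lam_gap; rewrite eq_sym.
Qed.

Let w_bound l t : `|w l t| <= delta t.
Proof.
have := @opnorm_dot _ _ (E t) (delta t) (d0 t) (@Edelta t) (u t l) (uh t) 1 1.
by rewrite dot_u eqxx uh1 expr1n lexx !mulr1; apply.
Qed.

(** Projection of the eigen-equation on [u_l]. For [l != m] it determines the coordinate [a l], for
    [l = m] the eigenvalue shift. *)
Let a_eq l t : (lh t - lam t l) * a l t = w l t.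
Proof.
have := congr1 (dot (u t l)) (eig t); rewrite Pu dotDr dotZr dot_sumr.
rewrite (bigD1 l) //= big1; last first.
  by move=> l' /negPf l'l; rewrite dotZr dot_u eq_sym l'l mulr0.
rewrite dotZr dot_u eqxx mulr1 addr0 -/(a l t) -/(w l t) => h.
by rewrite mulrBl -h; ring.
Qed.

Lemma bO_delta l : bO (w l) delta.
Proof. by apply: bO_leE => t; exact: w_bound. Qed.

Lemma bO_coef_off l : l != m -> bO (a l) delta.
Proof.
move=> lm; apply: bO_ext (bO_mul1 (bO_gapV lm) (bO_delta l)) => t.
rewrite -a_eq mulKf // -normr_gt0 (lt_le_trans _ (lh_gap t lm)) //; lra.
Qed.

Let z t := uh t - U t *m ((U t)^T *m uh t).

Let zz_eq t : dot (z t) (z t) = 1 - \sum_l a l t ^+ 2.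
Proof.
have e1 : dot (uh t) (U t *m ((U t)^T *m uh t)) = \sum_l a l t ^+ 2.
  by rewrite dot_mulmx; apply: eq_bigr => l _; rewrite UTx expr2.
have e2 : dot (U t *m ((U t)^T *m uh t)) (U t *m ((U t)^T *m uh t)) = \sum_l a l t ^+ 2.
  rewrite dot_mulmx mulmxA UU mul1mx; apply: eq_bigr => l _; by rewrite UTx expr2.
rewrite /z !(dotBl, dotBr) uh1 e2 (dotC (U t *m _)) e1; ring.
Qed.

(** Off the signal space the eigen-equation reads [lh z = (1 - U U^T) E uh]; this is Pythagoras for
    that vector. *)
Let zz_eq2 t : lh t ^+ 2 * dot (z t) (z t) =
  dot (E t *m uh t) (E t *m uh t) - \sum_l w l t ^+ 2.
Proof.
have EE : E t *m uh t = lh t *: uh t - \sum_l (lam t l * a l t) *: u t l.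
  by rewrite -Pu -eig addrC addKr.
have e1 : dot (uh t) (\sum_l (lam t l * a l t) *: u t l) = \sum_l lam t l * a l t ^+ 2.
  by rewrite dot_sumr; apply: eq_bigr => l _; rewrite dotZr dotC expr2 mulrA.
have e2 : dot (\sum_l (lam t l * a l t) *: u t l) (\sum_l (lam t l * a l t) *: u t l) =
    \sum_l lam t l ^+ 2 * a l t ^+ 2.
  rewrite dot_sumr; apply: eq_bigr => l _; rewrite dotZr dotC dot_sumr (bigD1 l) //= big1.
    by rewrite dotZr dot_u eqxx mulr1 addr0; ring.
  by move=> l' /negPf l'l; rewrite dotZr dot_u eq_sym l'l mulr0.
rewrite zz_eq EE !(dotBl, dotBr) !(dotZl, dotZr) uh1 e2 (dotC _ (uh t)) e1.
under [X in _ = _ - X]eq_bigr => l _ do rewrite -a_eq exprMn sqrrB !mulrDl.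
rewrite !big_split /= -mulr_sumr mulrBr mulr1.
under [X in _ = _ - (_ + X + _)]eq_bigr => l _.
  rewrite (_ : - (lh t * lam t l *+ 2) * a l t ^+ 2 = (- (lh t *+ 2)) * (lam t l * a l t ^+ 2)); last by ring.
over.
rewrite -mulr_sumr; ring.
Qed.

(** [1 - a m ^ 2] is the squared norm of what [uh] has besides [u_m]: the part [z] off the signal
    space and the other coordinates, all of order [delta]. The sign convention gives
    [0 <= a m <= 1], hence [1 - a m <= 1 - a m ^ 2]. *)
Lemma bO_coef_main : bO (fun t => 1 - a m t) (fun t => delta t ^+ 2).
Proof.
have zb t : dot (z t) (z t) <= 4 * delta t ^+ 2.
  have h1 : dot (E t *m uh t) (E t *m uh t) <= delta t ^+ 2.
    by apply: le_trans (Edelta (uh t)) _; rewrite uh1 mulr1.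
  have h2 : 0 <= \sum_l w l t ^+ 2 by apply: sumr_ge0 => l _; exact: sqr_ge0.
  have h3 := zz_eq2 t; have h4 := lh_inv t.
  have h5 : 1 / 4 <= lh t ^+ 2.
    rewrite -real_normK ?num_real //; rewrite expr2; nra.
  have := dot_ge0 (z t); nra.
have zO : bO (fun t => dot (z t) (z t)) (fun t => delta t ^+ 2).
  by exists 4 => // t; rewrite ger0_norm ?dot_ge0.
have aO : bO (fun t => \sum_(l | l != m) a l t ^+ 2) (fun t => delta t ^+ 2).
  apply: bO_sum => [t|l lm]; first exact: sqr_ge0.
  exact: (bO_X 2 (bO_coef_off lm)).
apply: bO_norm (bO_add zO aO) _ => t.
have -> : dot (z t) (z t) + \sum_(l | l != m) a l t ^+ 2 = 1 - a m t ^+ 2.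
  by rewrite zz_eq (bigD1 m) //=; ring.
have a0 := sgn t; rewrite -/(a m t) in a0.
have a1 : a m t ^+ 2 <= 1.
  have := dot_ge0 (z t); rewrite zz_eq (bigD1 m) //=.
  have : 0 <= \sum_(l | l != m) a l t ^+ 2 by apply: sumr_ge0 => l _; exact: sqr_ge0.
  lra.
have a1' : a m t <= 1 by rewrite -(ler_sqr a0) ?nnegrE // expr1n.
rewrite !ger0_norm ?subr_ge0 //; nra.
Qed.

(** Coefficient of [u_m] in the term [r = 0] of [expansion]. *)
Let alpha t := (lh t)^-1 * lam t m * a m t.

Let bO_lh : bO (fun t => lh t - lam t m) delta.
Proof. exact: bO_leE. Qed.

Let bO_a l : bO (a l) (fun=> 1).
Proof.
have [->|lm] := eqVneq l m.
  have h : bO (fun t => 1 - a m t) (fun=> 1).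
    apply: bO_le bO_coef_main _ => t; have := d0 t; have := d1 t; nra.
  by apply: bO_ext (bO_sub (bO_cst _ 1) h) => t; ring.
by apply: bO_le (bO_coef_off lm) _ => t; have := d1 t; lra.
Qed.

Let bO_alpha : bO (fun t => alpha t - 1) delta.
Proof.
have h1 : bO (fun t => 1 - a m t) delta.
  by apply: bO_le bO_coef_main _ => t; have := d0 t; have := d1 t; nra.
have h2 := bO_mul1 bO_lhV (bO_opp (bO_add bO_lh (bO_mul1 (bO_lam m) h1))).
by apply: bO_ext h2 => t; rewrite /alpha; field.
Qed.

Let Pv t := \sum_l (lam t l * a l t) *: u t l.

(** The entries of [uh] are unknown, so on the right [uh] is left only behind [N] factors of [E],
    where its norm suffices. Elsewhere it enters through the coordinates [a l], and [E] acts on the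
    fixed vectors [u_l]. *)
Lemma expansion N t : uh t = \sum_(r < N) (lh t)^-1 ^+ r.+1 *: powv (E t) r (Pv t) +
   (lh t)^-1 ^+ N *: powv (E t) N (uh t).
Proof.
elim: N => [|N IH]; first by rewrite big_ord0 add0r scale1r.
rewrite big_ord_recr /= -addrA {1}IH; congr (_ + _).
have uE : uh t = (lh t)^-1 *: (Pv t + E t *m uh t).
  by rewrite /Pv -Pu eig scalerA mulVf // scale1r.
rewrite [in LHS]uE powvZ powvD -powvSr scalerA -exprSr scalerDr //.
Qed.

Variables (i : forall t, 'I_(n t)) (nu : T -> R).
Hypothesis nu0 : forall t, 0 <= nu t.

Let e r l t := powv (E t) r (u t l) (i t) 0.

Let entry_Pv r t : powv (E t) r (Pv t) (i t) 0 = \sum_l lam t l * a l t * e r l t.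
Proof. by rewrite powv_sum summxE; apply: eq_bigr => l _; rewrite powvZ mxE. Qed.

Section Entry.
Variable N : nat.
Hypothesis Ee : forall t l r, (r < N)%N -> `|e r l t| <= delta t ^+ r * nu t.
Hypothesis rem : forall t, (2 * delta t) ^+ N <= delta t ^+ 3 * nu t.

Let rm t := (lh t)^-1 ^+ N * powv (E t) N (uh t) (i t) 0.

Let bO_rm : bO rm (fun t => delta t ^+ 3 * nu t).
Proof.
(* The [2] in [rem] bounds [1 / lh], since [lh] is at least [1 / 2] in absolute value. *)
apply: bO_leE => t; apply: le_trans (rem t); rewrite normrM exprMn.
apply: ler_pM => //.
  rewrite normrX normfV; apply: lerXn2r; rewrite ?nnegrE ?invr_ge0 //.
  by rewrite -[leRHS]invrK lef_pV2 ?posrE ?normr_gt0 // ?invr_gt0; have := lh_inv t; lra.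
apply: entry_le; first exact: exprn_ge0.
by apply: le_trans (powv_norm _ _ (@Edelta t)) _; rewrite uh1 mulr1.
Qed.

Let bO_e r l : (r < N)%N -> bO (e r l) (fun t => delta t ^+ r * nu t).
Proof. by move=> rN; apply: bO_leE => t; exact: Ee. Qed.

Let term r t := \sum_l (lh t)^-1 ^+ r.+1 * (lam t l * a l t * e r l t).

Let dnu_ge0 r t : 0 <= delta t ^+ r * nu t.
Proof. by rewrite mulr_ge0 ?exprn_ge0. Qed.

Let bO_lhVX r : bO (fun t => (lh t)^-1 ^+ r) (fun=> 1).
Proof. by apply: bO_le (bO_X r bO_lhV) _ => t; rewrite expr1n. Qed.

Let bO_lama l : bO (fun t => lam t l * a l t) (fun=> 1).
Proof. exact: bO_mul1. Qed.

Let bO_term r : (r < N)%N -> bO (term r) (fun t => delta t ^+ r * nu t).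
Proof.
move=> rN; apply: bO_sum => // l _.
by apply: bO_mul1 => //; apply: bO_mul1 => //; exact: bO_e.
Qed.

Let delta_pow_le r s t : (s <= r)%N -> delta t ^+ r <= delta t ^+ s.
Proof.
by move=> sr; apply: ler_wiXn2l => //; have := d1 t; lra.
Qed.

Let bO_terms s : bO (fun t => \sum_(s <= r < N) term r t) (fun t => delta t ^+ s * nu t).
Proof.
have H r : (s <= r)%N && (r < N)%N -> bO (term r) (fun t => delta t ^+ s * nu t).
  move=> /andP[sr rN]; apply: bO_le (bO_term rN) _ => t.
  by rewrite ler_wpM2r // delta_pow_le.
have := @bO_sum _ _ _ (index_iota s N) (fun r => (s <= r)%N && (r < N)%N) term
  (fun t => delta t ^+ s * nu t) (fun t => dnu_ge0 s t) H.
by apply: bO_ext => t; rewrite -big_nat.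
Qed.

Let entry_expansion s t : (s <= N)%N ->
  uh t (i t) 0 = \sum_(0 <= r < s) term r t + \sum_(s <= r < N) term r t + rm t.
Proof.
move=> sN; rewrite -big_cat_nat // {1}(expansion N t) mxE summxE big_mkord mxE.
by congr (_ + _); apply: eq_bigr => r _; rewrite mxE entry_Pv mulr_sumr.
Qed.

(** In the term [r = 0] the coefficient of [u_m] is [1] and those of the other [u_l] are [0], up to
    [delta]; every later term carries a factor [delta] of its own. *)
Lemma eigenvector_entry : (0 < N)%N ->
  bO (fun t => uh t (i t) 0 - e 0 m t) (fun t => delta t * nu t).
Proof.
move=> N0.
have h1 : bO (fun t => (alpha t - 1) * e 0 m t) (fun t => delta t * nu t).
  by apply: bO_le (bO_mul bO_alpha (bO_e m N0)) _ => t; rewrite expr0 mul1r.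
have h2 : bO (fun t => \sum_(l | l != m) (lh t)^-1 ^+ 1 * (lam t l * a l t * e 0 l t))
    (fun t => delta t * nu t).
  apply: bO_sum => [t|l lm]; first exact: mulr_ge0.
  have h := bO_mul (bO_coef_off lm) (bO_e l N0).
  apply: bO_ext (bO_le (bO_mul1 (bO_mul1 bO_lhV (bO_lam l)) h) _) => t.
    by rewrite expr1; ring.
  by rewrite expr0 mul1r.
have h3 := bO_terms 1.
have h4 : bO rm (fun t => delta t * nu t).
  by apply: bO_le bO_rm _ => t; rewrite ler_wpM2r // -[leRHS]expr1 delta_pow_le.
have h5 : bO (fun t => \sum_(1 <= r < N) term r t) (fun t => delta t * nu t).
  by apply: bO_le h3 _ => t; rewrite expr1.
apply: bO_ext (bO_add (bO_add (bO_add h1 h2) h5) h4) => t.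
have E0 : term 0 t = (lh t)^-1 ^+ 1 * (lam t m * a m t * e 0 m t) +
    \sum_(l | l != m) (lh t)^-1 ^+ 1 * (lam t l * a l t * e 0 l t).
  by rewrite /term (bigD1 m).
rewrite [in RHS](entry_expansion t N0) big_nat1 E0 /alpha expr1; ring.
Qed.

Section SecondOrder.
Variable gam : T -> R.
Hypothesis gam_ge0 : forall t, 0 <= gam t.
Hypothesis gam_le : forall t, gam t <= delta t.
Hypothesis Egam : forall t l l', `|dot (u t l) (E t *m u t l')| <= gam t.
Hypothesis N3 : (3 <= N)%N.

(** [zt] bounds the eigenvalue shift and the coordinates off [u_m]; [om], which equals [delta zt],
    is the admissible error. Products of two quantities of size [zt] are already negligible at that
    scale. *)
Let om t := delta t * gam t + delta t ^+ 3.
Let zt t := gam t + delta t ^+ 2.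

Let dg t : delta t * gam t <= om t.
Proof. by rewrite lerDl exprn_ge0. Qed.

Let d3 t : delta t ^+ 3 <= om t.
Proof. by rewrite lerDr mulr_ge0. Qed.

Let om0 t : 0 <= om t. Proof. exact: le_trans (mulr_ge0 _ _) (dg t). Qed.

Let zt0 t : 0 <= zt t. Proof. by rewrite addr_ge0 // exprn_ge0. Qed.

Let dz t : delta t * zt t = om t.
Proof. by rewrite mulrDr -exprS. Qed.

Let zd t : zt t <= 2 * delta t.
Proof.
have := d0 t; have := d1 t; have := gam_le t; rewrite /zt expr2; nra.
Qed.

Let z2 t : zt t * zt t <= 2 * om t.
Proof. by rewrite -dz mulrA ler_wpM2r. Qed.

Let d22 t : delta t ^+ 2 * delta t <= om t.
Proof. by rewrite -exprSr. Qed.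

Let d31 t : delta t * delta t ^+ 2 <= om t.
Proof. by rewrite -exprS. Qed.

Let Enorm r t y c : 0 <= c -> dot y y <= c ^+ 2 ->
  dot (powv (E t) r y) (powv (E t) r y) <= (delta t ^+ r * c) ^+ 2.
Proof.
move=> c0 yc; apply: le_trans (powv_norm _ _ (@Edelta t)) _.
by rewrite exprMn ler_wpM2l // sqr_ge0.
Qed.

Let bO_upow r (y : forall t, 'cV[R]_(n t)) l : (forall t, dot (y t) (y t) = 1) ->
  bO (fun t => dot (u t l) (powv (E t) r (y t))) (fun t => delta t ^+ r).
Proof.
move=> y1; apply: bO_leE => t; rewrite -[leRHS]mul1r; apply: dot_le => //.
- exact: exprn_ge0.
- by rewrite dot_u eqxx expr1n.
- by rewrite -[delta t ^+ r]mulr1; apply: Enorm => //; rewrite y1 expr1n.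
Qed.

Let u1 t l : dot (u t l) (u t l) = 1. Proof. by rewrite dot_u eqxx. Qed.

Let bO_x l : bO (xx l) gam.
Proof. by apply: bO_leE => t; exact: Egam. Qed.

Let bO_y l : bO (yy l) (fun t => delta t ^+ 2).
Proof.
have h := bO_mul1 (bO_lamV m) (@bO_upow 2 (fun t => u t m) l (fun t => u1 t m)).
by apply: bO_ext h => t; rewrite mulrC.
Qed.

Let bO_xy l : bO (fun t => xx l t + yy l t) zt.
Proof.
apply: bO_add.
  by apply: bO_le (bO_x l) _ => t; rewrite lerDl exprn_ge0.
by apply: bO_le (bO_y l) _ => t; rewrite lerDr.
Qed.

Let Pv_pow r t l : dot (u t l) (powv (E t) r (Pv t)) =
  \sum_l' lam t l' * a l' t * dot (u t l) (powv (E t) r (u t l')).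
Proof. by rewrite powv_sum dot_sumr; apply: eq_bigr => l' _; rewrite powvZ dotZr. Qed.

(** Two steps of [expansion] are inserted into [w]. The contributions of [u_m] give [xx] and [yy],
    those of the other [u_l'] carry a coordinate of order [delta], and the rest has three factors of
    [E]. *)
Let bO_w_expand l : bO (fun t => w l t - (xx l t + yy l t)) om.
Proof.
have wE t : w l t = (lh t)^-1 * (\sum_l' lam t l' * a l' t * dot (u t l) (E t *m u t l')) +
    (lh t)^-1 ^+ 2 * (\sum_l' lam t l' * a l' t * dot (u t l) (powv (E t) 2 (u t l'))) +
    (lh t)^-1 ^+ 2 * dot (u t l) (powv (E t) 3 (uh t)).
  have := congr1 (fun v => dot (u t l) (E t *m v)) (expansion 2 t).
  rewrite !big_ord_recl big_ord0 addr0 /= !mulmxDr -!scalemxAr !dotDr !dotZr.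
  rewrite -(Pv_pow 1) -(Pv_pow 2) /w => {1}->; rewrite expr1; ring.
have h1 : bO (fun t => (lh t)^-1 * \sum_(l' | l' != m) lam t l' * a l' t *
    dot (u t l) (E t *m u t l')) om.
  apply: bO_mul1 => //; apply: bO_sum => [//|l' lm].
  have hg : bO (fun t => dot (u t l) (E t *m u t l')) gam by apply: bO_leE.
  apply: bO_ext (bO_le (bO_mul1 (bO_lam l') (bO_mul (bO_coef_off lm) hg)) dg) => t.
  by rewrite mulrA.
have h2 : bO (fun t => (lh t)^-1 ^+ 2 * \sum_(l' | l' != m) lam t l' * a l' t *
    dot (u t l) (powv (E t) 2 (u t l'))) om.
  apply: bO_mul1 => //; apply: bO_sum => [//|l' lm].
  have hg := @bO_upow 2 (fun t => u t l') l (fun t => u1 t l').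
  apply: bO_ext (bO_le (bO_mul1 (bO_lam l') (bO_mul (bO_coef_off lm) hg)) d31) => t.
  by rewrite mulrA.
have h3 : bO (fun t => (lh t)^-1 ^+ 2 * dot (u t l) (powv (E t) 3 (uh t))) om.
  by apply: bO_mul1 => //; apply: bO_le (bO_upow _ _ uh1) d3.
have h4 : bO (fun t => (alpha t - 1) * xx l t) om.
  exact: bO_le (bO_mul bO_alpha (bO_x l)) dg.
have h5 : bO (fun t => (alpha t * (lh t)^-1 * lam t m - 1) * yy l t) om.
  have h : bO (fun t => alpha t * (lh t)^-1 * lam t m - 1) delta.
    have k1 := bO_mul1 (bO_mul1 bO_lhV (bO_lam m)) bO_alpha.
    have k2 := bO_mul1 bO_lhV bO_lh.
    by apply: bO_ext (bO_sub k1 k2) => t; field.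
  exact: bO_le (bO_mul h (bO_y l)) d31.
apply: bO_ext (bO_add (bO_add (bO_add h1 h2) h3) (bO_add h4 h5)) => t.
have split (F : 'I_d -> R) : \sum_l F l = F m + \sum_(l | l != m) F l by rewrite (bigD1 m).
rewrite wE !split.
rewrite /yy /xx /alpha; field.
by rewrite lh0 lam0.
Qed.

Let bO_w l : bO (w l) zt.
Proof.
have h : bO (fun t => w l t - (xx l t + yy l t)) zt.
  apply: bO_le (bO_w_expand l) _ => t; rewrite -dz -[leRHS]mul1r ler_wpM2r //.
  by have := d1 t; lra.
by apply: bO_ext (bO_add h (bO_xy l)) => t; rewrite subrK.
Qed.

(** This is [a_eq] at [l = m], where replacing [a m] by [1] costs [delta * delta ^ 2]. *)
Let bO_shift : bO (fun t => lh t - lam t m - (xx m t + yy m t)) om.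
Proof.
have h : bO (fun t => (lh t - lam t m) * (1 - a m t)) om.
  exact: bO_le (bO_mul bO_lh bO_coef_main) d31.
apply: bO_ext (bO_add (bO_w_expand m) h) => t; rewrite -a_eq; ring.
Qed.

Let omz t : om t <= zt t.
Proof. by rewrite -dz -[leRHS]mul1r ler_wpM2r //; have := d1 t; lra. Qed.

Let bO_shift_zt : bO (fun t => lh t - lam t m) zt.
Proof.
by apply: bO_ext (bO_add (bO_le bO_shift omz) (bO_xy m)) => t; rewrite subrK.
Qed.

Let a_off l t : l != m -> a l t = w l t / (lh t - lam t l).
Proof.
move=> lm; rewrite -a_eq mulrC mulKf // -normr_gt0 (lt_le_trans _ (lh_gap t lm)) //; lra.
Qed.

Let gap0 l t : l != m -> lam t m - lam t l != 0.
Proof.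
by move=> lm; rewrite -normr_gt0 (lt_le_trans ltr01) // lam_gap // eq_sym.
Qed.

Let lgap0 l t : l != m -> lh t - lam t l != 0.
Proof.
move=> lm; rewrite -normr_gt0 (lt_le_trans _ (lh_gap t lm)) //; lra.
Qed.

Let bO_a_zt l : l != m -> bO (a l) zt.
Proof.
move=> lm; apply: bO_ext (bO_mul1 (bO_gapV lm) (bO_w l)) => t.
by rewrite a_off // mulrC.
Qed.

Let bO_a_off l : l != m -> bO (fun t => a l t - (xx l t + yy l t) / (lam t m - lam t l)) om.
Proof.
move=> lm.
have h1 := bO_mul1 (bO_gap0V lm) (bO_w_expand l).
have h2 := bO_mul1 (bO_mul1 (bO_gap0V lm) (bO_gapV lm))
  (bO_leZ (C := 2) ltac:(lra) (bO_mul bO_shift_zt (bO_w l)) z2).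
apply: bO_ext (bO_sub h1 h2) => t.
by rewrite a_off //; field; rewrite gap0 // lgap0.
Qed.

Let bO_uhu : bO (fun t => dot (uh t - u t m) (uh t - u t m)) (fun t => delta t ^+ 2).
Proof.
apply: bO_ext (bO_Z 2 bO_coef_main) => t.
by rewrite !(dotBl, dotBr) uh1 u1 (dotC (uh t)) -/(a m t); ring.
Qed.

(** Both terms are squared norms, of [E uh] and of [E u_m]. Their difference pairs [E (uh - u_m)],
    of norm of order [delta ^ 2], with a vector of norm at most [2 delta]. *)
Let bO_EE : bO (fun t => dot (E t *m uh t) (E t *m uh t) - lam t m * yy m t) om.
Proof.
have [K K0 HK] := bO_uhu.
have yE t : lam t m * yy m t = dot (E t *m u t m) (E t *m u t m).
  by rewrite /yy mulrC divfK // dot_mulmx Esym.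
exists (2 * (K + 1)) => [|t]; first by rewrite mulr_ge0 // addr_ge0.
have -> : dot (E t *m uh t) (E t *m uh t) - lam t m * yy m t =
    dot (E t *m (uh t - u t m)) (E t *m uh t + E t *m u t m).
  by rewrite yE mulmxBr !(dotBl, dotDr) (dotC (E t *m u t m)); ring.
have K1 : 0 <= K + 1 by rewrite addr_ge0.
have hb : dot (E t *m (uh t - u t m)) (E t *m (uh t - u t m)) <=
    (delta t * (delta t * (K + 1))) ^+ 2.
  apply: le_trans (Edelta _) _; rewrite [in leRHS]exprMn; apply: ler_wpM2l; first exact: sqr_ge0.
  have := HK t; rewrite ger0_norm ?dot_ge0 // => /le_trans; apply.
  rewrite exprMn mulrC ler_wpM2l ?sqr_ge0 // expr2; nra.
have hE x : dot x x = 1 -> dot (E t *m x) (E t *m x) <= delta t ^+ 2.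
  by move=> x1; apply: le_trans (Edelta _) _; rewrite x1 mulr1.
have hc := sqrt_dotD (d0 t) (d0 t) (hE _ (uh1 t)) (hE _ (u1 t m)).
apply: le_trans (dot_le _ _ hb hc) _.
- by rewrite !mulr_ge0.
- by rewrite addr_ge0.
have := d3 t; rewrite !exprS expr0 mulr1 => h.
have -> : delta t * (delta t * (K + 1)) * (delta t + delta t) =
  2 * (K + 1) * (delta t * (delta t * delta t)) by ring.
by rewrite ler_wpM2l // mulr_ge0.
Qed.

Let bO_lhV2 : bO (fun t => (lh t)^-1 ^+ 2 - (lam t m)^-1 ^+ 2) delta.
Proof.
have h1 := bO_mul1 (bO_mul1 bO_lhV (bO_lamV m)) bO_lh.
have h2 := bO_add bO_lhV (bO_lamV m).
apply: bO_ext (bO_opp (bO_mul1 h2 h1)) => t; field.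
by rewrite lh0 lam0.
Qed.

(** Effect of the normalisation: [1 - a m ^ 2] is [|z|^2] up to [om], and [|z|^2] is close to
    [|E u_m|^2 / lam_m^2], that is to [yy / lam_m]. Passing from [a m ^ 2] to [a m] halves it. *)
Let bO_am : bO (fun t => a m t - (1 - yy m t / (2 * lam t m))) om.
Proof.
have h1 : bO (fun t => \sum_(l | l != m) a l t ^+ 2) om.
  apply: bO_sum => // l lm.
  by apply: (bO_leZ (C := 2) _ (bO_mul (bO_a_zt lm) (bO_a_zt lm)) z2); lra.
have h2 : bO (fun t => \sum_l w l t ^+ 2) om.
  apply: bO_sum => // l lm.
  by apply: (bO_leZ (C := 2) _ (bO_mul (bO_w l) (bO_w l)) z2); lra.
have h3 : bO (fun t => ((lh t)^-1 ^+ 2 - (lam t m)^-1 ^+ 2) * (lam t m * yy m t)) om.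
  exact: bO_le (bO_mul bO_lhV2 (bO_mul1 (bO_lam m) (bO_y m))) d31.
have h4 : bO (fun t => dot (z t) (z t) - yy m t / lam t m) om.
  apply: bO_ext (bO_add (bO_mul1 (bO_lhVX 2) (bO_sub bO_EE h2)) h3) => t.
  have -> : dot (z t) (z t) = (lh t)^-1 ^+ 2 * (lh t ^+ 2 * dot (z t) (z t)).
    by field.
  rewrite zz_eq2; field; by rewrite lh0 lam0.
have h5 : bO (fun t => (1 - a m t) ^+ 2) om.
  apply: bO_le (bO_X 2 bO_coef_main) _ => t; apply: le_trans (d3 t).
  by rewrite -exprM delta_pow_le.
apply: bO_ext (bO_Z (- (1 / 2)) (bO_add (bO_add h4 h1) h5)) => t.
have -> : dot (z t) (z t) = 1 - (a m t ^+ 2 + \sum_(l | l != m) a l t ^+ 2).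
  by rewrite zz_eq (bigD1 m).
field; by rewrite lam0.
Qed.

(** Origin of the [3 / 2] in the bias formula: the eigenvalue shift in [lam_m / lh] contributes
    [yy / lam_m], and the normalisation in [a m] half as much again. The square of the shift is
    absorbed by [om]. *)
Let bO_alpha2 : bO (fun t => alpha t - (1 - xx m t / lam t m - 3 / 2 * (yy m t / lam t m))) om.
Proof.
have h1 : bO (fun t => (lam t m / lh t - 1) * (a m t - 1)) om.
  have k := bO_opp (bO_mul1 bO_lhV bO_lh).
  apply: bO_ext (bO_opp (bO_le (bO_mul k bO_coef_main) d31)) => t; by field.
have h2 := bO_mul1 (bO_mul1 (bO_lamV m) bO_lhV)
  (bO_leZ (C := 2) ltac:(lra) (bO_mul bO_shift_zt bO_shift_zt) z2).
have h3 := bO_mul1 (bO_lamV m) bO_shift.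
apply: bO_ext (bO_add (bO_add (bO_sub h2 h3) h1) bO_am) => t.
rewrite /alpha; field; by rewrite lh0 lam0.
Qed.

(** The entry [e r l] already has [r] factors of [delta], so coefficients are needed up to [om] for
    [r = 0], up to [zt] for [r = 1] and only up to [delta] for [r = 2]. The two subtracted brackets
    are the parts linear and quadratic in [E]. *)
Lemma eigenvector_second_order :
  bO (fun t => uh t (i t) 0 - e 0 m t
    - (e 1 m t / lam t m - xx m t / lam t m * e 0 m t
       + \sum_(l | l != m) lam t l / (lam t m * (lam t m - lam t l)) * xx l t * e 0 l t)
    - (e 2 m t / lam t m ^+ 2 - 3 / 2 * (yy m t / lam t m) * e 0 m t
       + \sum_(l | l != m) lam t l / (lam t m * (lam t m - lam t l)) * yy l t * e 0 l t))
   (fun t => om t * nu t).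
Proof.
have omn t : 0 <= om t * nu t by exact: mulr_ge0.
have hom f : bO f om -> forall r l, (r < N)%N -> bO (fun t => f t * e r l t) (fun t => om t * nu t).
  move=> hf r l rN; apply: bO_le (bO_mul hf (bO_e l rN)) _ => t.
  rewrite ler_wpM2l // -[leRHS]mul1r ler_wpM2r //.
  by have := delta_pow_le (r := r) (s := 0) t isT; rewrite expr0.
have hdz f l : bO f zt -> bO (fun t => f t * e 1 l t) (fun t => om t * nu t).
  move=> hf; apply: bO_le (bO_mul hf (bO_e l (leq_trans _ N3))) _ => // t.
  by rewrite expr1 mulrA (mulrC (zt t)) dz.
have hd2 f l : bO f delta -> bO (fun t => f t * e 2 l t) (fun t => om t * nu t).
  move=> hf; apply: bO_le (bO_mul hf (bO_e l (leq_trans _ N3))) _ => // t.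
  by rewrite mulrA ler_wpM2r // d31.
have h1 : bO (fun t => (alpha t - (1 - xx m t / lam t m - 3 / 2 * (yy m t / lam t m))) * e 0 m t)
   (fun t => om t * nu t) by apply: hom => //; exact: leq_trans N3.
have h2 : bO (fun t => (alpha t / lh t - (lam t m)^-1) * e 1 m t) (fun t => om t * nu t).
  apply: hdz.
  have k1 : bO (fun t => alpha t - 1) zt.
    have kx := bO_mul1 (bO_lamV m) (bO_le (bO_x m) (fun t => ltac:(by rewrite lerDl exprn_ge0) : gam t <= zt t)).
    have ky := bO_mul1 (bO_lamV m) (bO_le (bO_y m) (fun t => ltac:(by rewrite lerDr) : delta t ^+ 2 <= zt t)).
    by apply: bO_ext (bO_sub (bO_sub (bO_le bO_alpha2 omz) kx) (bO_Z (3 / 2) ky)) => t; field.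
  have k2 := bO_mul1 (bO_mul1 bO_lhV (bO_lamV m)) bO_shift_zt.
  apply: bO_ext (bO_sub (bO_mul1 bO_lhV k1) k2) => t; field; by rewrite lh0 lam0.
have h3 : bO (fun t => (alpha t / lh t ^+ 2 - (lam t m)^-1 ^+ 2) * e 2 m t) (fun t => om t * nu t).
  apply: hd2.
  apply: bO_ext (bO_add (bO_mul1 (bO_lhVX 2) bO_alpha) bO_lhV2) => t; field; by rewrite lh0 lam0.
have h4 : bO (fun t => \sum_(l | l != m)
   (lam t l * a l t / lh t - lam t l / (lam t m * (lam t m - lam t l)) * (xx l t + yy l t)) * e 0 l t)
   (fun t => om t * nu t).
  apply: bO_sum => // l lm; apply: hom; last exact: leq_trans N3.
  have k1 := bO_mul1 (bO_mul1 (bO_lam l) (bO_lamV m)) (bO_a_off lm).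
  have k2 := bO_mul1 (bO_mul1 (bO_mul1 (bO_lam l) (bO_lamV m)) bO_lhV)
    (bO_leZ (C := 2) ltac:(lra) (bO_mul bO_shift_zt (bO_a_zt lm)) z2).
  apply: bO_ext (bO_sub k1 k2) => t; field.
  by rewrite lh0 lam0 gap0.
have h5 : bO (fun t => \sum_(l | l != m) lam t l * a l t / lh t ^+ 2 * e 1 l t)
   (fun t => om t * nu t).
  apply: bO_sum => // l lm; apply: hdz.
  apply: bO_ext (bO_mul1 (bO_mul1 (bO_lam l) (bO_lhVX 2)) (bO_a_zt lm)) => t; by field.
have h6 : bO (fun t => \sum_(l | l != m) lam t l * a l t / lh t ^+ 3 * e 2 l t)
   (fun t => om t * nu t).
  apply: bO_sum => // l lm; apply: hd2.
  apply: bO_ext (bO_mul1 (bO_mul1 (bO_lam l) (bO_lhVX 3)) (bO_coef_off lm)) => t; by field.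
have h7 : bO (fun t => \sum_(3 <= r < N) term r t) (fun t => om t * nu t).
  by apply: bO_le (bO_terms 3) _ => t; rewrite ler_wpM2r.
have h8 : bO rm (fun t => om t * nu t).
  by apply: bO_le bO_rm _ => t; rewrite ler_wpM2r.
apply: bO_ext (bO_add (bO_add (bO_add (bO_add h1 h2) h3) (bO_add (bO_add h4 h5) h6)) (bO_add h7 h8)) => t.
rewrite [in RHS](entry_expansion t N3) !big_nat_recl // big_nil.
have tE r : term r t = (lh t)^-1 ^+ r.+1 * (lam t m * a m t * e r m t) +
    \sum_(l | l != m) (lh t)^-1 ^+ r.+1 * (lam t l * a l t * e r l t).
  by rewrite /term (bigD1 m).
rewrite !tE.
have s0 : \sum_(l | l != m) (lam t l * a l t / lh t -
      lam t l / (lam t m * (lam t m - lam t l)) * (xx l t + yy l t)) * e 0 l t =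
   \sum_(l | l != m) (lh t)^-1 ^+ 1 * (lam t l * a l t * e 0 l t) -
   \sum_(l | l != m) lam t l / (lam t m * (lam t m - lam t l)) * xx l t * e 0 l t -
   \sum_(l | l != m) lam t l / (lam t m * (lam t m - lam t l)) * yy l t * e 0 l t.
  rewrite -!sumrB; apply: eq_bigr => l lm; rewrite expr1; ring.
have s1 : \sum_(l | l != m) lam t l * a l t / lh t ^+ 2 * e 1 l t =
   \sum_(l | l != m) (lh t)^-1 ^+ 2 * (lam t l * a l t * e 1 l t).
  by apply: eq_bigr => l lm; field.
have s2 : \sum_(l | l != m) lam t l * a l t / lh t ^+ 3 * e 2 l t =
   \sum_(l | l != m) (lh t)^-1 ^+ 3 * (lam t l * a l t * e 2 l t).
  by apply: eq_bigr => l lm; field.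
rewrite s0 s1 s2 /alpha.
set q1 := \sum_(l | _) _; set q2 := \sum_(l | _) _; set q3 := \sum_(l | _) _.
set q4 := \sum_(l | _) _; set q5 := \sum_(l | _) _; set q6 := \sum_(3 <= r < N) _.
field; by rewrite lh0 lam0.
Qed.

End SecondOrder.

End Entry.

End Eigenvector.

(** * Stability of the bias formula *)

Section DotExtra.
Variable R : rcfType.

Lemma sqrt_dotZ n (x : 'cV[R]_n) a c : `|c| <= a -> dot (c *: x) (c *: x) <= a ^+ 2 * dot x x.
Proof.
move=> ca; rewrite dotZl dotZr mulrA -expr2 ler_wpM2r ?dot_ge0 //.
rewrite -(real_normK (num_real c)) lerXn2r ?nnegrE //; exact: le_trans ca.
Qed.

Lemma sqrt_dot_sum n (I : Type) (s : seq I) (x : I -> 'cV[R]_n) c : 0 <= c ->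
  (forall l, dot (x l) (x l) <= c ^+ 2) ->
  dot (\sum_(l <- s) x l) (\sum_(l <- s) x l) <= ((size s)%:R * c) ^+ 2.
Proof.
move=> c0 xc; elim: s => [|l s IH].
  by rewrite big_nil mul0r expr0n /= /dot big1 // => i _; rewrite mxE mul0r.
rewrite big_cons /= -natr1 mulrDl mul1r addrC; apply: sqrt_dotD => //.
by rewrite mulr_ge0.
Qed.

Lemma weighted_dot_le n (x y : 'cV[R]_n) (D : 'I_n -> R) M a b :
  0 <= M -> 0 <= a -> 0 <= b -> (forall j, `|D j| <= M) ->
  dot x x <= a ^+ 2 -> dot y y <= b ^+ 2 ->
  `|\sum_j x j 0 * D j * y j 0| <= M * (a * b).
Proof.
move=> M0 a0 b0 DM xa yb; pose z : 'cV[R]_n := \col_j (D j * y j 0).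
have -> : \sum_j x j 0 * D j * y j 0 = dot x z.
  by apply: eq_bigr => j _; rewrite mxE mulrA.
rewrite mulrCA; apply: dot_le => //; first exact: mulr_ge0.
rewrite exprMn; apply: (le_trans (y := M ^+ 2 * dot y y)); last first.
  by rewrite ler_wpM2l // sqr_ge0.
rewrite /dot mulr_sumr; apply: ler_sum => j _.
rewrite mxE -expr2 exprMn -expr2 ler_wpM2r ?sqr_ge0 //.
by rewrite -(real_normK (num_real (D j))) lerXn2r ?nnegrE.
Qed.

End DotExtra.

Section Near.
Variables (R : realFieldType) (T : Type) (eta : T -> R).
Hypothesis eta0 : forall t, 0 <= eta t.

(* [f'] approximates [f] with relative error [eta] at the scale [g]. *)
Definition near (f' f g : T -> R) :=
  [/\ bO (fun t => f' t - f t) (fun t => g t * eta t), bO f g & bO f' g].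

Lemma near_mul f' f g h' h k : near f' f g -> near h' h k ->
  near (fun t => f' t * h' t) (fun t => f t * h t) (fun t => g t * k t).
Proof.
move=> [f1 f2 f3] [h1 h2 h3]; split; [|exact: bO_mul|exact: bO_mul].
have e1 : bO (fun t => (f' t - f t) * h' t) (fun t => g t * k t * eta t).
  by apply: bO_le (bO_mul f1 h3) _ => t; rewrite mulrAC.
have e2 : bO (fun t => f t * (h' t - h t)) (fun t => g t * k t * eta t).
  by apply: bO_le (bO_mul f2 h1) _ => t; rewrite mulrA.
by apply: bO_ext (bO_add e1 e2) => t; ring.
Qed.

Lemma near_mul1 f' f h' h k : near f' f (fun=> 1) -> near h' h k ->
  near (fun t => f' t * h' t) (fun t => f t * h t) k.
Proof.
move=> Hf Hh; have [e1 e2 e3] := near_mul Hf Hh; split.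
- by apply: bO_le e1 _ => t; rewrite mul1r.
- by apply: bO_le e2 _ => t; rewrite mul1r.
- by apply: bO_le e3 _ => t; rewrite mul1r.
Qed.

Lemma near_add f' f h' h g : near f' f g -> near h' h g ->
  near (fun t => f' t + h' t) (fun t => f t + h t) g.
Proof.
move=> [f1 f2 f3] [h1 h2 h3]; split; [|exact: bO_add|exact: bO_add].
by apply: bO_ext (bO_add f1 h1) => t; ring.
Qed.

Lemma near_opp f' f g : near f' f g -> near (fun t => - f' t) (fun t => - f t) g.
Proof.
move=> [f1 f2 f3]; split; [|exact: bO_opp|exact: bO_opp].
by apply: bO_ext (bO_opp f1) => t; ring.
Qed.

Lemma near_sum (I : eqType) (s : seq I) (Q : pred I) (f' f : I -> T -> R) g :
  (forall t, 0 <= g t) -> (forall l, Q l -> near (f' l) (f l) g) ->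
  near (fun t => \sum_(l <- s | Q l) f' l t) (fun t => \sum_(l <- s | Q l) f l t) g.
Proof.
move=> g0 H; split.
- have h : bO (fun t => \sum_(l <- s | Q l) (f' l t - f l t)) (fun t => g t * eta t).
    by apply: bO_sum => [t|l /H []//]; apply: mulr_ge0.
  by apply: bO_ext h => t; rewrite sumrB.
- by apply: bO_sum => // l /H [].
- by apply: bO_sum => // l /H [].
Qed.

Lemma near_cst c : near (fun=> c) (fun=> c) (fun=> 1).
Proof.
split; [|exact: bO_cst|exact: bO_cst].
by exists 0 => // t; rewrite subrr normr0 mul0r.
Qed.

Lemma near_inv f' f (c : R) : 0 < c -> (forall t, c <= `|f t|) -> (forall t, c <= `|f' t|) ->
  bO (fun t => f' t - f t) eta ->
  near (fun t => (f' t)^-1) (fun t => (f t)^-1) (fun=> 1).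
Proof.
move=> c0 fc f'c h; have v := bO_inv c0 fc; have v' := bO_inv c0 f'c; split => //.
have nz (g : T -> R) t : c <= `|g t| -> g t != 0.
  by move=> gc; rewrite -normr_gt0 (lt_le_trans c0).
apply: bO_ext (bO_le (bO_opp (bO_mul1 (bO_mul1 v v') h)) _) => t; last by rewrite mul1r.
by field; rewrite !nz.
Qed.

End Near.

Section Bias.
Variables (R : rcfType) (T : Type) (d : nat) (n : T -> nat).
Variables (U : forall t, 'M[R]_(n t, d)) (lam : T -> 'I_d -> R) (E : forall t, 'M[R]_(n t)).
Variables (uh : forall t, 'I_d -> 'cV[R]_(n t)) (lh : T -> 'I_d -> R).
Variables (delta nu eta B : T -> R) (lam_ratio K : R).
Variable (D : forall t, 'cV[R]_(n t)).
Hypothesis UU : forall t l, dot (col l (U t)) (col l (U t)) = 1.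
Hypothesis uh1 : forall t l, dot (uh t l) (uh t l) = 1.
Hypothesis delta01 : forall t, 0 <= delta t <= 1 / 4.
Hypothesis lam_ge : forall t l, 1 <= `|lam t l|.
Hypothesis lam_le : forall t l, `|lam t l| <= lam_ratio.
Hypothesis lam_gap : forall t l l', l != l' -> 1 <= `|lam t l - lam t l'|.
Hypothesis lh_close : forall t l, `|lh t l - lam t l| <= delta t.
Hypothesis nu0 : forall t, 0 <= nu t.
Hypothesis U_nu : forall t l j, `|U t j l| <= nu t.
Hypothesis K0 : 0 <= K.
Hypothesis uh_entry : forall t l j, `|uh t l j 0 - U t j l| <= K * (delta t * nu t).
Hypothesis uh_norm : forall t l,
  dot (uh t l - col l (U t)) (uh t l - col l (U t)) <= (K * delta t) ^+ 2.
Hypothesis eta01 : forall t, 0 <= eta t <= 1.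
Hypothesis delta_eta : forall t, delta t <= eta t.
Hypothesis B0 : forall t, 0 <= B t.
Hypothesis dnB : forall t, delta t * nu t <= Num.sqrt (B t) * eta t.
Hypothesis D_B : forall t j, 0 <= D t j 0 <= B t.
Hypothesis E_D : forall t j, `|\sum_j' E t j j' ^+ 2 - D t j 0| <= B t * eta t.

Let d0 t : 0 <= delta t. Proof. by case/andP: (delta01 t). Qed.
Let d1 t : delta t <= 1 / 4. Proof. by case/andP: (delta01 t). Qed.
Let eta0 t : 0 <= eta t. Proof. by case/andP: (eta01 t). Qed.
Let eta1 t : eta t <= 1. Proof. by case/andP: (eta01 t). Qed.

Let low t (j j' : 'I_(n t)) := \sum_l lam t l * U t j l * U t j' l.
Let lowh t (j j' : 'I_(n t)) := \sum_l lh t l * uh t l j 0 * uh t l j' 0.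
Let Dh t (j : 'I_(n t)) := \sum_j' (low j j' + E t j j' - lowh j j') ^+ 2.

Let uh_nu t l j : `|uh t l j 0| <= (1 + K) * nu t.
Proof.
have := uh_entry l j; have := U_nu l j; have := ler_normD (uh t l j 0 - U t j l) (U t j l).
rewrite subrK => h1 h2 h3; have := nu0 t; have := d1 t; have := d0 t.
have : K * (delta t * nu t) <= K * nu t.
  by rewrite ler_wpM2l // -[leRHS]mul1r ler_wpM2r //; have := d1 t; lra.
lra.
Qed.

Let K1 := d%:R * (1 + K + `|lam_ratio| * K + `|lam_ratio| * K).

Let K1_ge0 : 0 <= K1.
Proof. by rewrite mulr_ge0 // !addr_ge0 // mulr_ge0. Qed.

(** In each rank-one term the eigenvalue, the entry [j] and the vector are replaced one at a time.
    The entrywise bound on [uh] makes the row error of order [delta nu]; closeness in norm alone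
    would only give [delta]. *)
Lemma low_rank_row t (j : 'I_(n t)) :
  \sum_j' (lowh j j' - low j j') ^+ 2 <= (K1 * (delta t * nu t)) ^+ 2.
Proof.
pose r l : 'cV[R]_(n t) := ((lh t l - lam t l) * uh t l j 0) *: uh t l +
  (lam t l * (uh t l j 0 - U t j l)) *: uh t l +
  (lam t l * U t j l) *: (uh t l - col l (U t)).
have -> : \sum_j' (lowh j j' - low j j') ^+ 2 = dot (\sum_l r l) (\sum_l r l).
  apply: eq_bigr => j' _; rewrite -expr2; congr (_ ^+ 2).
  rewrite summxE -sumrB; apply: eq_bigr => l _; rewrite !mxE; ring.
set c := (1 + K + `|lam_ratio| * K + `|lam_ratio| * K) * (delta t * nu t).
have dn0 : 0 <= delta t * nu t by exact: mulr_ge0.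
have c0 : 0 <= c by rewrite mulr_ge0 // !addr_ge0 // mulr_ge0.
have := @sqrt_dot_sum _ _ _ (index_enum 'I_d) r c c0.
rewrite (_ : size (index_enum 'I_d) = d) ; last by rewrite -sum1_size sum1_card card_ord.
rewrite /K1 -mulrA; apply => l.
have lv : `|lam t l| <= `|lam_ratio| by apply: le_trans (lam_le t l) _; exact: ler_norm.
have hz b b' : `|b| <= b' -> dot (b *: uh t l) (b *: uh t l) <= b' ^+ 2.
  by move=> hb; apply: le_trans (sqrt_dotZ _ hb) _; rewrite uh1 mulr1.
rewrite /c 2!(mulrDl _ _ (delta t * nu t)); apply: sqrt_dotD.
- by rewrite addr_ge0 // mulr_ge0 // ?addr_ge0 // mulr_ge0.
- by rewrite !mulr_ge0.
- apply: sqrt_dotD.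
  + by rewrite mulr_ge0 // addr_ge0.
  + by rewrite !mulr_ge0.
  + apply: hz.
    rewrite normrM (mulrCA (1 + K)); apply: ler_pM => //.
  + apply: hz.
    by rewrite normrM -mulrA; apply: ler_pM.
- apply: le_trans (@sqrt_dotZ _ _ _ (`|lam_ratio| * nu t) _ _) _.
    by rewrite normrM; apply: ler_pM.
  have -> : (`|lam_ratio| * K * (delta t * nu t)) ^+ 2 = (`|lam_ratio| * nu t) ^+ 2 * (K * delta t) ^+ 2 by ring.
  by rewrite ler_wpM2l ?sqr_ge0.
Qed.

Let KD := 4 * K1 + K1 ^+ 2 + 1.

(** A row of the residual is the row [g] of [E] minus the row [r] of the low-rank error, so its
    squared norm is [|g|^2 - 2 <g, r> + |r|^2]. In [KD], the [1] accounts for [|g|^2], [4 * K1] for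
    the cross term, as [|g|] is at most [2 sqrt B], and [K1 ^+ 2] for [|r|^2]. *)
Lemma Dhat_close t (j : 'I_(n t)) : `|Dh j - D t j 0| <= KD * (B t * eta t).
Proof.
pose g : 'cV[R]_(n t) := \col_j' E t j j'.
pose r : 'cV[R]_(n t) := \col_j' (lowh j j' - low j j').
have rr : dot r r <= (K1 * (Num.sqrt (B t) * eta t)) ^+ 2.
  have -> : dot r r = \sum_j' (lowh j j' - low j j') ^+ 2.
    by apply: eq_bigr => j' _; rewrite mxE expr2.
  apply: le_trans (low_rank_row j) _; apply: lerXn2r; rewrite ?nnegrE.
  - by apply: mulr_ge0 => //; apply: mulr_ge0.
  - by apply: mulr_ge0 => //; apply: mulr_ge0 => //; exact: sqrtr_ge0.
  - exact: ler_wpM2l.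
have gE : dot g g = \sum_j' E t j j' ^+ 2 by apply: eq_bigr => j' _; rewrite mxE expr2.
have gg : dot g g <= (2 * Num.sqrt (B t)) ^+ 2.
  rewrite gE exprMn sqr_sqrtr //; have := E_D j; rewrite ler_norml => /andP[_ h].
  have /andP[_ h2] := D_B j; have : B t * eta t <= B t by rewrite -[leRHS]mulr1 ler_wpM2l.
  by have := B0 t; lra.
have DhE : Dh j = dot g g - dot g r *+ 2 + dot r r.
  rewrite /Dh -sumrMnl -sumrB -big_split /=; apply: eq_bigr => j' _.
  by rewrite !mxE; ring.
have h1 := dot_le (mulr_ge0 (ler0n R 2) (sqrtr_ge0 (B t))) (mulr_ge0 K1_ge0 (mulr_ge0 (sqrtr_ge0 (B t)) (eta0 t))) gg rr.
have e1 : 2 * Num.sqrt (B t) * (K1 * (Num.sqrt (B t) * eta t)) = 2 * K1 * (B t * eta t).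
  by rewrite -{3}(sqr_sqrtr (B0 t)); ring.
rewrite e1 in h1.
have e2 : (K1 * (Num.sqrt (B t) * eta t)) ^+ 2 = K1 ^+ 2 * (B t * eta t ^+ 2).
  by rewrite -{2}(sqr_sqrtr (B0 t)); ring.
rewrite e2 in rr.
have h3 : B t * eta t ^+ 2 <= B t * eta t.
  by rewrite ler_wpM2l // expr2 -[leRHS]mulr1 ler_wpM2l.
have h4 : K1 ^+ 2 * (B t * eta t ^+ 2) <= K1 ^+ 2 * (B t * eta t).
  by rewrite ler_wpM2l // sqr_ge0.
have h5 := dot_ge0 r.
have h6 := E_D j; rewrite -gE in h6.
rewrite DhE /KD.
move: h4 (le_trans rr h4) h1 h6; set x := B t * eta t; move: (K1 ^+ 2) => k2.
move=> _ h4; rewrite !ler_norml => /andP[? ?] /andP[? ?]; apply/andP; split; lra.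
Qed.

Section Entry.
Variables (m : 'I_d) (i : forall t, 'I_(n t)).

Let KD0 : 0 <= KD.
Proof. by apply: addr_ge0 => //; apply: addr_ge0; [exact: mulr_ge0|exact: sqr_ge0]. Qed.

Let Dh_bound t j : `|@Dh t j| <= (1 + KD) * B t.
Proof.
have := Dhat_close j; have /andP[D0 DB] := D_B j.
have : KD * (B t * eta t) <= KD * B t by rewrite ler_wpM2l // -[leRHS]mulr1 ler_wpM2l.
rewrite !ler_norml => h /andP[h1 h2]; apply/andP; split; nra.
Qed.

Let S l t := \sum_j U t j l * D t j 0 * U t j m.
Let Sh l t := \sum_j uh t l j 0 * @Dh t j * uh t m j 0.

Let col_colE t l j : U t j l = col l (U t) j 0. Proof. by rewrite mxE. Qed.

(** Left vector, weight and right vector are replaced in turn; closeness in norm of the vectors is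
    enough here. *)
Let near_S l : near eta (Sh l) (S l) B.
Proof.
have u1 t l' : dot (col l' (U t)) (col l' (U t)) <= 1 ^+ 2 by rewrite UU expr1n.
have h1 t l' : dot (uh t l') (uh t l') <= 1 ^+ 2 by rewrite uh1 expr1n.
have DB t j : `|D t j 0| <= B t by have /andP[D0 DB] := D_B j; rewrite ger0_norm.
have SE t : S l t = \sum_j col l (U t) j 0 * D t j 0 * col m (U t) j 0.
  by apply: eq_bigr => j _; rewrite -!col_colE.
have Kd t : 0 <= K * delta t by exact: mulr_ge0.
have KD1 : 0 <= 1 + KD by rewrite addr_ge0.
split.
- have b1 : bO (fun t => \sum_j (uh t l - col l (U t)) j 0 * @Dh t j * uh t m j 0)
      (fun t => B t * eta t).
    apply: (@bO_bound _ _ _ _ ((1 + KD) * K)) => [|t]; first exact: mulr_ge0.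
    apply: le_trans (weighted_dot_le _ (Kd t) ler01 (@Dh_bound t) (@uh_norm t l) (h1 t m)) _.
      exact: mulr_ge0.
    rewrite mulr1 -!mulrA ler_wpM2l // mulrCA ler_wpM2l // mulrC.
    by rewrite mulrC ler_wpM2l.
  have b2 : bO (fun t => \sum_j col l (U t) j 0 * (@Dh t j - D t j 0) * uh t m j 0)
      (fun t => B t * eta t).
    apply: (@bO_bound _ _ _ _ KD) => [//|t].
    apply: le_trans (weighted_dot_le _ ler01 ler01 (@Dhat_close t) (@u1 t l) (h1 t m)) _.
      by apply: mulr_ge0 => //; exact: mulr_ge0.
    by rewrite !mulr1.
  have b3 : bO (fun t => \sum_j col l (U t) j 0 * D t j 0 * (uh t m - col m (U t)) j 0)
      (fun t => B t * eta t).
    apply: (@bO_bound _ _ _ _ K) => [//|t].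
    apply: le_trans (weighted_dot_le _ ler01 (Kd t) (@DB t) (@u1 t l) (@uh_norm t m)) _ => //.
    by rewrite mul1r mulrCA ler_wpM2l // ler_wpM2l.
  apply: bO_ext (bO_add (bO_add b1 b2) b3) => t.
  rewrite SE /Sh -sumrB -!big_split /=; apply: eq_bigr => j _.
  by rewrite !mxE; ring.
- apply: bO_leE => t; rewrite SE.
  apply: le_trans (weighted_dot_le _ ler01 ler01 (@DB t) (u1 t l) (u1 t m)) _ => //.
  by rewrite !mulr1.
- apply: (@bO_bound _ _ _ _ (1 + KD)) => [//|t].
  apply: le_trans (weighted_dot_le _ ler01 ler01 (@Dh_bound t) (h1 t l) (h1 t m)) _.
    exact: mulr_ge0.
  by rewrite !mulr1.
Qed.

Let near_D : near eta (fun t => @Dh t (i t)) (fun t => D t (i t) 0) B.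
Proof.
split.
- exact: bO_bound KD0 (fun t => Dhat_close (i t)).
- by apply: bO_leE => t; have /andP[D0 DB] := D_B (i t); rewrite ger0_norm.
- by apply: (@bO_bound _ _ _ _ (1 + KD)) => [|t]; [rewrite addr_ge0|exact: Dh_bound].
Qed.

Let near_u l : near eta (fun t => uh t l (i t) 0) (fun t => U t (i t) l) nu.
Proof.
split.
- apply: (@bO_bound _ _ _ _ K) => // t; apply: le_trans (uh_entry _ _) _.
  by rewrite ler_wpM2l // mulrC ler_wpM2l.
- exact: bO_leE.
- by apply: (@bO_bound _ _ _ _ (1 + K)) => [|t]; [rewrite addr_ge0|exact: uh_nu].
Qed.

Let near_lam l : near eta (fun t => lh t l) (fun t => lam t l) (fun=> 1).
Proof.
have h1 : bO (fun t => lh t l - lam t l) (fun t => 1 * eta t).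
  by apply: bO_leE => t; rewrite mul1r; apply: le_trans (lh_close t l) _.
have h2 : bO (fun t => lam t l) (fun=> 1).
  by exists `|lam_ratio| => // t; rewrite mulr1; apply: le_trans (lam_le t l) _; exact: ler_norm.
split => //; apply: bO_ext (bO_add (bO_le h1 _) h2) => t; first by rewrite subrK.
by rewrite mul1r.
Qed.

Let lh_ge t l : 1 / 2 <= `|lh t l|.
Proof.
have := lam_ge t l; have := lh_close t l; have := d1 t.
have := ler_normB (lh t l) (lh t l - lam t l); rewrite subKr; lra.
Qed.

Let near_lamV l : near eta (fun t => (lh t l)^-1) (fun t => (lam t l)^-1) (fun=> 1).
Proof.
apply: (near_inv (c := 1 / 2)) => [|t|t|]; first lra.
- by apply: le_trans (lam_ge t l); lra.
- exact: lh_ge.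
- by case: (near_lam l) => h _ _; apply: bO_le h _ => t; rewrite mul1r.
Qed.

Let near_gapV l : l != m ->
  near eta (fun t => (lh t m - lh t l)^-1) (fun t => (lam t m - lam t l)^-1) (fun=> 1).
Proof.
move=> lm; have ml : m != l by rewrite eq_sym.
apply: (near_inv (c := 1 / 2)) => [|t|t|]; first lra.
- by apply: le_trans (lam_gap t ml); lra.
- have := lam_gap t ml; have := lh_close t l; have := lh_close t m; have := d1 t.
  have := ler_normB (lh t m - lh t l) ((lh t m - lam t m) - (lh t l - lam t l)).
  have := ler_normB (lh t m - lam t m) (lh t l - lam t l).
  rewrite (_ : lh t m - lh t l - (lh t m - lam t m - (lh t l - lam t l)) = lam t m - lam t l); last by ring.
  lra.
- case: (near_lam l) => h _ _; case: (near_lam m) => h' _ _.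
  apply: bO_ext (bO_le (bO_sub h' h) _) => t; first by ring.
  by rewrite mul1r.
Qed.

(** Relative errors add up under products, and the number of factors and summands depends on [d]
    only, so one constant serves all indices. *)
Lemma bias_entry_close : bO (fun t =>
    (lh t m ^+ 2)^-1 * (@Dh t (i t) * uh t m (i t) 0 - 3 / 2 * uh t m (i t) 0 * Sh m t
      + \sum_(l | l != m) lh t l / (lh t m - lh t l) * uh t l (i t) 0 * Sh l t)
  - (lam t m ^+ 2)^-1 * (D t (i t) 0 * U t (i t) m - 3 / 2 * U t (i t) m * S m t
      + \sum_(l | l != m) lam t l / (lam t m - lam t l) * U t (i t) l * S l t))
  (fun t => B t * nu t * eta t).
Proof.
have BN t : 0 <= nu t * B t by exact: mulr_ge0.
have e0 := eta0.
have a1 := near_mul near_D (near_u m).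
have a2 := near_mul (near_mul1 (near_cst eta (3 / 2)) (near_u m)) (near_S m).
have a3 : near eta (fun t => \sum_(l | l != m) lh t l / (lh t m - lh t l) * uh t l (i t) 0 * Sh l t)
   (fun t => \sum_(l | l != m) lam t l / (lam t m - lam t l) * U t (i t) l * S l t)
   (fun t => nu t * B t).
  apply: (near_sum e0) => // l lm.
  exact: (near_mul (near_mul1 (near_mul1 (near_lam l) (near_gapV lm)) (near_u l)) (near_S l)).
have a4 := near_mul1 (near_lamV m) (near_lamV m).
have c1 : near eta (fun t => @Dh t (i t) * uh t m (i t) 0) (fun t => D t (i t) 0 * U t (i t) m)
   (fun t => nu t * B t).
  case: a1 => h1 h2 h3; split; [move: h1|move: h2|move: h3]; move=> h.
  - by apply: bO_le h _ => t; rewrite (mulrC (B t)).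
  - by apply: bO_le h _ => t; rewrite (mulrC (B t)).
  - by apply: bO_le h _ => t; rewrite (mulrC (B t)).
have [h _ _] := near_mul1 a4 (near_add (near_add c1 (near_opp a2)) a3).
apply: bO_ext (bO_le h _) => t; last by rewrite (mulrC (B t)).
by rewrite !expr2 !invfM.
Qed.

End Entry.

End Bias.

Local Open Scope classical_set_scope.
Local Open Scope ring_scope.

(** * The spectral configuration *)

Section CorrectionOperator.
Variable R : rcfType.

(* The bracket in the bias formula, with the coefficient of the [k]-th projection
   left free: [1] for the linear term of the expansion, [3/2] for the quadratic
   term and for the bias. *)
Definition corr n d (U : 'M[R]_(n, d)) (lam : 'I_d -> R) (k : 'I_d) (c : R) (y : 'cV[R]_n) :=
  y - (c * dot (col k U) y) *: col k U
  + \sum_(l < d | l != k) (lam l / (lam k - lam l) * dot (col l U) y) *: col l U.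

Lemma corrE n d (U : 'M[R]_(n, d)) lam k c y i : corr U lam k c y i 0 =
  y i 0 - c * dot (col k U) y * U i k
  + \sum_(l < d | l != k) lam l / (lam k - lam l) * dot (col l U) y * U i l.
Proof. by rewrite !mxE summxE; congr (_ + _); apply: eq_bigr => l _; rewrite !mxE. Qed.

(** The bracket is homogeneous of degree zero in the eigenvalues, which allows dividing them by the
    eigengap. *)
Lemma corr_scale n d (U : 'M[R]_(n, d)) lam k c y (a : R) : a != 0 ->
  corr U (fun l => a * lam l) k c y = corr U lam k c y.
Proof.
move=> a0; congr (_ + _); apply: eq_bigr => l lk; congr (_ * _ *: _).
by rewrite -mulrBr invfM mulrACA divff // mul1r.
Qed.

Lemma corrD n d (U : 'M[R]_(n, d)) lam k c x y :
  corr U lam k c (x + y) = corr U lam k c x + corr U lam k c y.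
Proof.
apply/colP => i; rewrite [RHS]mxE !corrE !dotDr mxE.
under eq_bigr => l _ do rewrite dotDr mulrDr mulrDl.
rewrite big_split /=; ring.
Qed.

Lemma corrZ n d (U : 'M[R]_(n, d)) lam k c a y :
  corr U lam k c (a *: y) = a *: corr U lam k c y.
Proof.
apply/colP => i; rewrite [RHS]mxE !corrE dotZr [in LHS]mxE.
have -> : \sum_(l | l != k) lam l / (lam k - lam l) * dot (col l U) (a *: y) * U i l =
    a * \sum_(l | l != k) lam l / (lam k - lam l) * dot (col l U) y * U i l.
  by rewrite mulr_sumr; apply: eq_bigr => l _; rewrite dotZr; ring.
ring.
Qed.

End CorrectionOperator.

(** * Entries of the matrices in the bias formula *)

Section Connect.
Variable R : realType.

Lemma bias_formulaE n d (U : 'M[R]_(n, d)) lam (D : 'M[R]_n) k :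
  bias_formula U lam D k = (lam k ^+ 2)^-1 *: corr U lam k (3 / 2) (D *m col k U).
Proof.
have colM l (y : 'cV[R]_n) : col l U *m (col l U)^T *m y = dot (col l U) y *: col l U.
  by rewrite -mulmxA [X in _ *m X]mx11_scalar dotE mul_mx_scalar.
rewrite /bias_formula; congr (_ *: _); rewrite -mulmxA.
rewrite mulmxDl mulmxBl mul1mx mulmx_suml /corr; congr (_ - _ + _).
  by rewrite -scalemxAl colM scalerA.
by apply: eq_bigr => l _; rewrite -scalemxAl colM scalerA.
Qed.

Lemma col_UAof n p d (V : 'M[R]_n) (l : 'I_d) (j : 'I_n) :
  (j : nat) = sel n p d l -> col l (@UAof R n p d V) = col j V.
Proof.
move=> jE; apply/colP => i; rewrite !mxE (big_pred1 j) // => j' /=.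
by rewrite -jE; apply/eqP/eqP => [/val_inj|->].
Qed.

Lemma SAof_sel n p d (mu : 'I_n -> R) (l : 'I_d) (j : 'I_n) :
  (j : nat) = sel n p d l -> @SAof R n p d mu l = mu j.
Proof.
move=> jE; rewrite /SAof (big_pred1 j) // => j' /=.
by rewrite -jE; apply/eqP/eqP => [/val_inj|->].
Qed.

Lemma low_rankE n d (U : 'M[R]_(n, d)) (s : 'I_d -> R) i j :
  (U *m diagv s *m U^T) i j = \sum_l s l * U i l * U j l.
Proof.
rewrite mxE; apply: eq_bigr => l _; rewrite /diagv mul_mx_diag !mxE.
by rewrite (mulrC (U i l)).
Qed.

Lemma diag_mx_colE n (D : 'I_n -> R) (x : 'cV[R]_n) i :
  (diag_mx (\row_j D j) *m x) i 0 = D i * x i 0.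
Proof. by rewrite mul_diag_mx !mxE. Qed.

(** The bias does not change when the eigenvalues are multiplied by [c] and the diagonal by
    [c ^+ 2]. With [c] the inverse eigengap, the right-hand side has the shape compared in
    [bias_entry_close]. *)
Lemma bias_formula_entry n d (W : 'M[R]_(n, d)) (x : 'I_d -> R) (D : 'I_n -> R) k i (c : R) :
  c != 0 ->
  bias_formula W x (diag_mx (\row_j D j)) k i 0 =
  ((c * x k) ^+ 2)^-1 * (c ^+ 2 * D i * W i k
    - 3 / 2 * W i k * (\sum_j W j k * (c ^+ 2 * D j) * W j k)
    + \sum_(l | l != k) c * x l / (c * x k - c * x l) * W i l *
        (\sum_j W j l * (c ^+ 2 * D j) * W j k)).
Proof.
move=> c0; rewrite bias_formulaE mxE corrE diag_mx_colE mxE.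
have dE l : dot (col l W) (diag_mx (\row_j D j) *m col k W) = \sum_j W j l * D j * W j k.
  by apply: eq_bigr => j _; rewrite diag_mx_colE !mxE mulrA.
have cE l : \sum_j W j l * (c ^+ 2 * D j) * W j k = c ^+ 2 * \sum_j W j l * D j * W j k.
  by rewrite mulr_sumr; apply: eq_bigr => j _; ring.
rewrite dE cE exprMn [(c ^+ 2 * x k ^+ 2)^-1]invfM.
have -> : \sum_(l | l != k) c * x l / (c * x k - c * x l) * W i l *
        (\sum_j W j l * (c ^+ 2 * D j) * W j k) =
    c ^+ 2 * \sum_(l | l != k) x l / (x k - x l) * dot (col l W) (diag_mx (\row_j D j) *m col k W) * W i l.
  rewrite mulr_sumr; apply: eq_bigr => l _; rewrite cE dE.
  have -> : c * x l / (c * x k - c * x l) = x l / (x k - x l).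
    by rewrite -mulrBr invfM mulrACA divff // mul1r.
  ring.
have cc : (c ^+ 2)^-1 * c ^+ 2 = 1 by rewrite mulVf // expf_neq0.
rewrite -[LHS]mul1r -[X in X * _ = _]cc; ring.
Qed.

End Connect.

Section Uniform.
Variables (R : realFieldType) (T : Type).

Lemma bO_uniform d (f : 'I_d -> T -> R) (g : T -> R) : (forall t, 0 <= g t) ->
  (forall l, bO (f l) g) -> exists2 K, 0 <= K & forall l t, `|f l t| <= K * g t.
Proof.
move=> g0 H.
suff [K K0 HK] : exists2 K, 0 <= K & forall l, l \in enum 'I_d -> forall t, `|f l t| <= K * g t.
  by exists K => // l t; apply: HK; rewrite mem_enum.
elim: (enum 'I_d) => [|l s [K K0 IH]]; first by exists 0.
have [K' K'0 H'] := H l; exists (K + K'); first exact: addr_ge0.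
move=> l'; rewrite inE => /orP[/eqP ->|l's] t; rewrite mulrDl.
  by apply: le_trans (H' t) _; rewrite lerDr mulr_ge0.
by apply: le_trans (IH l' l's t) _; rewrite lerDl mulr_ge0.
Qed.

End Uniform.

(** * Expansion and bias estimate for a family of eigendecompositions *)

Section Configuration.
Variables (R : realType) (T : Type) (d p : nat) (n : T -> nat).
Variables (U : forall t, 'M[R]_(n t, d)) (lam : T -> 'I_d -> R) (E V : forall t, 'M[R]_(n t)).
Variables (mu : forall t, 'I_(n t) -> R) (Dl tau nu : T -> R) (lam_ratio : R) (N : nat).
Hypothesis UU : forall t, (U t)^T *m U t = 1%:M.
Hypothesis VV : forall t, (V t)^T *m V t = 1%:M.
Hypothesis Esym : forall t, (E t)^T = E t.
Hypothesis AE : forall t,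
  U t *m diagv (lam t) *m (U t)^T + E t = V t *m diagv (@mu t) *m (V t)^T.
Hypothesis lam_sign : forall t (l : 'I_d),
  ((l < p)%N -> 0 < lam t l) /\ ((p <= l)%N -> lam t l < 0).
Hypothesis lam_mono : forall t (l l' : 'I_d), (l <= l')%N -> lam t l' <= lam t l.
Hypothesis mu_mono : forall t (i j : 'I_(n t)), (i <= j)%N -> mu j <= mu i.
Hypothesis Dl0 : forall t, 0 < Dl t.
Hypothesis lam_ge : forall t l, Dl t <= `|lam t l|.
Hypothesis lam_le : forall t l, `|lam t l| <= lam_ratio * Dl t.
Hypothesis lam_gap : forall t l l', l != l' -> Dl t <= `|lam t l - lam t l'|.
Hypothesis tau01 : forall t, 0 <= tau t <= Dl t / 4.
Hypothesis Etau : forall t x, dot (E t *m x) (E t *m x) <= tau t ^+ 2 * dot x x.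
Hypothesis nu0 : forall t, 0 <= nu t.
Hypothesis N3 : (3 <= N)%N.
Hypothesis Epow : forall t l r j, (r < N)%N ->
  `|powv (E t) r (col l (U t)) j 0| <= tau t ^+ r * nu t.
Hypothesis rem : forall t, (2 * (tau t / Dl t)) ^+ N <= (tau t / Dl t) ^+ 3 * nu t.

Let delta t := tau t / Dl t.
Let uhat t l := col l (@UAof R (n t) p d (V t)).
Let lhat t l := @SAof R (n t) p d (@mu t) l.
Let dn t : (d <= n t)%N := orthonormal_dim (UU t).
Let sgn t l : R := (-1) ^+ (dot (col l (U t)) (uhat t l) < 0)%R.

Let sel_lt t (l : 'I_d) : (sel (n t) p d l < n t)%N.
Proof. by rewrite /sel; have := dn t; have := ltn_ord l; case: ifP => _; lia. Qed.

Let sj t l : 'I_(n t) := Ordinal (sel_lt t l).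

Let uhatE t l : uhat t l = col (sj t l) (V t).
Proof. exact: col_UAof. Qed.

Let lhatE t l : lhat t l = mu (sj t l).
Proof. exact: SAof_sel. Qed.

Let tau0 t : 0 <= tau t. Proof. by case/andP: (tau01 t). Qed.

Let delta01 t : 0 <= delta t <= 1 / 4.
Proof.
have [h1 h2] := andP (tau01 t); rewrite divr_ge0 ?(ltW (Dl0 t)) //=.
by rewrite ler_pdivrMr // mulrC; lra.
Qed.

Let sgn2 t l : sgn t l * sgn t l = 1.
Proof. by rewrite /sgn -signr_addb addbb. Qed.

(** Division by the eigengap and a choice of sign lead to the normalised setting of the expansion.
    The sign is [1] at a vanishing overlap, so [uh] is a unit vector in every case. *)
Let uh t l := sgn t l *: uhat t l.
Let El t := (Dl t)^-1 *: E t.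
Let laml t l := (Dl t)^-1 * lam t l.
Let lhl t l := (Dl t)^-1 * lhat t l.

Let uhat1 t l : dot (uhat t l) (uhat t l) = 1.
Proof.
rewrite uhatE; transitivity (((V t)^T *m V t) (sj t l) (sj t l)).
  by rewrite mxE; apply: eq_bigr => i _; rewrite !mxE.
by rewrite VV mxE eqxx.
Qed.

Let uh1 t l : dot (uh t l) (uh t l) = 1.
Proof. by rewrite dotZl dotZr mulrA sgn2 mul1r uhat1. Qed.

Let uh_sgn t l : 0 <= dot (col l (U t)) (uh t l).
Proof.
by rewrite dotZr /sgn -normrEsign.
Qed.

Let DlV t : 0 < (Dl t)^-1. Proof. by rewrite invr_gt0. Qed.

Let normDl t (x : R) : `|(Dl t)^-1 * x| = `|x| / Dl t.
Proof. by rewrite normrM gtr0_norm // mulrC. Qed.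

Let laml_ge t l : 1 <= `|laml t l|.
Proof. by rewrite normDl ler_pdivlMr // mul1r. Qed.

Let laml_le t l : `|laml t l| <= lam_ratio.
Proof. by rewrite normDl ler_pdivrMr. Qed.

Let laml_gap t l l' : l != l' -> 1 <= `|laml t l - laml t l'|.
Proof. by move=> ll'; rewrite -mulrBr normDl ler_pdivlMr // mul1r lam_gap. Qed.

Let lhl_close t l : `|lhl t l - laml t l| <= delta t.
Proof.
rewrite -mulrBr normDl ler_pM2r // lhatE.
apply: (weyl_selected (UU t) (VV t) (AE t) (tau0 t) (@Etau t) (@lam_sign t) (@lam_mono t)
  (@mu_mono t)) => //.
Qed.

Let El_op t x : dot (El t *m x) (El t *m x) <= delta t ^+ 2 * dot x x.
Proof.
rewrite -scalemxAl dotZl dotZr mulrA -expr2 /delta expr_div_n exprVn mulrC.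
by rewrite (mulrAC _ _ (dot x x)) ler_pM2r ?invr_gt0 ?exprn_gt0.
Qed.

Let eig t l : U t *m diag_mx (\row_l laml t l) *m (U t)^T *m uh t l + El t *m uh t l =
  lhl t l *: uh t l.
Proof.
have dE : diag_mx (\row_l laml t l) = (Dl t)^-1 *: diagv (lam t).
  by apply/matrixP => i j; rewrite !mxE mulrnAr.
have AV : V t *m diagv (@mu t) *m (V t)^T *m uhat t l = lhat t l *: uhat t l.
  have dj : diagv (@mu t) *m delta_mx (sj t l) 0 = mu (sj t l) *: delta_mx (sj t l) (0 : 'I_1).
    apply/matrixP => i j; rewrite mul_diag_mx !mxE.
    by case: (eqVneq i (sj t l)) => [->|] //=; rewrite ?mulr0.
  rewrite uhatE lhatE colE -!mulmxA (mulmxA _^T) VV mul1mx dj.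
  by rewrite -scalemxAr.
rewrite dE /El -(scalemxAr (Dl t)^-1 (U t)) -!(scalemxAl (Dl t)^-1) -scalerDr -mulmxDl AE /uh -scalemxAr AV.
by rewrite !scalerA; congr (_ *: _); rewrite /lhl; ring.
Qed.

Lemma coef_main : exists2 K, 0 <= K & forall l t,
  `|1 - `|dot (col l (U t)) (uhat t l)| | <= K * delta t ^+ 2.
Proof.
apply: bO_uniform => [t|l]; first exact: sqr_ge0.
have := bO_coef_main UU El_op (fun t => eig t l) (fun t => uh1 t l) delta01 laml_ge
  laml_gap (fun t => lhl_close t l) (fun t => uh_sgn t l).
by apply: bO_ext => t; rewrite /uh dotZr /sgn -normrEsign.
Qed.

Let T' := {t : T & 'I_(n t)}.
Let pr (x : T') := projT1 x.
Let co (x : T') : 'I_(n (pr x)) := projT2 x.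

Let El_pow r t l j : (r < N)%N -> `|powv (El t) r (col l (U t)) j 0| <= delta t ^+ r * nu t.
Proof.
move=> rN; rewrite powv_scale mxE exprVn normrM gtr0_norm ?invr_gt0 ?exprn_gt0 //.
rewrite /delta expr_div_n mulrC mulrAC ler_pM2r ?invr_gt0 ?exprn_gt0 //.
exact: Epow.
Qed.

Let uh_entry : exists2 K, 0 <= K & forall l (x : T'),
  `|uh (pr x) l (co x) 0 - U (pr x) (co x) l| <= K * (delta (pr x) * nu (pr x)).
Proof.
apply: bO_uniform => [x|l]; first by rewrite mulr_ge0 //; case/andP: (delta01 (pr x)).
have := @eigenvector_entry _ T' d l (fun x => n (pr x)) (fun x => U (pr x))
  (fun x => laml (pr x)) (fun x => El (pr x)) (fun x => uh (pr x) l) (fun x => lhl (pr x) l)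
  (fun x => delta (pr x)) lam_ratio (fun x => UU (pr x)) (fun x => @El_op (pr x))
  (fun x => eig (pr x) l) (fun x => uh1 (pr x) l) (fun x => delta01 (pr x))
  (fun x => laml_ge (pr x)) (fun x => laml_le (pr x)) (fun x => @laml_gap (pr x))
  (fun x => lhl_close (pr x) l) (fun x => uh_sgn (pr x) l) co (fun x => nu (pr x))
  (fun x => nu0 (pr x)) N (fun x l r => @El_pow r (pr x) l (co x)) (fun x => rem (pr x))
  (leq_trans _ N3).
by move=> /(_ isT); apply: bO_ext => x; congr (_ - _); rewrite /= mxE.
Qed.

Lemma second_order_expansion (k : 'I_d) (gam : T -> R) :
  (forall t, 0 <= gam t) -> (forall t, gam t <= delta t) ->
  (forall t l l', `|dot (col l (U t)) (E t *m col l' (U t))| <= gam t * Dl t) ->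
  exists2 K, 0 <= K & forall t (i : 'I_(n t)),
  `|(sgn t k *: uhat t k - col k (U t)
     - (lam t k)^-1 *: corr (U t) (lam t) k 1 (E t *m col k (U t))
     - (lam t k ^+ 2)^-1 *: corr (U t) (lam t) k (3 / 2) (E t *m (E t *m col k (U t)))) i 0|
  <= K * ((delta t * gam t + delta t ^+ 3) * nu t).
Proof.
move=> g0 gd Eg.
have Eg' t l l' : `|dot (col l (U t)) (El t *m col l' (U t))| <= gam t.
  by rewrite -scalemxAl dotZr normDl ler_pdivrMr.
have [K K0 HK] := @eigenvector_second_order _ T' d k (fun x => n (pr x)) (fun x => U (pr x))
  (fun x => laml (pr x)) (fun x => El (pr x)) (fun x => uh (pr x) k) (fun x => lhl (pr x) k)
  (fun x => delta (pr x)) lam_ratio (fun x => UU (pr x))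
  (fun x => ltac:(by rewrite /El linearZ /= Esym) : (El (pr x))^T = El (pr x))
  (fun x => @El_op (pr x))
  (fun x => eig (pr x) k) (fun x => uh1 (pr x) k) (fun x => delta01 (pr x))
  (fun x => laml_ge (pr x)) (fun x => laml_le (pr x)) (fun x => @laml_gap (pr x))
  (fun x => lhl_close (pr x) k) (fun x => uh_sgn (pr x) k) co (fun x => nu (pr x))
  (fun x => nu0 (pr x)) N (fun x l r => @El_pow r (pr x) l (co x)) (fun x => rem (pr x))
  (fun x => gam (pr x)) (fun x => g0 (pr x)) (fun x => gd (pr x))
  (fun x => Eg' (pr x)) N3.
exists K => // t i; apply: le_trans (HK (existT _ t i)); rewrite le_eqVlt; apply/orP; left.
apply/eqP; congr (`|_|); rewrite /pr /co /=.
have D0 : Dl t != 0 by rewrite gt_eqF.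
have lam0 l : lam t l != 0 by rewrite -normr_gt0 (lt_le_trans (Dl0 t)).
have gap0 l : l != k -> lam t k - lam t l != 0.
  by move=> lk; rewrite -normr_gt0 (lt_le_trans (Dl0 t)) // lam_gap // eq_sym.
have e1 : lam t k = Dl t * laml t k by rewrite /laml mulrA divff // mul1r.
have l0 l : laml t l != 0 by rewrite mulf_neq0 ?invr_eq0.
have lg0 l : l != k -> laml t k - laml t l != 0.
  by move=> lk; rewrite -mulrBr mulf_neq0 ?invr_eq0 // gap0.
have E1 (y : 'cV[R]_(n t)) : E t *m y = Dl t *: (El t *m y).
  by rewrite -scalemxAl scalerA divff // scale1r.
have c1 c y : corr (U t) (lam t) k c y = corr (U t) (laml t) k c y.
  by rewrite -(corr_scale (U t) (lam t) k c y (a := (Dl t)^-1)) ?invr_eq0.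
rewrite !c1 !E1 -scalemxAr !corrZ !scalerA e1.
have -> : (Dl t * laml t k)^-1 * Dl t = (laml t k)^-1 by rewrite invfM mulrAC mulVf // mul1r.
have -> : ((Dl t * laml t k) ^+ 2)^-1 * (Dl t * Dl t) = (laml t k ^+ 2)^-1.
  by field; rewrite D0 l0.
set y1 := El t *m col k (U t); set y2 := El t *m y1.
have mxB4 (a b c e : 'cV[R]_(n t)) : (a - b - c - e) i 0 = a i 0 - b i 0 - c i 0 - e i 0.
  by rewrite !mxE.
have mxZ a (c : 'cV[R]_(n t)) : (a *: c) i 0 = a * c i 0 by rewrite mxE.
have uE l : U t i l = col l (U t) i 0 by rewrite mxE.
rewrite mxB4 !mxZ -/(uh t k) !corrE (uE k).
have s1 : \sum_(l < d | l != k) laml t l / (laml t k - laml t l) * dot (col l (U t)) y1 * U t i l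
   = laml t k * \sum_(l < d | l != k)
      laml t l / (laml t k * (laml t k - laml t l)) * dot (col l (U t)) y1 * col l (U t) i 0.
  rewrite mulr_sumr; apply: eq_bigr => l lk; rewrite (uE l); field.
  by rewrite lg0 // l0.
have s2 : \sum_(l < d | l != k) laml t l / (laml t k - laml t l) * dot (col l (U t)) y2 * U t i l
   = laml t k ^+ 2 * \sum_(l < d | l != k)
      laml t l / (laml t k * (laml t k - laml t l)) * (dot (col l (U t)) y2 / laml t k) * col l (U t) i 0.
  rewrite mulr_sumr; apply: eq_bigr => l lk; rewrite (uE l); field.
  by rewrite lg0 // l0.
rewrite s1 s2; set q1 := \sum_(l < d | _) _; set q2 := \sum_(l < d | _) _.
by field.
Qed.

Section BiasEstimate.
Variables (eta B : T -> R) (D : forall t, 'cV[R]_(n t)).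
Hypothesis U_nu : forall t (l : 'I_d) j, `|U t j l| <= nu t.
Hypothesis eta01 : forall t, 0 <= eta t <= 1.
Hypothesis delta_eta : forall t, delta t <= eta t.
Hypothesis B0 : forall t, 0 <= B t.
Hypothesis dnB : forall t, tau t * nu t <= Num.sqrt (B t) * eta t.
Hypothesis D_B : forall t j, 0 <= D t j 0 <= B t.
Hypothesis E_D : forall t (j : 'I_(n t)), `|\sum_j' E t j j' ^+ 2 - D t j 0| <= B t * eta t.

Lemma bias_estimate (k : 'I_d) : exists2 K, 0 <= K & forall t (i : 'I_(n t)),
  `|(sgn t k *: bias_formula (@UAof R (n t) p d (V t)) (@SAof R (n t) p d (@mu t))
       (Dhat (U t *m diagv (lam t) *m (U t)^T + E t) (@Phat R (n t) p d (V t) (@mu t))) k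
     - bias_formula (U t) (lam t) (diag_mx (\row_j D t j 0)) k) i 0|
  <= K * (B t / Dl t ^+ 2 * nu t * eta t).
Proof.
have [K1 K10 HK1] := uh_entry.
have [K2 K20 HK2] := coef_main.
(* [K] has to dominate the entrywise constant [K1] and to satisfy [2 * K2 <= K ^+ 2], because
   [|uh - u|^2] equals [2 (1 - |<u, uhat>|)]. *)
pose K := K1 + (2 * K2 + 1).
have K0 : 0 <= K by rewrite !addr_ge0 // mulr_ge0.
have u1 t l : dot (col l (U t)) (col l (U t)) = 1.
  transitivity (((U t)^T *m U t) l l); last by rewrite UU mxE eqxx.
  by rewrite mxE; apply: eq_bigr => i _; rewrite !mxE.
have d0 t : 0 <= delta t by case/andP: (delta01 t).
have uh_n t l : dot (uh t l - col l (U t)) (uh t l - col l (U t)) <= (K * delta t) ^+ 2.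
  rewrite !(dotBl, dotBr) uh1 u1 (dotC (uh t l)).
  have -> : dot (col l (U t)) (uh t l) = `|dot (col l (U t)) (uhat t l)|.
    by rewrite /uh dotZr /sgn -normrEsign.
  have := HK2 l t; rewrite ler_norml => /andP[_ h].
  have h2 : 2 * K2 <= K ^+ 2.
    by rewrite -[leLHS]mulr1 expr2 ler_pM ?mulr_ge0 //; rewrite /K; lra.
  have h3 := ler_wpM2r (sqr_ge0 (delta t)) h2.
  have -> : (K * delta t) ^+ 2 = K ^+ 2 * delta t ^+ 2 by ring.
  lra.
have uh_e (x : T') l j : `|uh (pr x) l j 0 - U (pr x) j l| <= K * (delta (pr x) * nu (pr x)).
  apply: le_trans (HK1 l (existT _ (pr x) j)) _; apply: ler_wpM2r; first by rewrite mulr_ge0.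
  by rewrite /K lerDl addr_ge0 // mulr_ge0.
pose c t := (Dl t)^-1.
have c0 t : c t != 0 by rewrite gt_eqF //; exact: DlV.
have c2 t : 0 < c t ^+ 2 by apply: exprn_gt0; exact: DlV.
have dnB' t : delta t * nu t <= Num.sqrt (c t ^+ 2 * B t) * eta t.
  rewrite sqrtrM ?(ltW (c2 t)) // sqrtr_sqr gtr0_norm; last exact: DlV.
  have -> : delta t * nu t = c t * (tau t * nu t) by rewrite /delta /c; ring.
  by rewrite -mulrA; apply: ler_wpM2l => //; exact: ltW (DlV t).
have D_B' t j : 0 <= (c t ^+ 2 *: D t) j 0 <= c t ^+ 2 * B t.
  have /andP[h1 h2] := D_B j; rewrite mxE; apply/andP; split.
    by apply: mulr_ge0 => //; exact: ltW (c2 t).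
  by apply: ler_wpM2l => //; exact: ltW (c2 t).
have E_D' t j : `|\sum_j' El t j j' ^+ 2 - (c t ^+ 2 *: D t) j 0| <= c t ^+ 2 * B t * eta t.
  rewrite mxE; under eq_bigr => j' _ do rewrite mxE exprMn.
  rewrite -mulr_sumr -mulrBr normrM gtr0_norm; last exact: c2.
  by rewrite -mulrA; apply: ler_wpM2l; [exact: ltW (c2 t)|exact: E_D].
have [K' K'0 HK'] := @bias_entry_close _ T' d (fun x => n (pr x)) (fun x => U (pr x))
  (fun x => laml (pr x)) (fun x => El (pr x)) (fun x => uh (pr x)) (fun x => lhl (pr x))
  (fun x => delta (pr x)) (fun x => nu (pr x)) (fun x => eta (pr x))
  (fun x => c (pr x) ^+ 2 * B (pr x)) lam_ratio K (fun x => c (pr x) ^+ 2 *: D (pr x))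
  (fun x => u1 (pr x)) (fun x => uh1 (pr x)) (fun x => delta01 (pr x))
  (fun x => laml_ge (pr x)) (fun x => laml_le (pr x)) (fun x => @laml_gap (pr x))
  (fun x => lhl_close (pr x)) (fun x => nu0 (pr x)) (fun x => @U_nu (pr x)) K0
  uh_e (fun x => uh_n (pr x)) (fun x => eta01 (pr x)) (fun x => delta_eta (pr x))
  (fun x => mulr_ge0 (ltW (c2 (pr x))) (B0 (pr x)))
  (fun x => dnB' (pr x)) (fun x => @D_B' (pr x)) (fun x => @E_D' (pr x)) k co.
exists K' => // t i.
have -> : B t / Dl t ^+ 2 * nu t * eta t = c t ^+ 2 * B t * nu t * eta t.
  by rewrite exprVn (mulrC (B t)).
apply: le_trans (HK' (existT _ t i)); rewrite le_eqVlt; apply/orP; left.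
apply/eqP; congr (`|_|); rewrite /pr /co /=.
have hatE j l : (@UAof R (n t) p d (V t)) j l = uhat t l j 0 by rewrite [RHS]mxE.
have uhE l j : uh t l j 0 = sgn t l * uhat t l j 0 by rewrite mxE.
pose Dh j := \sum_j' ((U t *m diagv (lam t) *m (U t)^T + E t) j j' -
   (@Phat R (n t) p d (V t) (@mu t)) j j') ^+ 2.
have DhE j : \sum_j' (\sum_l laml t l * U t j l * U t j' l + El t j j' -
     \sum_l lhl t l * uh t l j 0 * uh t l j' 0) ^+ 2 = c t ^+ 2 * Dh j.
  rewrite /Dh mulr_sumr; apply: eq_bigr => j' _; rewrite -exprMn; congr (_ ^+ 2).
  have PE : (U t *m diagv (lam t) *m (U t)^T + E t) j j' =
      \sum_l lam t l * U t j l * U t j' l + E t j j' by rewrite mxE low_rankE.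
  rewrite PE /Phat low_rankE mulrBr mulrDr !mulr_sumr; congr (_ + _ - _).
  - by apply: eq_bigr => l _; rewrite /laml !mulrA.
  - by rewrite mxE.
  - apply: eq_bigr => l _; rewrite !uhE !hatE /lhl -/(lhat t l).
    rewrite -[RHS]mul1r -(sgn2 t l) /c; ring.
rewrite mxE [X in _ + X]mxE [X in X + _]mxE; congr (_ - _); last first.
  rewrite (bias_formula_entry _ _ _ _ _ (c0 t)); congr (_ * (_ - _ + _)).
  - by rewrite mxE.
  - by congr (_ * _); apply: eq_bigr => j _; rewrite mxE.
  - by apply: eq_bigr => l _; congr (_ * _); apply: eq_bigr => j _; rewrite mxE.
rewrite /Dhat (bias_formula_entry _ _ _ _ _ (c0 t)) -/(lhat t k) -/(lhl t k).
(* In each term of the bias every sign other than that of [k] occurs an even number of times; the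
   one left over is the prefactor [sgn t k]. *)
have SE l : \sum_j uh t l j 0 * (c t ^+ 2 * Dh j) * uh t k j 0 = sgn t l * sgn t k *
   (\sum_j (@UAof R (n t) p d (V t)) j l * (c t ^+ 2 * Dh j) * (@UAof R (n t) p d (V t)) j k).
  rewrite mulr_sumr; apply: eq_bigr => j _; rewrite !uhE !hatE; ring.
have SE' l : \sum_j uh t l j 0 * (\sum_j' (\sum_l laml t l * U t j l * U t j' l + El t j j' -
     \sum_l lhl t l * uh t l j 0 * uh t l j' 0) ^+ 2) * uh t k j 0 = sgn t l * sgn t k *
   (\sum_j (@UAof R (n t) p d (V t)) j l * (c t ^+ 2 * Dh j) * (@UAof R (n t) p d (V t)) j k).
  by rewrite -SE; apply: eq_bigr => j _; rewrite DhE.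
rewrite mulrCA; congr (_ * _); rewrite SE' DhE sgn2 mul1r uhE hatE mulrDr mulrBr.
congr (_ - _ + _); [by rewrite mulrCA|by rewrite -!mulrA mulrCA; congr (_ * _); rewrite mulrCA|].
rewrite mulr_sumr; apply: eq_bigr => l _; rewrite SE' !uhE !hatE.
rewrite -[LHS]mul1r -[X in X * _ = _](sgn2 t l) /lhl /lhat /c.
under eq_bigr => j _ do rewrite -/(Dh j).
ring.
Qed.

End BiasEstimate.

End Configuration.

(** * Independence *)

Section Independence.
Import HBNNSimple.
Context (R : realType) d (T : measurableType d) (P : probability T R).

Lemma measurable_fun_prodr (I : Type) (s : seq I) (Q : pred I) (f : I -> T -> R) :
  (forall i, measurable_fun setT (f i)) ->
  measurable_fun setT (fun w => \prod_(i <- s | Q i) f i w).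
Proof.
move=> mf; elim: s => [|i s IH].
  by under eq_fun do rewrite big_nil; exact: measurable_cst.
under eq_fun do rewrite big_cons.
by case: (Q i) => //; apply: measurable_funM.
Qed.

(** Passage from indicators of [X] to nonnegative functions of [X]: linearity for simple functions,
    then monotone convergence. [H] stands for the product over the remaining variables and enters
    only through the number [h]. *)
Lemma indep_ge0_step (X H : T -> R) (h : R) :
  measurable_fun setT X -> measurable_fun setT H -> (forall w, 0 <= H w) ->
  0 <= h ->
  (forall B, measurable B ->
     (\int[P]_w (\1_B (X w) * H w)%:E = P (X @^-1` B) * h%:E)%E) ->
  forall g : R -> R, measurable_fun setT g -> (forall x, 0 <= g x) ->
  (\int[P]_w (g (X w) * H w)%:E = (\int[P]_w (g (X w))%:E) * h%:E)%E.
Proof.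
move=> mX mH H0 h0 hB g mg g0.
have mg' : measurable_fun setT (EFin \o g) by apply/measurable_EFinP.
pose gn := nnsfun_approx measurableT mg'.
have gn0 n x : 0 <= gn n x by exact: fun_ge0.
have mgn n : measurable_fun setT (gn n) by exact: measurable_funPT.
have mgX n : measurable_fun setT (gn n \o X) by apply: measurableT_comp.
have cvgg x : (EFin \o gn^~ x) @ \oo --> (g x)%:E.
  by apply: (@cvg_nnsfun_approx _ _ _ setT measurableT _ mg' _ x) => // y _; rewrite lee_fin.
have ndg x m n : (m <= n)%N -> gn m x <= gn n x.
  by move=> mn; have /lefP := nd_nnsfun_approx measurableT mg' mn; exact.
have indep_n n : (\int[P]_w (gn n (X w) * H w)%:E =
                  (\int[P]_w (gn n (X w))%:E) * h%:E)%E.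
  have intB B : measurable B -> (\int[P]_w (\1_B (X w))%:E = P (X @^-1` B))%E.
    move=> mB; rewrite -[X in P X]setIT -(@integral_indic _ _ _ P setT)//.
    by rewrite -[X in measurable X]setTI; exact: mX.
  have mI B : measurable B -> measurable_fun setT (fun w => \1_B (X w) : R).
    move=> mB; have mi : measurable_fun setT (\1_B : R -> R) by apply: measurable_indic.
    exact: (measurableT_comp mi mX).
  (* The approximation [gn n] as a nonnegative combination of indicators: [n 2^n] dyadic levels and,
     at [ord_max], the set where [g] is at least [n]. *)
  have [m [c [A [c0 mA EA]]]] : exists m (c : 'I_m.+1 -> R) (A : 'I_m.+1 -> set R),
      [/\ forall k, 0 <= c k, forall k, measurable (A k) &
       forall x, gn n x = \sum_(k < m.+1) c k * \1_(A k) x].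
    exists (n * 2 ^ n)%N,
      (fun k => if unlift ord_max k is Some j then (j : nat)%:R * 2 ^- n else n%:R),
      (fun k => if unlift ord_max k is Some j then
          dyadic_approx setT (EFin \o g) n j else integer_approx setT (EFin \o g) n).
    split=> [k|k|x].
    - by case: unlift => //= j; rewrite mulr_ge0 // invr_ge0 exprn_ge0.
    - case: unliftP => [j _|_].
        rewrite /dyadic_approx; case: ifPn => //= _; rewrite -preimage_comp.
        by apply: (mg') => //; apply/measurable_image_EFin; exact: measurable_itv.
      rewrite /integer_approx; apply: emeasurable_fun_c_infty => //.
    - rewrite /gn nnsfun_approxE /approx big_ord_recr /= unlift_none; congr (_ + _).
      apply: eq_bigr => k _.
      have -> : widen_ord (leqnSn (n * 2 ^ n)) k = lift ord_max k.
        by apply: val_inj; rewrite /= /bump leqNgt ltn_ord.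
      by rewrite liftK.
  have E1 w : (gn n (X w) * H w)%:E = (\sum_(k < m.+1) (c k)%:E * (\1_(A k) (X w) * H w)%:E)%E.
    rewrite EA mulr_suml sumEFin; congr (_%:E); apply: eq_bigr => k _.
    by rewrite mulrA.
  have E2 w : (gn n (X w))%:E = (\sum_(k < m.+1) (c k)%:E * (\1_(A k) (X w))%:E)%E.
    by rewrite EA sumEFin.
  under eq_integral do rewrite E1.
  under [in RHS]eq_integral do rewrite E2.
  rewrite !ge0_integral_sum //; last first.
  - by move=> k w _; rewrite -EFinM lee_fin !mulr_ge0.
  - move=> k; apply/measurable_EFinP; apply: measurable_funM => //.
      by apply: measurable_funM => //; exact: mI.
  - by move=> k w _; rewrite -EFinM lee_fin !mulr_ge0.
  - by move=> k; apply/measurable_EFinP; apply: measurable_funM => //; exact: mI.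
  rewrite ge0_sume_distrl; last first.
    by move=> k _; apply: integral_ge0 => w _; rewrite -EFinM lee_fin !mulr_ge0.
  apply: eq_bigr => k _.
  rewrite ge0_integralZl_EFin //; last 2 first.
  - by move=> w _; rewrite lee_fin mulr_ge0.
  - by apply/measurable_EFinP; apply: measurable_funM => //; exact: mI.
  rewrite ge0_integralZl_EFin //; last first.
    by apply/measurable_EFinP; exact: mI.
  by rewrite -muleA intB; [rewrite -hB|]; last exact: mA.
have mono (f : T -> R) (fn : nat -> T -> R) : (forall n w, 0 <= fn n w) ->
    (forall n, measurable_fun setT (fn n)) ->
    (forall w m n, (m <= n)%N -> fn m w <= fn n w) ->
    (forall w, (EFin \o fn^~ w) @ \oo --> (f w)%:E) ->
    (\int[P]_w (fn n w)%:E @[n --> \oo] --> \int[P]_w (f w)%:E)%E.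
  move=> fn0 mfn ndfn cf.
  have -> : (\int[P]_w (f w)%:E = \int[P]_w limn (fun n => (fn n w)%:E))%E.
    by apply: eq_integral => w _; apply/esym/cvg_lim => //; exact: cf.
  apply: (@cvg_monotone_convergence _ _ _ P setT measurableT
            (fun n w => (fn n w)%:E)).
  - by move=> n; apply/measurable_EFinP.
  - by move=> n w _; rewrite lee_fin.
  - by move=> w _ m n mn; rewrite lee_fin ndfn.
have L1 : (\int[P]_w (gn n (X w) * H w)%:E @[n --> \oo] -->
            \int[P]_w (g (X w) * H w)%:E)%E.
  apply: mono => [n w|n|w m n mn|w].
  - by rewrite mulr_ge0.
  - by apply: measurable_funM; [exact: mgX|exact: mH].
  - by rewrite ler_wpM2r // ndg.
  - have -> : (EFin \o (fun n => gn n (X w) * H w)) =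
              (fun n => (gn n (X w))%:E * (H w)%:E)%E by [].
    by rewrite EFinM; apply: cvgeZr => //; exact: cvgg.
have L2 : (\int[P]_w (gn n (X w))%:E @[n --> \oo] --> \int[P]_w (g (X w))%:E)%E.
  by apply: mono => [n w|n|w m n mn|w]; [exact: gn0|exact: mgX|exact: ndg|exact: cvgg].
have L3 : ((\int[P]_w (gn n (X w))%:E * h%:E) @[n --> \oo] -->
            \int[P]_w (g (X w))%:E * h%:E)%E by apply: cvgeZr.
apply: (cvg_unique _ L1); first exact: ereal_hausdorff.
by rewrite (funext indep_n).
Qed.

Lemma integral_indic_comp (X : T -> R) (B : set R) :
  measurable_fun setT X -> measurable B ->
  (\int[P]_w (\1_B (X w))%:E = P (X @^-1` B))%E.
Proof.
move=> mX mB; rewrite -[X in P X]setIT -(@integral_indic _ _ _ P setT)//.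
by rewrite -[X in measurable X]setTI; exact: mX.
Qed.

Lemma indep_prod_ge0 (I : finType) (J : pred I) (X : I -> T -> R) :
  (forall i, measurable_fun setT (X i)) -> mutually_independent P J X ->
  forall g : I -> R -> R, (forall i, measurable_fun setT (g i)) ->
  (forall i x, 0 <= g i x) -> (forall i, \int[P]_w (g i (X i w))%:E < +oo)%E ->
  (\int[P]_w (\prod_(i | J i) g i (X i w))%:E =
   (\prod_(i | J i) fine (\int[P]_w (g i (X i w))%:E))%:E)%E.
Proof.
move=> mX indX.
(* Induction on the list [s] of indices at which [g i] may be arbitrary. Outside [s] each [g i] is
   an indicator, and for empty [s] the claim is the definition of independence. *)
suff main (s : seq I) (g : I -> R -> R) : (forall i, measurable_fun setT (g i)) ->
    (forall i x, 0 <= g i x) -> (forall i, \int[P]_w (g i (X i w))%:E < +oo)%E ->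
    (forall i, i \notin s -> exists2 B, measurable B & g i = \1_B) ->
    (\int[P]_w (\prod_(i | J i) g i (X i w))%:E =
     (\prod_(i | J i) fine (\int[P]_w (g i (X i w))%:E))%:E)%E.
  move=> g mg g0 gfin; apply: (main (enum I)) => // i; by rewrite mem_enum.
elim: s g => [|a s IH] g mg g0 gfin gs.
  have /choice[B HB] : forall i, exists B, measurable B /\ g i = \1_B.
    by move=> i; have [B mB ->] := gs i isT; exists B.
  have mB i : measurable (B i) by case: (HB i).
  have gB i : g i = \1_(B i) by case: (HB i).
  have mS : measurable [set w | forall i, J i -> B i (X i w)].
    rewrite (_ : [set w | _] = \big[setI/setT]_(i | J i) (X i @^-1` B i)).
      apply: bigsetI_measurable => i _.
      by rewrite -[X in measurable X]setTI; exact: mX.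
    apply/seteqP; split=> w; rewrite -bigcap_seq_cond /=.
      by move=> H i /andP[_ Ji]; exact: H.
    by move=> H i Ji; apply: H; apply/andP; split=> //; exact: mem_index_enum.
  have E w : \prod_(i | J i) g i (X i w) =
      \1_[set w | forall i, J i -> B i (X i w)] w.
    rewrite [RHS]indicE; have [H|H] := pselect (forall i, J i -> B i (X i w)).
      rewrite mem_set // big1 // => i Ji; rewrite gB indicE mem_set //; exact: H.
    have [i Ji nB] : exists2 i, J i & ~ B i (X i w).
      apply: contrapT => H'; apply: H => i Ji; apply: contrapT => nB.
      by apply: H'; exists i.
    by rewrite (memNset H) (bigD1 i) //= gB indicE memNset // mul0r.
  under eq_integral do rewrite E.
  rewrite integral_indic // setIT -[LHS]fineK ?fin_num_measure //.
  rewrite (indX B mB); congr (_%:E); apply: eq_bigr => i Ji.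
  by rewrite gB integral_indic_comp.
have [Ja|nJa] := boolP (J a); last first.
  (* An index outside [J] does not enter the products, so its function may be traded for an
     indicator. *)
  pose g' i := if i == a then \1_setT else g i.
  have Eg i : J i -> g i = g' i.
    by rewrite /g'; case: eqP => // -> Ji; rewrite Ji in nJa.
  have := IH g'.
  under eq_integral do (under eq_bigr => i Ji do rewrite -(Eg i Ji)).
  under [in RHS]eq_bigr => i Ji do rewrite -(Eg i Ji).
  apply.
  - by move=> i; rewrite /g'; case: eqP => // _; apply: measurable_indic.
  - by move=> i x; rewrite /g'; case: eqP.
  - move=> i; rewrite /g'; case: eqP => // _.
    by rewrite integral_indic_comp // (le_lt_trans (probability_le1 _ _)) ?ltry // -[X in measurable X]setTI; exact: mX.
  - move=> i nis; rewrite /g'; case: eqP => [_|nia]; first by exists setT.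
    by apply: gs; rewrite inE negb_or nis andbT; apply/eqP.
pose H w := \prod_(i | J i && (i != a)) g i (X i w).
pose h := \prod_(i | J i && (i != a)) fine (\int[P]_w (g i (X i w))%:E)%E.
have h0 : 0 <= h.
  by apply: prodr_ge0 => i _; apply/fine_ge0/integral_ge0 => w _; rewrite lee_fin.
have mH : measurable_fun setT H.
  apply: measurable_fun_prodr => i; exact: (measurableT_comp (mg i) (mX i)).
have H0 w : 0 <= H w by apply: prodr_ge0.
under eq_integral do rewrite (bigD1 a) //=.
rewrite (indep_ge0_step (X := X a) (H := H) (h := h)) //.
  rewrite [in RHS](bigD1 a) //= EFinM fineK //.
  by rewrite ge0_fin_numE //; apply: integral_ge0 => w _; rewrite lee_fin.
move=> B mB.
(* With an indicator at [a], the factorisation is the induction hypothesis. *)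
pose g' i := if i == a then \1_B else g i.
have Eg i : i != a -> g' i = g i by rewrite /g'; case: eqP.
have Ega : g' a = \1_B by rewrite /g' eqxx.
have := IH g'.
under eq_integral do (rewrite (bigD1 a) //= Ega; under eq_bigr => i /andP[Ji ia] do rewrite (Eg i ia)).
rewrite (bigD1 a) //= Ega; under [in RHS]eq_bigr => i /andP[Ji ia] do rewrite (Eg i ia).
rewrite EFinM integral_indic_comp // fineK; last first.
  by apply: fin_num_measure; rewrite -[X in measurable X]setTI; exact: mX.
apply.
- by move=> i; rewrite /g'; case: eqP => // _; apply: measurable_indic.
- by move=> i x; rewrite /g'; case: eqP.
- move=> i; rewrite /g'; case: eqP => // _.
  by rewrite integral_indic_comp // (le_lt_trans (probability_le1 _ _)) ?ltry // -[X in measurable X]setTI; exact: mX.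
- move=> i nis; rewrite /g'; case: eqP => [_|nia]; first by exists B.
  by apply: gs; rewrite inE negb_or nis andbT; apply/eqP.
Qed.

(** The same induction with nonnegative functions in the place of indicators: one [g a] at a time is
    split into positive and negative parts. Integrability of the product comes first, from the
    nonnegative case applied to absolute values. *)
Lemma indep_prod (I : finType) (J : pred I) (X : I -> T -> R) :
  (forall i, measurable_fun setT (X i)) -> mutually_independent P J X ->
  forall g : I -> R -> R, (forall i, measurable_fun setT (g i)) ->
  (forall i, P.-integrable setT (fun w => (g i (X i w))%:E)) ->
  P.-integrable setT (fun w => (\prod_(i | J i) g i (X i w))%:E) /\
  (\int[P]_w (\prod_(i | J i) g i (X i w))%:E =
   (\prod_(i | J i) fine (\int[P]_w (g i (X i w))%:E))%:E)%E.
Proof.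
move=> mX indX.
have int (g : I -> R -> R) : (forall i, measurable_fun setT (g i)) ->
    (forall i, P.-integrable setT (fun w => (g i (X i w))%:E)) ->
    P.-integrable setT (fun w => (\prod_(i | J i) g i (X i w))%:E).
  move=> mg ig; apply/integrableP; split.
    apply/measurable_EFinP; apply: measurable_fun_prodr => i.
    exact: (measurableT_comp (mg i) (mX i)).
  under eq_integral do rewrite abse_EFin normr_prod.
  rewrite (indep_prod_ge0 mX indX (g := fun i x => `|g i x|)) ?ltry //.
  - by move=> i; apply: measurableT_comp.
  - by move=> i; case/integrableP: (ig i).
move=> g mg ig; split; first exact: int.
suff main (s : seq I) (g' : I -> R -> R) : (forall i, measurable_fun setT (g' i)) ->
    (forall i, P.-integrable setT (fun w => (g' i (X i w))%:E)) ->
    (forall i, i \notin s -> forall x, 0 <= g' i x) ->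
    (\int[P]_w (\prod_(i | J i) g' i (X i w))%:E =
     (\prod_(i | J i) fine (\int[P]_w (g' i (X i w))%:E))%:E)%E.
  by apply: (main (enum I)) => // i; rewrite mem_enum.
elim: s g' {g mg ig} => [|a s IH] g mg ig gs.
  apply: indep_prod_ge0 => // [i x|i]; first exact: gs.
  case/integrableP: (ig i) => _; apply: le_lt_trans.
  apply: ge0_le_integral => //.
  - by move=> w _; rewrite lee_fin gs.
  - by apply/measurable_EFinP; exact: (measurableT_comp (mg i) (mX i)).
  - apply/measurable_EFinP; apply: measurableT_comp => //.
    exact: (measurableT_comp (mg i) (mX i)).
  - by move=> w _; rewrite lee_fin ler_norm.
pose upd (f : R -> R) i := if i == a then f else g i.
have updE f i : i != a -> upd f i = g i by rewrite /upd; case: eqP.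
have upda f : upd f a = f by rewrite /upd eqxx.
have mupd f i : measurable_fun setT f -> measurable_fun setT (upd f i).
  by move=> mf; rewrite /upd; case: eqP.
have [Ja|nJa] := boolP (J a); last first.
  have Eg i : J i -> g i = upd (cst 0) i.
    by move=> Ji; rewrite updE //; apply: contraNneq nJa => <-.
  have := IH (upd (cst 0)).
  under eq_integral do (under eq_bigr => i Ji do rewrite -(Eg i Ji)).
  under [in RHS]eq_bigr => i Ji do rewrite -(Eg i Ji).
  apply.
  - by move=> i; apply: mupd.
  - by move=> i; rewrite /upd; case: eqP => // _; exact: integrable0.
  - move=> i nis x; rewrite /upd; case: eqP => // /eqP nia.
    by apply: gs; rewrite inE negb_or nis andbT.
pose gp x := Num.max (g a x) 0; pose gn x := Num.max (- g a x) 0.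
have mgp : measurable_fun setT gp by apply: measurable_maxr.
have mgn : measurable_fun setT gn by apply: measurable_maxr => //; exact: measurableT_comp.
have gE x : g a x = gp x - gn x.
  rewrite /gp /gn; have [h|] := boolP (0 <= g a x); last rewrite -ltNge => h.
    by rewrite [Num.max (g a x) 0]max_l // [Num.max (- g a x) 0]max_r ?oppr_le0 // subr0.
  by rewrite [Num.max (g a x) 0]max_r ?(ltW h) // max_l ?oppr_ge0 ?(ltW h) // sub0r opprK.
have igp : P.-integrable setT (fun w => (gp (X a w))%:E).
  apply: le_integrable (ig a) => //.
    by apply/measurable_EFinP; exact: (measurableT_comp mgp (mX a)).
  move=> w _; rewrite !abse_EFin lee_fin /gp; have [h|] := boolP (0 <= g a (X a w)); last rewrite -ltNge => h.
    by rewrite max_l.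
  by rewrite max_r ?(ltW h) // normr0.
have ign : P.-integrable setT (fun w => (gn (X a w))%:E).
  apply: le_integrable (ig a) => //.
    by apply/measurable_EFinP; exact: (measurableT_comp mgn (mX a)).
  move=> w _; rewrite !abse_EFin lee_fin /gn; have [h|] := boolP (0 <= g a (X a w)); last rewrite -ltNge => h.
    by rewrite max_r ?oppr_le0 // normr0.
  by rewrite max_l ?oppr_ge0 ?(ltW h) // normrN.
have half f : measurable_fun setT f -> P.-integrable setT (fun w => (f (X a w))%:E) ->
    (forall x, 0 <= f x) ->
    P.-integrable setT (fun w => (f (X a w) * \prod_(i | J i && (i != a)) g i (X i w))%:E) /\
    (\int[P]_w (f (X a w) * \prod_(i | J i && (i != a)) g i (X i w))%:E =
     (fine (\int[P]_w (f (X a w))%:E) *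
      \prod_(i | J i && (i != a)) fine (\int[P]_w (g i (X i w))%:E))%:E)%E.
  move=> mf if_ f0.
  have mu' i : measurable_fun setT (upd f i) by exact: mupd.
  have iu i : P.-integrable setT (fun w => (upd f i (X i w))%:E).
    by rewrite /upd; case: eqP => [->|].
  have E w : f (X a w) * \prod_(i | J i && (i != a)) g i (X i w) =
      \prod_(i | J i) upd f i (X i w).
    rewrite [RHS](bigD1 a) //= upda; congr (_ * _).
    by apply: eq_bigr => i /andP[_ ia]; rewrite updE.
  under eq_fun do rewrite E.
  split; first exact: int.
  rewrite IH //; last first.
    move=> i nis x; rewrite /upd; case: eqP => // /eqP nia.
    by apply: gs; rewrite inE negb_or nis andbT.
  rewrite (bigD1 a) //= upda; congr (_ * _)%:E.
  by apply: eq_bigr => i /andP[_ ia]; rewrite updE.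
have [i1 e1] := half gp mgp igp (fun x => ltac:(by rewrite /gp le_max lexx orbT)).
have [i2 e2] := half gn mgn ign (fun x => ltac:(by rewrite /gn le_max lexx orbT)).
have E w : (\prod_(i | J i) g i (X i w))%:E =
  ((gp (X a w) * \prod_(i | J i && (i != a)) g i (X i w))%:E -
   (gn (X a w) * \prod_(i | J i && (i != a)) g i (X i w))%:E)%E.
  by rewrite (bigD1 a) //= gE mulrBl EFinB.
under eq_integral do rewrite E.
rewrite integralB // e1 e2 -EFinB -mulrBl [in RHS](bigD1 a) //=; congr (_ * _)%:E.
under [in RHS]eq_integral do rewrite gE EFinB.
rewrite integralB // [RHS]fineB //.
  exact: (integrable_fin_num measurableT igp).
exact: (integrable_fin_num measurableT ign).
Qed.

End Independence.

(** * Expectations and moments *)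

Section Expectation.
Context (R : realType) d (T : measurableType d) (P : probability T R).

Definition rv_integrable (X : T -> R) := P.-integrable setT (fun w => (X w)%:E).

Lemma integrable_expectR X : rv_integrable X -> (\int[P]_w (X w)%:E)%E = (expectR P X)%:E.
Proof. by move=> iX; rewrite /expectR fineK //; apply: (integrable_fin_num measurableT iX). Qed.

Lemma rv_integrable_cst a : rv_integrable (fun=> a).
Proof. by apply: (finite_measure_integrable_cst P a). Qed.

Lemma expectR_cst a : expectR P (fun=> a) = a.
Proof.
rewrite /expectR integral_cst //.
by have := probability_setT P => /= ->; rewrite mule1.
Qed.

Lemma rv_integrableD X Y : rv_integrable X -> rv_integrable Y ->
  rv_integrable (fun w => X w + Y w).
Proof. by move=> iX iY; apply: (integrableD measurableT iX iY). Qed.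

Lemma expectRD X Y : rv_integrable X -> rv_integrable Y ->
  expectR P (fun w => X w + Y w) = expectR P X + expectR P Y.
Proof.
move=> iX iY; apply: EFin_inj; rewrite EFinD -!integrable_expectR //; last exact: rv_integrableD.
by under eq_integral do rewrite EFinD; rewrite integralD.
Qed.

Lemma rv_integrableZ a X : rv_integrable X -> rv_integrable (fun w => a * X w).
Proof. by move=> iX; apply: (integrableZl measurableT a iX). Qed.

Lemma expectRZ a X : rv_integrable X -> expectR P (fun w => a * X w) = a * expectR P X.
Proof.
move=> iX; apply: EFin_inj; rewrite EFinM -!integrable_expectR //; last exact: rv_integrableZ.
by under eq_integral do rewrite EFinM; rewrite integralZl.
Qed.

Lemma rv_integrable_sum (I : Type) (s : seq I) (Q : pred I) (X : I -> T -> R) :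
  (forall i, Q i -> rv_integrable (X i)) -> rv_integrable (fun w => \sum_(i <- s | Q i) X i w).
Proof.
move=> iX; elim: s => [|i s IH].
  by under eq_fun do rewrite big_nil; exact: rv_integrable_cst.
under eq_fun do rewrite big_cons.
by case: (boolP (Q i)) => // Qi; apply: rv_integrableD => //; exact: iX.
Qed.

Lemma expectR_sum (I : Type) (s : seq I) (Q : pred I) (X : I -> T -> R) :
  (forall i, Q i -> rv_integrable (X i)) ->
  expectR P (fun w => \sum_(i <- s | Q i) X i w) = \sum_(i <- s | Q i) expectR P (X i).
Proof.
move=> iX; elim: s => [|i s IH].
  by under eq_fun do rewrite big_nil; rewrite expectR_cst big_nil.
under eq_fun do rewrite big_cons.
rewrite big_cons; case: (boolP (Q i)) => // Qi; rewrite expectRD ?IH //.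
  exact: iX.
exact: rv_integrable_sum.
Qed.

Lemma expectR_le X Y : rv_integrable X -> rv_integrable Y ->
  (forall w, X w <= Y w) -> expectR P X <= expectR P Y.
Proof.
move=> iX iY XY; rewrite -lee_fin -!integrable_expectR //.
by apply: le_integral => // w _; rewrite lee_fin.
Qed.

Lemma expectR_ge0 X : (forall w, 0 <= X w) -> 0 <= expectR P X.
Proof. by move=> X0; apply/fine_ge0/integral_ge0 => w _; rewrite lee_fin. Qed.

Lemma rv_integrable_abs X : rv_integrable X -> rv_integrable (fun w => `|X w|).
Proof. exact: integrable_norm. Qed.

Lemma expectR_abs X : rv_integrable X -> `|expectR P X| <= expectR P (fun w => `|X w|).
Proof.
move=> iX; have iX' := rv_integrable_abs iX; rewrite ler_norml.
rewrite (expectR_le iX iX' (fun w => ler_norm (X w))) andbT -mulN1r -expectRZ //.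
apply: expectR_le => // [|w]; first exact: rv_integrableZ.
by rewrite mulN1r lerNl -normrN ler_norm.
Qed.

Lemma rv_integrable_measurable (X : T -> R) : rv_integrable X -> measurable_fun setT X.
Proof. by move/integrableP => [/measurable_EFinP]. Qed.

Lemma rv_integrable_bound (X : T -> R) (b : R) : measurable_fun setT X ->
  (\int[P]_w (`|X w|)%:E <= b%:E)%E -> rv_integrable X /\ expectR P (fun w => `|X w|) <= b.
Proof.
move=> mX ib; have iX : rv_integrable X.
  apply/integrableP; split; first exact/measurable_EFinP.
  by apply: le_lt_trans (ltry b); under eq_integral do rewrite abse_EFin.
by split => //; rewrite -lee_fin -integrable_expectR //; exact: rv_integrable_abs.
Qed.

Lemma markov_ge0 X (b : R) : rv_integrable X -> (forall w, 0 <= X w) -> 0 < b ->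
  (P [set w | (b < X w)%R] <= (expectR P X / b)%:E)%E.
Proof.
move=> iX X0 b0; have mX := rv_integrable_measurable iX.
have mS : measurable [set w | b < X w].
  rewrite (_ : [set w | _] = X @^-1` `]b, +oo[%classic).
    by rewrite -[X in measurable X]setTI; apply: mX => //; exact: measurable_itv.
  by apply/seteqP; split=> w /=; rewrite in_itv /= andbT.
rewrite mulrC -[X in P X]setIT -(@integral_indic _ _ _ P setT) //.
have -> : (b^-1 * expectR P X)%:E = (\int[P]_w (b^-1 * X w)%:E)%E.
  by rewrite integrable_expectR ?expectRZ //; exact: rv_integrableZ.
apply: ge0_le_integral => //.
- by apply/measurable_EFinP; exact: measurable_indic.
- by apply/measurable_EFinP; apply: measurable_funM => //; exact: measurable_cst.
move=> w _; rewrite lee_fin indicE; have [H|H] := pselect (b < X w).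
  by rewrite mem_set // ler_pdivlMl // mulr1 ltW.
by rewrite memNset // mulr_ge0 // invr_ge0 ltW.
Qed.

End Expectation.

(** * Expectations of products of independent centred variables *)

Section Monomials.
Context (R : realType) d (T : measurableType d) (P : probability T R).
Context (I : finType) (J : pred I) (X : I -> T -> R).
Hypothesis mX : forall i, measurable_fun setT (X i).
Hypothesis indX : mutually_independent P J X.

Lemma prod_seq_count (F : I -> R) (s : seq I) : all J s ->
  \prod_(e <- s) F e = \prod_(e | J e) F e ^+ count_mem e s.
Proof.
elim: s => [_|a s IH /= /andP[Ja Js]].
  by rewrite big_nil big1.
rewrite big_cons IH // [X in _ * X](bigD1 a) //= [RHS](bigD1 a) //= eqxx add1n exprS mulrA; congr (_ * _).
by apply: eq_bigr => e /andP[_ /negPf ea]; rewrite eq_sym ea add0n.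
Qed.

(** Independence factors the expectation over the distinct indices. Multiplicity one gives [0]; a
    higher multiplicity gives a factor [1 / nn], which will pay for the choice of a new vertex along
    a walk. *)
Lemma expectR_monomial (f : I -> R -> R) (a nn : R) (L : nat) :
  (forall i, measurable_fun setT (f i)) -> 0 <= a -> 1 <= nn ->
  (forall e, J e -> rv_integrable P (fun w => f e (X e w)) /\
                    expectR P (fun w => f e (X e w)) = 0) ->
  (forall e m, J e -> (2 <= m <= L)%N ->
     (\int[P]_w (`|f e (X e w)| ^+ m)%:E <= (a ^+ m / nn)%:E)%E) ->
  forall s : seq I, all J s -> (size s <= L)%N ->
  rv_integrable P (fun w => \prod_(e <- s) f e (X e w)) /\
  `|expectR P (fun w => \prod_(e <- s) f e (X e w))| <= a ^+ size s / nn ^+ size (undup s).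
Proof.
move=> mf a0 nn1 f1 fm s Js sL.
have mfX e : measurable_fun setT (fun w => f e (X e w)).
  exact: (measurableT_comp (mf e) (mX e)).
have pw e : rv_integrable P (fun w => f e (X e w) ^+ count_mem e s) /\
    `|expectR P (fun w => f e (X e w) ^+ count_mem e s)| <=
    (if e \in s then a ^+ count_mem e s / nn else 1).
  have cL : (count_mem e s <= L)%N by apply: leq_trans sL; exact: count_size.
  case: ifPn => [es|/count_memPn ->]; last first.
    under eq_fun do rewrite expr0; rewrite expectR_cst normr1; split=> //.
    exact: rv_integrable_cst.
  have Je : J e by move/allP: Js; apply.
  have cgt0 : (0 < count_mem e s)%N by rewrite -has_count has_pred1.
  have [c1|c1] := eqVneq (count_mem e s) 1%N.
    rewrite c1; under eq_fun do rewrite expr1.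
    have [i1 ->] := f1 e Je; split => //.
    by rewrite normr0 divr_ge0 ?exprn_ge0 // (le_trans _ nn1).
  have c2 : (2 <= count_mem e s <= L)%N.
    by rewrite cL andbT ltn_neqAle eq_sym c1.
  have := fm _ _ Je c2; under eq_integral do rewrite -normrX.
  move=> /(rv_integrable_bound _)[].
    exact: (measurable_funX _ (mfX e)).
  by move=> i1 h; split => //; apply: le_trans h; exact: expectR_abs.
have mg e : measurable_fun setT (fun x => f e x ^+ count_mem e s).
  exact: measurable_funX.
have [ip ep] := indep_prod mX indX mg (fun e => (pw e).1).
under eq_fun do rewrite (prod_seq_count (fun e => f e (X e _)) Js).
split; first exact: ip.
rewrite {1}/expectR ep /= normr_prod.
apply: (le_trans (y := \prod_(e | J e) (if e \in s then a ^+ count_mem e s / nn else 1))).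
  by apply: ler_prod => e Je; rewrite normr_ge0 /=; exact: (pw e).2.
rewrite le_eqVlt; apply/orP; left; apply/eqP.
transitivity (\prod_(e | J e) a ^+ count_mem e s * \prod_(e | J e && (e \in s)) nn^-1).
  rewrite [X in _ * X]big_mkcondr -big_split /=; apply: eq_bigr => e _.
  by case: ifPn => // /count_memPn ->; rewrite expr0 mulr1.
rewrite -(prod_seq_count (fun=> a)) // big_const_seq count_predT iter_mulr_1 prodr_const.
rewrite exprVn; congr (_ / nn ^+ _).
rewrite -(card_uniqP (undup_uniq s)); apply: eq_card => e.
rewrite unfold_in mem_undup /= andbC; case es: (e \in s) => //=.
by move/allP: Js => /(_ e es).
Qed.

Lemma expectR_uniq_monomial (f : I -> R -> R) :
  (forall i, measurable_fun setT (f i)) ->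
  (forall e, J e -> rv_integrable P (fun w => f e (X e w)) /\
                    expectR P (fun w => f e (X e w)) = 0) ->
  forall e0 (s : seq I), all J s -> uniq s -> e0 \in s ->
  rv_integrable P (fun w => \prod_(e <- s) f e (X e w)) /\
  expectR P (fun w => \prod_(e <- s) f e (X e w)) = 0.
Proof.
move=> mf f1 e0 s Js us e0s.
have cE e : count_mem e s = (e \in s) by exact: count_uniq_mem.
have mg e : measurable_fun setT (fun x => f e x ^+ count_mem e s).
  exact: measurable_funX.
have ig e : rv_integrable P (fun w => f e (X e w) ^+ count_mem e s).
  rewrite cE; case: (boolP (e \in s)) => es; last first.
    by under eq_fun do rewrite expr0; exact: rv_integrable_cst.
  under eq_fun do rewrite expr1; apply: (f1 e _).1; exact: (allP Js).
have [ip ep] := indep_prod mX indX mg ig.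
under eq_fun do rewrite (prod_seq_count (fun e => f e (X e _)) Js).
split; first exact: ip.
have Je0 : J e0 by exact: (allP Js).
rewrite {1}/expectR ep /= (bigD1 e0) //= cE e0s.
under eq_integral do rewrite expr1.
by rewrite -/(expectR P (fun w => f e0 (X e0 w))) (f1 e0 Je0).2 mul0r.
Qed.

End Monomials.

(** * Moments of walks *)

Section Walks.
Context (R : realType).

(** Independence concerns the entries on and above the diagonal; this is the representative there of
    an unordered pair. *)
Definition upper_edge n (i j : 'I_n) : 'I_n * 'I_n := if (i <= j)%N then (i, j) else (j, i).

(* [None] sums over one more vertex of a walk; [Some y] weights the endpoint of
   the walk by [y] and starts a new walk from the root. *)
Fixpoint walk n (Z : 'M[R]_n) (c : seq (option ('I_n -> R))) (root cur : 'I_n) : R :=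
  match c with
  | [::] => 1
  | None :: c' => \sum_x Z cur x * walk Z c' root x
  | Some y :: c' => y cur * walk Z c' root root
  end.

Fixpoint weights_le n (kap : R) (c : seq (option ('I_n -> R))) : Prop :=
  match c with
  | [::] => True
  | None :: c' => weights_le kap c'
  | Some y :: c' => (forall x, `|y x| <= kap) /\ weights_le kap c'
  end.

Lemma walk_powv n (Z : 'M[R]_n) r (y : 'cV[R]_n) c root cur :
  walk Z (nseq r None ++ Some (fun x : 'I_n => y x 0 : R) :: c) root cur =
  powv Z r y cur 0 * walk Z c root root.
Proof.
elim: r cur => [|r IH] cur //=.
rewrite mxE mulr_suml; apply: eq_bigr => x _.
by rewrite IH mulrA.
Qed.

Lemma walk_powvX n (Z : 'M[R]_n) r (y : 'cV[R]_n) m root :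
  walk Z (flatten (nseq m (nseq r None ++ [:: Some (fun x : 'I_n => y x 0 : R)]))) root root =
  powv Z r y root 0 ^+ m.
Proof.
elim: m => [|m IH] //=.
by rewrite -catA /= walk_powv IH exprS.
Qed.

Context d (T : measurableType d) (P : probability T R).
Context (n : nat) (Z : T -> 'M[R]_n) (a : R) (L : nat).
Local Notation J := (fun ij : 'I_n * 'I_n => (ij.1 <= ij.2)%N).
Hypothesis n0 : (0 < n)%N.
Hypothesis a0 : 0 <= a.
Hypothesis Zsym : forall w i j, Z w i j = Z w j i.
Hypothesis Zmon : forall s : seq ('I_n * 'I_n), all J s -> (size s <= L)%N ->
  rv_integrable P (fun w => \prod_(e <- s) Z w e.1 e.2) /\
  `|expectR P (fun w => \prod_(e <- s) Z w e.1 e.2)| <= a ^+ size s / n%:R ^+ size (undup s).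

Let steps (c : seq (option ('I_n -> R))) := count (fun o => ~~ isSome o) c.
Let resets (c : seq (option ('I_n -> R))) := count (fun o => isSome o) c.

(** [s] lists the edges already used and [W] contains the vertices visited. [W] has at most one
    vertex more than there are distinct edges, and each distinct edge is worth [1 / n]. Hence the
    sum over new vertices is free, while an old vertex is one of at most [L.+1]. *)
Lemma walk_moment (kap : R) c s (W : {set 'I_n}) root cur :
  0 <= kap -> weights_le kap c -> all J s -> root \in W -> cur \in W ->
  (forall e, e \in s -> (e.1 \in W) && (e.2 \in W)) ->
  (#|W| <= (size (undup s)).+1)%N -> (size s + steps c <= L)%N ->
  rv_integrable P (fun w => (\prod_(e <- s) Z w e.1 e.2) * walk (Z w) c root cur) /\
  `|expectR P (fun w => (\prod_(e <- s) Z w e.1 e.2) * walk (Z w) c root cur)| <=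
    kap ^+ resets c * a ^+ (size s + steps c) * (L.+2)%:R ^+ steps c * (n%:R / n%:R ^+ #|W|).
Proof.
move=> kap0; have n0' : (0 : R) < n%:R by rewrite ltr0n.
have n1 : (1 : R) <= n%:R by rewrite ler1n.
elim: c s W root cur => [|[y|] c IH] s W root cur /= wc Js rW cW sW cardW sL.
- rewrite addn0 in sL *; rewrite !expr0 mul1r mulr1.
  under eq_fun do rewrite mulr1.
  have [i1 e1] := Zmon Js sL; split => //; apply: le_trans e1 _.
  rewrite ler_wpM2l ?exprn_ge0 // ler_pdivlMr ?exprn_gt0 // mulrC ler_pdivrMr ?exprn_gt0 //.
  by rewrite -exprS ler_weXn2l.
- have [yk wc'] := wc.
  have [i1 e1] := IH s W root root wc' Js rW rW sW cardW sL.
  have E w : (\prod_(e <- s) Z w e.1 e.2) * (y cur * walk (Z w) c root root) =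
     y cur * ((\prod_(e <- s) Z w e.1 e.2) * walk (Z w) c root root) by rewrite mulrCA.
  under eq_fun do rewrite E; split; first exact: rv_integrableZ.
  rewrite expectRZ // normrM add0n add1n exprS -(mulrA kap) -(mulrA kap) -(mulrA kap).
  by apply: ler_pM.
pose s' x := upper_edge cur x :: s.
have E w : (\prod_(e <- s) Z w e.1 e.2) * (\sum_x Z w cur x * walk (Z w) c root x) =
   \sum_x (\prod_(e <- s' x) Z w e.1 e.2) * walk (Z w) c root x.
  rewrite mulr_sumr; apply: eq_bigr => x _; rewrite /s' big_cons mulrA; congr (_ * _).
  rewrite mulrC; congr (_ * _); rewrite /upper_edge; case: ifP => //= _.
under eq_fun do rewrite E.
have Js' x : all J (s' x).
  by rewrite /s' /= Js andbT /upper_edge; case: ifPn => //=; rewrite -ltnNge => /ltnW.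
have sL' x : (size (s' x) + steps c <= L)%N by rewrite /s' /= addSnnS -(add1n (steps c)).
have szs' x : (size (s' x) + steps c = size s + (1 + steps c))%N by rewrite /s' /= addSnnS add1n.
have WL : (#|W| <= L.+1)%N.
  apply: leq_trans cardW _; rewrite ltnS; apply: leq_trans (size_undup _) _.
  by apply: leq_trans sL; exact: leq_addr.
pose B := kap ^+ resets c * a ^+ (size s + (1 + steps c)) * (L.+2)%:R ^+ steps c.
have B0 : 0 <= B by rewrite !mulr_ge0 // exprn_ge0.
have HW x : x \in W ->
    rv_integrable P (fun w => (\prod_(e <- s' x) Z w e.1 e.2) * walk (Z w) c root x) /\
    `|expectR P (fun w => (\prod_(e <- s' x) Z w e.1 e.2) * walk (Z w) c root x)| <=
    B * (n%:R / n%:R ^+ #|W|).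
  move=> xW; have := IH (s' x) W root x wc (Js' x) rW xW; rewrite szs'; apply => //.
    move=> e; rewrite inE => /orP[/eqP ->|/sW //].
    by rewrite /upper_edge; case: ifP => _ /=; rewrite xW cW.
  apply: leq_trans cardW _; rewrite ltnS /=; case: ifP => //= _; exact: leqnSn.
have HnW x : x \notin W ->
    rv_integrable P (fun w => (\prod_(e <- s' x) Z w e.1 e.2) * walk (Z w) c root x) /\
    `|expectR P (fun w => (\prod_(e <- s' x) Z w e.1 e.2) * walk (Z w) c root x)| <=
    B * (n%:R ^+ #|W|)^-1.
  move=> xW; have := IH (s' x) (x |: W) root x wc (Js' x); rewrite szs' cardsU1 xW add1n exprS.
  rewrite invfM mulVKf ?gt_eqF //; apply => //.
  - by rewrite in_setU1 rW orbT.
  - by rewrite in_setU1 eqxx.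
  - move=> e; rewrite inE => /orP[/eqP ->|/sW /andP[e1 e2]].
      by rewrite /upper_edge; case: ifP => _ /=; rewrite !in_setU1 eqxx cW ?orbT.
    by rewrite !in_setU1 e1 e2 !orbT.
  (* The edges of [s] have both ends in [W], so an edge to a vertex outside [W] is new, and the
     number of distinct edges grows together with [W]. *)
  - rewrite ltnS; apply: leq_trans cardW _; rewrite /=; case: ifP => // /sW.
    by rewrite /upper_edge; case: ifP => _ /=; rewrite (negPf xW) ?andbF.
have Hint x : rv_integrable P (fun w => (\prod_(e <- s' x) Z w e.1 e.2) * walk (Z w) c root x).
  by case: (boolP (x \in W)) => [/HW|/HnW] [].
split; first by apply: rv_integrable_sum.
rewrite expectR_sum //; apply: le_trans (ler_norm_sum _ _ _) _.
rewrite (bigID (mem W)) /=.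
apply: (le_trans (y := \sum_(x in W) B * (n%:R / n%:R ^+ #|W|) +
   \sum_(x | x \notin W) B * (n%:R ^+ #|W|)^-1)).
  by apply: lerD; apply: ler_sum => x xW; [exact: (HW x xW).2|exact: (HnW x xW).2].
rewrite !sumr_const -[X in X + _ <= _]mulr_natr -[X in _ + X <= _]mulr_natr.
(* [L.+2] splits into [L.+1], a bound for the number of old vertices, and [1] for all new vertices
   together: there are at most [n] of them, each at the price [1 / n]. *)
have -> : kap ^+ (0 + resets c) * a ^+ (size s + (1 + steps c)) * L.+2%:R ^+ (1 + steps c)
   * (n%:R / n%:R ^+ #|W|) = B * (n%:R / n%:R ^+ #|W|) * L.+1%:R + B * (n%:R / n%:R ^+ #|W|).
  by rewrite /B -[L.+2%:R]natr1 add0n add1n (exprS _ (steps c)); ring.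
apply: lerD.
  by rewrite ler_wpM2l ?ler_nat // mulr_ge0 // divr_ge0 ?exprn_ge0.
rewrite -mulrA ler_wpM2l // mulrC ler_wpM2r ?invr_ge0 ?exprn_ge0 // ler_nat.
by apply: leq_trans (max_card _) _; rewrite card_ord.
Qed.

(** The power is a sum over [m] walks of length [r] from the root [i], and the count starts with
    [W = {i}]. The factor [L.+2], of order [ln n] when the moment order is, is the source of the
    logarithm in the noise bounds. *)
Lemma powv_moment (kap : R) (y : 'cV[R]_n) r m i : 0 <= kap ->
  (forall x, `|y x 0| <= kap) -> (r * m <= L)%N ->
  rv_integrable P (fun w => powv (Z w) r y i 0 ^+ m) /\
  `|expectR P (fun w => powv (Z w) r y i 0 ^+ m)| <= (kap * (a * (L.+2)%:R) ^+ r) ^+ m.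
Proof.
move=> kap0 yk rm.
pose c : seq (option ('I_n -> R)) := flatten (nseq m (nseq r None ++ [:: Some (fun x : 'I_n => y x 0 : R)])).
have stc : steps c = (r * m)%N.
  rewrite /steps /c; elim: (m) => [|k IH] /=; first by rewrite muln0.
  rewrite !count_cat IH count_nseq /= mul1n mulnS.
  by transitivity (r + 0 + r * k)%N; rewrite ?addn0.
have rsc : resets c = m.
  rewrite /resets /c; elim: (m) => [|k IH] //=.
  by rewrite !count_cat IH count_nseq /= mul0n.
have wc : weights_le kap c.
  rewrite /c; elim: (m) => [|k IH]; first by [].
  have cc r' : weights_le kap (nseq r' None ++ [:: Some (fun x : 'I_n => y x 0 : R)] ++
      flatten (nseq k (nseq r None ++ [:: Some (fun x : 'I_n => y x 0 : R)]))).
    by elim: r' => [|r' IHr]; [split; [exact: yk|exact: IH]|exact: IHr].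
  by have := cc r; rewrite catA.
have := @walk_moment kap c [::] [set i] i i kap0 wc isT; rewrite !inE eqxx.
move=> /(_ isT isT (fun e => ltac:(done))); rewrite cards1 => /(_ isT).
rewrite add0n stc rsc => /(_ rm).
under eq_fun do rewrite big_nil mul1r walk_powvX.
rewrite expr1 divff ?mulr1 ?pnatr_eq0 -?lt0n // => -[i1 e1]; split => //.
apply: le_trans e1 _; rewrite exprMn -mulrA ler_wpM2l ?exprn_ge0 //.
by rewrite -exprM exprMn.
Qed.

End Walks.

(** * Norm and entry bounds with high probability *)

Section PowerIteration.
Variable R : rcfType.

Lemma powv_sqr n (Z : 'M[R]_n) k x : powv (Z *m Z) k x = powv Z (k + k) x.
Proof. by elim: k => //= k IH; rewrite addnS /= IH mulmxA. Qed.

(* Log-convexity of [s -> dot x (Z^(2s) x)], along powers of two. *)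
Lemma dot_powv_convex n (Z : 'M[R]_n) x t : Z^T = Z -> dot x x = 1 ->
  dot (Z *m x) (Z *m x) ^+ (2 ^ t) <= dot (powv Z (2 ^ t) x) (powv Z (2 ^ t) x).
Proof.
elim: t Z => [|t IH] Z Zs x1; first by rewrite expn0 expr1.
have Z2 : (Z *m Z)^T = Z *m Z by rewrite trmx_mul Zs.
have := IH _ Z2 x1; rewrite powv_sqr addnn -mul2n -expnS; apply: le_trans.
rewrite expnS exprM lerXn2r ?nnegrE ?dot_ge0 ?sqr_ge0 //.
have -> : dot (Z *m x) (Z *m x) = dot x (Z *m Z *m x) by rewrite -mulmxA [in RHS]dot_mulmx Zs.
by apply: le_trans (dot_CS _ _) _; rewrite x1 mul1r.
Qed.

Definition unitv n (i : 'I_n) : 'cV[R]_n := delta_mx i 0.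

Lemma dot_unitv n (i : 'I_n) x : dot (unitv i) x = x i 0.
Proof.
rewrite /dot (bigD1 i) //= big1 ?addr0; first by rewrite mxE !eqxx mul1r.
by move=> j /negPf ji; rewrite mxE ji mul0r.
Qed.

(** The sum on the right is the trace of [Z ^ (2 s)], which for symmetric [Z] is the squared
    Frobenius norm of [Z ^ s]. *)
Lemma powv_frobenius n (Z : 'M[R]_n) s x : Z^T = Z ->
  dot (powv Z s x) (powv Z s x) <= (\sum_i powv Z (s + s) (unitv i) i 0) * dot x x.
Proof.
move=> Zs; rewrite mulr_suml; apply: ler_sum => i _.
have e1 : powv Z s x i 0 = dot (powv Z s (unitv i)) x by rewrite dot_powv // dot_unitv.
have e2 : powv Z (s + s) (unitv i) i 0 = dot (powv Z s (unitv i)) (powv Z s (unitv i)).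
  by rewrite dot_powv // dot_unitv /powv iterD.
by rewrite e1 e2 -expr2 dot_CS.
Qed.

Lemma opnorm_of_trace n (Z : 'M[R]_n) t tau : Z^T = Z -> 0 <= tau ->
  \sum_i powv Z (2 ^ t + 2 ^ t) (unitv i) i 0 <= tau ^+ (2 * 2 ^ t) ->
  forall x, dot (Z *m x) (Z *m x) <= tau ^+ 2 * dot x x.
Proof.
move=> Zs tau0 tr; have H x : dot x x = 1 -> dot (Z *m x) (Z *m x) <= tau ^+ 2.
  move=> x1; rewrite -(ler_pXn2r (n := 2 ^ t)) ?expn_gt0 ?nnegrE ?dot_ge0 ?sqr_ge0 //.
  apply: le_trans (dot_powv_convex t Zs x1) _.
  by apply: le_trans (powv_frobenius _ _ Zs) _; rewrite x1 mulr1 -exprM.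
move=> x; have [->|x0] := eqVneq x 0.
  by rewrite mulmx0 /dot !big1 ?mulr0 // => i _; rewrite mxE mul0r.
have xx : 0 < dot x x by rewrite lt_neqAle eq_sym dot_eq0 x0 dot_ge0.
pose c := (Num.sqrt (dot x x))^-1.
have c2 : c ^+ 2 = (dot x x)^-1 by rewrite exprVn sqr_sqrtr // ltW.
have := H (c *: x); rewrite -scalemxAr !(dotZl, dotZr) !mulrA -expr2 c2.
rewrite mulVf ?gt_eqF // => /(_ erefl).
by rewrite mulrC ler_pdivrMr.
Qed.

End PowerIteration.

(** * A single Markov bound for all high-probability estimates *)

Section GoodEvent.
Context (R : realType) d0 (T : measurableType d0) (P : probability T R).
Context (n d : nat) (E : T -> 'M[R]_n) (U : 'M[R]_(n, d)) (sig2 : 'I_n -> 'I_n -> R).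
Context (a aY nu b : R) (L N t : nat).
Local Notation J := (fun ij : 'I_n * 'I_n => (ij.1 <= ij.2)%N).
Hypothesis n0 : (0 < n)%N.
Hypothesis Esym : forall w i j, E w i j = E w j i.
Hypothesis mE : forall i j, measurable_fun setT (fun w => E w i j).
Hypothesis E0 : forall i j, rv_integrable P (fun w => E w i j) /\
  expectR P (fun w => E w i j) = 0.
Hypothesis sig2E : forall i j, rv_integrable P (fun w => E w i j ^+ 2) /\
  expectR P (fun w => E w i j ^+ 2) = sig2 i j.
Hypothesis indE : mutually_independent P J (fun ij w => E w ij.1 ij.2).
Hypothesis a0 : 0 < a.
Hypothesis aY0 : 0 < aY.
Hypothesis mom : forall i j m, (2 <= m <= L)%N ->
  (\int[P]_w (`|E w i j| ^+ m)%:E <= (a ^+ m / n%:R)%:E)%E.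
Hypothesis momY : forall i j m, (2 <= m <= L)%N ->
  (\int[P]_w (`|E w i j ^+ 2 - sig2 i j| ^+ m)%:E <= (aY ^+ m / n%:R)%:E)%E.

Let sig2_sym i j : sig2 i j = sig2 j i.
Proof.
by rewrite -(sig2E i j).2 -(sig2E j i).2; congr expectR; apply/funext => w; rewrite Esym.
Qed.

(** The centred squares are again independent and centred on and above the diagonal, and the
    deviation of a row sum is an entry of [Y] applied to the all-ones vector, so the walk bound
    covers it at length one. *)
Let Y w := \matrix_(i, j) (E w i j ^+ 2 - sig2 i j).

Let Ysym w i j : Y w i j = Y w j i.
Proof. by rewrite !mxE Esym sig2_sym. Qed.

Let n1 : (1 : R) <= n%:R. Proof. by rewrite ler1n. Qed.

Let Emon (s : seq ('I_n * 'I_n)) : all J s -> (size s <= L)%N ->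
  rv_integrable P (fun w => \prod_(e <- s) E w e.1 e.2) /\
  `|expectR P (fun w => \prod_(e <- s) E w e.1 e.2)| <= a ^+ size s / n%:R ^+ size (undup s).
Proof.
apply: (@expectR_monomial _ _ _ P _ J (fun ij w => E w ij.1 ij.2) _ indE (fun _ x => x)).
- by move=> [i j]; exact: mE.
- by move=> i; exact: measurable_id.
- exact: ltW.
- exact: n1.
- by move=> [i j] _; exact: E0.
- by move=> [i j] m _ mL; exact: mom.
Qed.

Let Ymon (s : seq ('I_n * 'I_n)) : all J s -> (size s <= L)%N ->
  rv_integrable P (fun w => \prod_(e <- s) Y w e.1 e.2) /\
  `|expectR P (fun w => \prod_(e <- s) Y w e.1 e.2)| <= aY ^+ size s / n%:R ^+ size (undup s).
Proof.
have -> : (fun w => \prod_(e <- s) Y w e.1 e.2) =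
    (fun w => \prod_(e <- s) (E w e.1 e.2 ^+ 2 - sig2 e.1 e.2)).
  by apply/funext => w; apply: eq_bigr => e _; rewrite mxE.
apply: (@expectR_monomial _ _ _ P _ J (fun ij w => E w ij.1 ij.2) _ indE
  (fun e x => x ^+ 2 - sig2 e.1 e.2)).
- by move=> [i j]; exact: mE.
- by move=> i; apply: measurable_funB => //; exact: measurable_cst.
- exact: ltW.
- exact: n1.
- move=> [i j] _ /=; have [i2 e2] := sig2E i j; split.
    by apply: (rv_integrableD i2 (rv_integrable_cst P (- sig2 i j))).
  by rewrite (expectRD i2 (rv_integrable_cst P (- sig2 i j))) expectR_cst e2 subrr.
- by move=> [i j] m _ mL; exact: momY.
Qed.

Let tau := b * (a * L.+2%:R).
Let tauY := b * (aY * L.+2%:R).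
Let s := (2 ^ t)%N.

Hypothesis nu0 : 0 < nu.
Hypothesis b1 : 1 <= b.
Hypothesis U_nu : forall i l, `|U i l| <= nu.
Hypothesis NL : (N * (2 * s) <= L)%N.
Hypothesis N0 : (0 < N)%N.

Let b0 : 0 < b. Proof. exact: lt_le_trans b1. Qed.
Let tau0 : 0 < tau. Proof. by rewrite !mulr_gt0. Qed.
Let tauY0 : 0 < tauY. Proof. by rewrite !mulr_gt0. Qed.

Let X r l i w := powv (E w) r.+1 (col l U) i 0.

(* Each summand is a normalised moment of order [2s], so [E S <= card * b^(-2s)]
   and all the bounds hold as soon as [S w <= 1]. *)
Let S w := \sum_(r < N) \sum_(l < d) \sum_(i < n) ((nu * tau ^+ r.+1)^-1 ^+ (2 * s) * X r l i w ^+ (2 * s))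
  + tau^-1 ^+ (2 * s) * (\sum_(i < n) powv (E w) (2 * s) (unitv R i) i 0 ^+ 1)
  + tauY^-1 ^+ (2 * s) * (\sum_(i < n) powv (Y w) 1 (const_mx 1) i 0 ^+ (2 * s)).

Let even_pos (x : R) : 0 <= x ^+ (2 * s).
Proof. by rewrite exprM exprn_ge0 // sqr_ge0. Qed.

Let S_terms r l i : (r < N)%N ->
  rv_integrable P (fun w => X r l i w ^+ (2 * s)) /\
  (nu * tau ^+ r.+1)^-1 ^+ (2 * s) * expectR P (fun w => X r l i w ^+ (2 * s)) <= b^-1 ^+ (2 * s).
Proof.
move=> rN; have yn x : `|col l U x 0| <= nu by rewrite mxE.
have rs : (r.+1 * (2 * s) <= L)%N by apply: leq_trans NL; rewrite leq_mul2r rN orbT.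
have [i1 e1] := powv_moment n0 (ltW a0) Esym Emon i (ltW nu0) yn rs.
split => //; have := ler_norm (expectR P (fun w => X r l i w ^+ (2 * s))) => /le_trans /(_ e1).
move=> /(ler_wpM2l (even_pos (nu * tau ^+ r.+1)^-1)) h; apply: le_trans h _.
have bV1 : b^-1 <= 1 by rewrite invf_le1.
have E1 : (nu * tau ^+ r.+1)^-1 * (nu * (a * L.+2%:R) ^+ r.+1) = b^-1 ^+ r.+1.
  have q0 : (a * L.+2%:R) ^+ r.+1 != 0 by rewrite expf_neq0 // mulf_neq0 ?gt_eqF.
  have B0 : b ^+ r.+1 != 0 by rewrite expf_neq0 // gt_eqF.
  rewrite /tau (exprMn _ b) exprVn; move: (b ^+ r.+1) ((a * L.+2%:R) ^+ r.+1) B0 q0 => B q B0 q0.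
  by field; rewrite B0 q0 gt_eqF.
rewrite -exprMn E1 -exprM; apply: ler_wiXn2l => //; first by rewrite invr_ge0 ltW.
by rewrite leq_pmull.
Qed.

Let s0 : (0 < s)%N. Proof. by rewrite expn_gt0. Qed.

Let tr_term i : rv_integrable P (fun w => powv (E w) (2 * s) (unitv R i) i 0 ^+ 1) /\
  tau^-1 ^+ (2 * s) * expectR P (fun w => powv (E w) (2 * s) (unitv R i) i 0 ^+ 1) <= b^-1 ^+ (2 * s).
Proof.
have yn x : `|unitv R i x 0| <= 1.
  by rewrite mxE; case: (_ && _); rewrite /= ?normr1 ?normr0.
have rs : (2 * s * 1 <= L)%N by apply: leq_trans NL; rewrite muln1 leq_pmull.
have [i1 e1] := powv_moment n0 (ltW a0) Esym Emon i ler01 yn rs.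
split => //; have := ler_norm (expectR P (fun w => powv (E w) (2 * s) (unitv R i) i 0 ^+ 1)).
move=> /le_trans /(_ e1) /(ler_wpM2l (even_pos tau^-1)) h; apply: le_trans h _.
rewrite mul1r expr1 -exprMn /tau invfM -mulrA mulVf ?mulr1 // gt_eqF // mulr_gt0 //.
Qed.

Let Y_term i : rv_integrable P (fun w => powv (Y w) 1 (const_mx 1) i 0 ^+ (2 * s)) /\
  tauY^-1 ^+ (2 * s) * expectR P (fun w => powv (Y w) 1 (const_mx 1) i 0 ^+ (2 * s)) <= b^-1 ^+ (2 * s).
Proof.
have yn x : `|(const_mx 1 : 'cV[R]_n) x 0| <= 1 by rewrite mxE normr1.
have rs : (1 * (2 * s) <= L)%N by apply: leq_trans NL; rewrite leq_mul2r N0 orbT.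
have [i1 e1] := powv_moment n0 (ltW aY0) Ysym Ymon i ler01 yn rs.
split => //; have := ler_norm (expectR P (fun w => powv (Y w) 1 (const_mx 1) i 0 ^+ (2 * s))).
move=> /le_trans /(_ e1) /(ler_wpM2l (even_pos tauY^-1)) h; apply: le_trans h _.
rewrite mul1r expr1 -exprMn /tauY invfM -mulrA mulVf ?mulr1 // gt_eqF // mulr_gt0 //.
Qed.

Let bV := b^-1 ^+ (2 * s).

Let S_int : rv_integrable P S /\ expectR P S <= (N * d * n + 2 * n)%:R * bV.
Proof.
have i1 r l i : (r < N)%N ->
    rv_integrable P (fun w => (nu * tau ^+ r.+1)^-1 ^+ (2 * s) * X r l i w ^+ (2 * s)).
  by move=> rN; apply: rv_integrableZ; case: (S_terms l i rN).
have i2 : rv_integrable P (fun w => \sum_(r < N) \sum_(l < d) \sum_(i < n)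
    ((nu * tau ^+ r.+1)^-1 ^+ (2 * s) * X r l i w ^+ (2 * s))).
  by do 3! (apply: rv_integrable_sum => ? _); exact: i1.
have i3 : rv_integrable P (fun w => \sum_(i < n) powv (E w) (2 * s) (unitv R i) i 0 ^+ 1).
  by apply: rv_integrable_sum => i _; case: (tr_term i).
have i4 : rv_integrable P (fun w => \sum_(i < n) powv (Y w) 1 (const_mx 1) i 0 ^+ (2 * s)).
  by apply: rv_integrable_sum => i _; case: (Y_term i).
have i34 := (rv_integrableZ (tau^-1 ^+ (2 * s)) i3, rv_integrableZ (tauY^-1 ^+ (2 * s)) i4).
have i23 := rv_integrableD i2 i34.1.
split; first exact: (rv_integrableD i23 i34.2).
rewrite (expectRD i23 i34.2) (expectRD i2 i34.1) !expectRZ //.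
have bV0 : 0 <= bV by exact: even_pos.
have -> : (N * d * n + 2 * n)%:R * bV = (N * d * n)%:R * bV + n%:R * bV + n%:R * bV.
  by rewrite natrD natrM (natrM _ 2); ring.
apply: lerD; first apply: lerD.
- rewrite expectR_sum => [|r _]; last first.
    by do 2! (apply: rv_integrable_sum => ? _); exact: i1.
  apply: (le_trans (y := \sum_(r < N) \sum_(l < d) \sum_(i < n) bV)).
    apply: ler_sum => r _; rewrite expectR_sum => [|l _]; last first.
      by apply: rv_integrable_sum => ? _; exact: i1.
    apply: ler_sum => l _; rewrite expectR_sum => [|i _]; last exact: i1.
    apply: ler_sum => i _; have [i5 e5] := S_terms l i (ltn_ord r).
    by rewrite expectRZ.
  rewrite !sumr_const !card_ord -!mulrnA mulr_natl.
  have E1 : (n * d * N)%N = (N * d * n)%N by rewrite mulnC mulnA mulnAC.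
  by rewrite ?mulnA ?E1.
- rewrite expectR_sum => [|i _]; last by case: (tr_term i).
  rewrite mulr_sumr; apply: (le_trans (y := \sum_(i < n) bV)).
    by apply: ler_sum => i _; case: (tr_term i).
  by rewrite sumr_const card_ord mulr_natl.
- rewrite expectR_sum => [|i _]; last by case: (Y_term i).
  rewrite mulr_sumr; apply: (le_trans (y := \sum_(i < n) bV)).
    by apply: ler_sum => i _; case: (Y_term i).
  by rewrite sumr_const card_ord mulr_natl.
Qed.

Lemma good_event : exists G : set T, [/\ measurable G,
  ((1 - (N * d * n + 2 * n)%:R * b^-1 ^+ (2 * 2 ^ t))%:E <= P G)%E &
  forall w, G w ->
  [/\ forall x, dot (E w *m x) (E w *m x) <= tau ^+ 2 * dot x x,
      forall l r i, (r <= N)%N -> `|powv (E w) r (col l U) i 0| <= tau ^+ r * nu &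
      forall i, `|\sum_j E w i j ^+ 2 - \sum_j sig2 i j| <= tauY]].
Proof.
have [iS eS] := S_int.
have Etr w : (E w)^T = E w by apply/matrixP => i j; rewrite mxE Esym.
have Xpos w r l i : 0 <= (nu * tau ^+ r.+1)^-1 ^+ (2 * s) * X r l i w ^+ (2 * s).
  by rewrite mulr_ge0.
have S1pos w : 0 <= \sum_(r < N) \sum_(l < d) \sum_(i < n)
    ((nu * tau ^+ r.+1)^-1 ^+ (2 * s) * X r l i w ^+ (2 * s)).
  by do 3! (apply: sumr_ge0 => ? _).
have trE w i : powv (E w) (2 * s) (unitv R i) i 0 =
    dot (powv (E w) s (unitv R i)) (powv (E w) s (unitv R i)).
  by rewrite dot_powv // dot_unitv mul2n -addnn /powv iterD.
have S2pos w : 0 <= tau^-1 ^+ (2 * s) * (\sum_(i < n) powv (E w) (2 * s) (unitv R i) i 0 ^+ 1).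
  by rewrite mulr_ge0 // sumr_ge0 // => i _; rewrite expr1 trE dot_ge0.
have S3pos w : 0 <= tauY^-1 ^+ (2 * s) * (\sum_(i < n) powv (Y w) 1 (const_mx 1) i 0 ^+ (2 * s)).
  by rewrite mulr_ge0 // sumr_ge0.
have Spos w : 0 <= S w by rewrite /S !addr_ge0.
have mS := rv_integrable_measurable iS.
have mG : measurable [set w | 1 < S w].
  rewrite (_ : [set w | _] = S @^-1` `]1, +oo[%classic).
    by rewrite -[X in measurable X]setTI; apply: mS => //; exact: measurable_itv.
  by apply/seteqP; split=> w /=; rewrite in_itv /= andbT.
exists (~` [set w | 1 < S w]); split; first exact: measurableC.
  rewrite probability_setC // EFinB; apply: leeB => //.
  apply: le_trans (markov_ge0 iS Spos ltr01) _.
  by rewrite divr1 lee_fin.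
(* All summands of [S] are nonnegative, being even powers or diagonal entries of an even power of
   [E], so [S w <= 1] bounds each of them separately. *)
have even_bound (x c : R) : 0 < c -> c^-1 ^+ (2 * s) * x ^+ (2 * s) <= 1 -> `|x| <= c.
  move=> c0; rewrite -exprMn => h.
  have h2 : `|c^-1 * x| ^+ (2 * s) <= 1 ^+ (2 * s) by rewrite expr1n -normrX ger0_norm.
  move: h2; rewrite ler_pXn2r ?nnegrE ?muln_gt0 // normrM gtr0_norm ?invr_gt0 //.
  by rewrite ler_pdivrMl // mulr1.
move=> w /negP; rewrite -leNgt => Sw; split.
- apply: (opnorm_of_trace (t := t)) => //; first exact: ltW.
  have : tau^-1 ^+ (2 * s) * (\sum_(i < n) powv (E w) (2 * s) (unitv R i) i 0 ^+ 1) <= 1.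
    apply: le_trans Sw; rewrite /S -addrA addrCA lerDl addr_ge0 //.
  rewrite exprVn ler_pdivrMl ?exprn_gt0 // mulr1; apply: le_trans.
  by apply: ler_sum => i _; rewrite expr1 mul2n -addnn.
(* The case [r = 0] is the bound on [U] itself; [S] contains only the positive powers. *)
- move=> l [|r] i rN; first by rewrite expr0 mul1r /= mxE.
  rewrite mulrC; apply: even_bound; first by rewrite mulr_gt0 ?exprn_gt0.
  apply: le_trans Sw; rewrite /S -addrA; apply: ler_wpDr; first exact: addr_ge0.
  rewrite (bigD1 (Ordinal rN)) //= (bigD1 l) //= (bigD1 i) //= -!addrA lerDl.
  by rewrite !addr_ge0 // !sumr_ge0 // => ? _; rewrite ?sumr_ge0 // => ? _; rewrite ?sumr_ge0.
- move=> i; have -> : \sum_j E w i j ^+ 2 - \sum_j sig2 i j = powv (Y w) 1 (const_mx 1) i 0.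
    by rewrite /= mxE -sumrB; apply: eq_bigr => j _; rewrite !mxE mulr1.
  apply: even_bound => //; apply: le_trans Sw; rewrite /S; apply: ler_wpDl.
    exact: addr_ge0.
  by rewrite mulr_sumr (bigD1 i) //= lerDl sumr_ge0 // => ? _; rewrite mulr_ge0.
Qed.

End GoodEvent.

(** * Second moments *)

Lemma le_sum6 (R : realFieldType) (x1 x2 x3 x4 x5 x6 : R) :
  0 <= x1 -> 0 <= x2 -> 0 <= x3 -> 0 <= x4 -> 0 <= x5 -> 0 <= x6 ->
  let s := x1 + x2 + x3 + x4 + x5 + x6 in
  [/\ x1 <= s, x2 <= s, x3 <= s, x4 <= s & x5 <= s /\ x6 <= s].
Proof. by move=> ? ? ? ? ? ? /=; split; try split; lra. Qed.

Section SecondMoments.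
Context (R : realType) d0 (T : measurableType d0) (P : probability T R).
Context (n d : nat) (E : T -> 'M[R]_n) (U : 'M[R]_(n, d)) (a nu : R).
Local Notation J := (fun ij : 'I_n * 'I_n => (ij.1 <= ij.2)%N).
Hypothesis n0 : (0 < n)%N.
Hypothesis Esym : forall w i j, E w i j = E w j i.
Hypothesis mE : forall i j, measurable_fun setT (fun w => E w i j).
Hypothesis E0 : forall i j, rv_integrable P (fun w => E w i j) /\
  expectR P (fun w => E w i j) = 0.
Hypothesis indE : mutually_independent P J (fun ij w => E w ij.1 ij.2).
Hypothesis a0 : 0 < a.
Hypothesis mom : forall i j m, (2 <= m <= 4)%N ->
  (\int[P]_w (`|E w i j| ^+ m)%:E <= (a ^+ m / n%:R)%:E)%E.
Hypothesis nu0 : 0 < nu.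
Hypothesis U_nu : forall i l, `|U i l| <= nu.

Lemma upper_edgeP w i j : E w i j = E w (upper_edge i j).1 (upper_edge i j).2.
Proof. by rewrite /upper_edge; case: ifP => //= _; exact: Esym. Qed.

Lemma upper_edge_J i j : J (upper_edge i j).
Proof. by rewrite /upper_edge; case: ifPn => //=; rewrite -ltnNge => /ltnW. Qed.

Lemma uncorrelated i j k l : upper_edge i j != upper_edge k l ->
  rv_integrable P (fun w => E w i j * E w k l) /\ expectR P (fun w => E w i j * E w k l) = 0.
Proof.
move=> ne.
have := @expectR_uniq_monomial _ _ _ P _ J (fun ij w => E w ij.1 ij.2)
  (fun ij => mE ij.1 ij.2) indE (fun _ x => x) (fun _ => @measurable_id _ _ setT)
  (fun ij _ => E0 ij.1 ij.2) (upper_edge i j) [:: upper_edge i j; upper_edge k l].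
rewrite [all _ _]/= !upper_edge_J [uniq _]/= !inE ne eqxx => /(_ isT isT isT).
have -> : (fun w => \prod_(e <- [:: upper_edge i j; upper_edge k l]) E w e.1 e.2) =
    (fun w => E w i j * E w k l); last by [].
by apply/funext => w; rewrite big_cons big_seq1 -!upper_edgeP.
Qed.

Lemma variance_bound i j : rv_integrable P (fun w => E w i j ^+ 2) /\
  0 <= expectR P (fun w => E w i j ^+ 2) <= a ^+ 2 / n%:R.
Proof.
have := mom i j (m := 2) isT; under eq_integral do rewrite -normrX.
move=> /(rv_integrable_bound _)[|i2 e2]; first exact: measurable_funX.
split=> //; rewrite expectR_ge0 /= => [|w]; last exact: sqr_ge0.
by apply: le_trans e2; apply: le_trans (expectR_abs i2); exact: ler_norm.
Qed.

Let n1 : (1 : R) <= n%:R. Proof. by rewrite ler1n. Qed.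
Let npos : (0 : R) < n%:R. Proof. by rewrite ltr0n. Qed.

Let Emon r (s : seq ('I_n * 'I_n)) : (r <= 2)%N -> all J s -> (size s <= r * 2)%N ->
  rv_integrable P (fun w => \prod_(e <- s) E w e.1 e.2) /\
  `|expectR P (fun w => \prod_(e <- s) E w e.1 e.2)| <= a ^+ size s / n%:R ^+ size (undup s).
Proof.
move=> r2; apply: (@expectR_monomial _ _ _ P _ J (fun ij w => E w ij.1 ij.2) _ indE (fun _ x => x)).
- by move=> [i j]; exact: mE.
- by move=> i; exact: measurable_id.
- exact: ltW.
- exact: n1.
- by move=> [i j] _; exact: E0.
- move=> [i j] m _ /andP[m2 mL]; apply: mom; rewrite m2 (leq_trans mL) //.
  by rewrite -[4%N]/(2 * 2)%N leq_mul2r.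
Qed.

(** The walk bound is used at the fixed order [L = r * 2], so [L.+2] is at most [6] and no logarithm
    appears. *)
Lemma powv_second_moment r l i : (r <= 2)%N ->
  rv_integrable P (fun w => powv (E w) r (col l U) i 0 ^+ 2) /\
  expectR P (fun w => powv (E w) r (col l U) i 0 ^+ 2) <= (nu * (a * (r * 2).+2%:R) ^+ r) ^+ 2.
Proof.
move=> r2; have yn x : `|col l U x 0| <= nu by rewrite mxE.
have [i1 e1] := powv_moment n0 (ltW a0) Esym (fun s => @Emon r s r2) i (ltW nu0) yn (leqnn _).
by split => //; apply: le_trans (ler_norm _) e1.
Qed.

(** An entry is correlated only with itself and its transpose, so at most [2 n^2] pairs survive,
    each contributing at most [nu^4 a^2 / n]. With [nu] of order [n^(-1/2)] the root of this bound
    is of order [n^(-1/2) a]. *)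
Lemma bilinear_second_moment l l' :
  rv_integrable P (fun w => dot (col l U) (E w *m col l' U) ^+ 2) /\
  expectR P (fun w => dot (col l U) (E w *m col l' U) ^+ 2) <= 2 * n%:R * nu ^+ 4 * a ^+ 2.
Proof.
pose c (e : 'I_n * 'I_n) := U e.1 l * U e.2 l'.
have XE w : dot (col l U) (E w *m col l' U) ^+ 2 =
    \sum_(e : 'I_n * 'I_n) \sum_(f : 'I_n * 'I_n) c e * c f * (E w e.1 e.2 * E w f.1 f.2).
  have X1 : dot (col l U) (E w *m col l' U) = \sum_(e : 'I_n * 'I_n) c e * E w e.1 e.2.
    rewrite -(pair_bigA _ (fun i j => U i l * U j l' * E w i j)) /=.
    apply: eq_bigr => i _; rewrite !mxE mulr_sumr; apply: eq_bigr => j _.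
    by rewrite !mxE; ring.
  rewrite X1 expr2 mulr_suml; apply: eq_bigr => e _; rewrite mulr_sumr.
  by apply: eq_bigr => f _; ring.
have cn e f : `|c e * c f| <= nu ^+ 4.
  rewrite !normrM (_ : nu ^+ 4 = nu * nu * (nu * nu)); last by ring.
  by rewrite !ler_pM ?mulr_ge0.
have key e f : rv_integrable P (fun w => E w e.1 e.2 * E w f.1 f.2) /\
    `|expectR P (fun w => E w e.1 e.2 * E w f.1 f.2)| <=
      if upper_edge e.1 e.2 == upper_edge f.1 f.2 then a ^+ 2 / n%:R else 0.
  case: eqP => [ef|/eqP ne]; last first.
    by have [i1 ->] := uncorrelated ne; rewrite normr0.
  have -> : (fun w => E w e.1 e.2 * E w f.1 f.2) = (fun w => E w e.1 e.2 ^+ 2).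
    apply/funext => w; rewrite expr2; congr (_ * _).
    by rewrite (upper_edgeP w f.1) -ef -upper_edgeP.
  have [i2 /andP[e2 e3]] := variance_bound e.1 e.2.
  by rewrite ger0_norm.
have i1 e f : rv_integrable P (fun w => c e * c f * (E w e.1 e.2 * E w f.1 f.2)).
  by apply: rv_integrableZ; case: (key e f).
have -> : (fun w => dot (col l U) (E w *m col l' U) ^+ 2) = (fun w =>
    \sum_(e : 'I_n * 'I_n) \sum_(f : 'I_n * 'I_n) c e * c f * (E w e.1 e.2 * E w f.1 f.2)).
  exact/funext.
split; first by do 2! (apply: rv_integrable_sum => ? _).
rewrite expectR_sum => [|e _]; last by apply: rv_integrable_sum.
apply: (le_trans (y := \sum_(e : 'I_n * 'I_n) nu ^+ 4 * (2 * (a ^+ 2 / n%:R)))).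
  apply: ler_sum => e _; rewrite expectR_sum //.
  apply: (le_trans (y := \sum_(f : 'I_n * 'I_n)
     (if f \in [:: e; (e.2, e.1)] then nu ^+ 4 * (a ^+ 2 / n%:R) else 0))).
    apply: ler_sum => f _; have [i2 e2] := key e f.
    rewrite expectRZ //; apply: le_trans (ler_norm _) _; rewrite normrM.
    have nu4 : 0 <= nu ^+ 4 by rewrite exprn_ge0 // ltW.
    case: ifPn => [_|nf].
      apply: ler_pM => //; apply: le_trans e2 _; case: ifP => // _.
      by rewrite divr_ge0 // sqr_ge0.
    suff ne : upper_edge e.1 e.2 != upper_edge f.1 f.2.
      by move: e2; rewrite (negPf ne) normr_le0 => /eqP ->; rewrite normr0 mulr0.
    apply: contraNneq nf; rewrite !inE; case: e f {e2 i2} => [i j] [i' j'] /=.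
    rewrite /upper_edge; case: ifP => _; case: ifP => _ [-> ->]; by rewrite ?eqxx ?orbT.
  rewrite -big_mkcond /= -big_filter big_const_seq iter_addr_0 count_predT.
  rewrite -[leLHS]mulr_natl [leRHS]mulrCA; apply: ler_wpM2r.
    by rewrite mulr_ge0 ?exprn_ge0 ?divr_ge0 ?sqr_ge0 // ltW.
  rewrite ler_nat -[leqRHS]/(size [:: e; (e.2, e.1)]); apply: uniq_leq_size.
    by rewrite filter_uniq // index_enum_uniq.
  by move=> f; rewrite mem_filter => /andP[].
rewrite sumr_const card_prod card_ord -[leLHS]mulr_natl natrM.
rewrite le_eqVlt; apply/orP; left; apply/eqP; field.
by rewrite gt_eqF.
Qed.

(** Each summand is divided by the order of its expectation, so that one Markov bound on the sum
    yields all six estimates. *)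
Definition second_moment_total (k : 'I_d) (i : 'I_n) (w : T) : R :=
  (powv (E w) 1 (col k U) i 0 ^+ 2) / (nu * a) ^+ 2
  + (powv (E w) 2 (col k U) i 0 ^+ 2) / (nu * a ^+ 2) ^+ 2
  + (\sum_l \sum_j powv (E w) 1 (col l U) j 0 ^+ 2) / (n%:R * (nu * a) ^+ 2)
  + (\sum_j \sum_j' E w j j' ^+ 2) / (n%:R * a ^+ 2)
  + (\sum_j E w i j ^+ 2) / a ^+ 2
  + (\sum_l \sum_l' dot (col l U) (E w *m col l' U) ^+ 2) / (n%:R * nu ^+ 4 * a ^+ 2).

(** [1334 = 16 + 1296 + 1 + 1 + 20], where [16 = 4 ^ 2] and [1296 = 6 ^ 4] come from
    [powv_second_moment] at [r = 1] and [r = 2], the two [1] from the sums of squared entries, and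
    [20] is slack. [16 * d] and [2 * d * d] come from the sums over columns and pairs of columns. *)
Definition second_moment_const : R := (1334 + 16 * d + 2 * d * d)%:R.

Lemma second_event (k : 'I_d) (i : 'I_n) (e : R) : 0 < e ->
  let M := second_moment_const / e in
  exists G : set T, [/\ measurable G, ((1 - e)%:E <= P G)%E &
  forall w, G w ->
  [/\ powv (E w) 1 (col k U) i 0 ^+ 2 <= M * (nu * a) ^+ 2,
      powv (E w) 2 (col k U) i 0 ^+ 2 <= M * (nu * a ^+ 2) ^+ 2 ,
      forall l, dot (E w *m col l U) (E w *m col l U) <= M * (n%:R * (nu * a) ^+ 2) ,
      \sum_j \sum_j' E w j j' ^+ 2 <= M * (n%:R * a ^+ 2) &
      \sum_j E w i j ^+ 2 <= M * a ^+ 2 /\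
      forall l l', dot (col l U) (E w *m col l' U) ^+ 2 <= M * (n%:R * nu ^+ 4 * a ^+ 2)]].
Proof.
move=> e0 M; set S := second_moment_total k i.
have na : 0 < nu * a by rewrite mulr_gt0.
have p1 : 0 < (nu * a) ^+ 2 by rewrite exprn_gt0.
have p2 : 0 < (nu * a ^+ 2) ^+ 2 by rewrite exprn_gt0 // mulr_gt0 // exprn_gt0.
have p3 : 0 < n%:R * (nu * a) ^+ 2 by rewrite mulr_gt0.
have p5 : 0 < a ^+ 2 by rewrite exprn_gt0.
have p4 : 0 < n%:R * a ^+ 2 by rewrite mulr_gt0.
have p6 : 0 < n%:R * nu ^+ 4 * a ^+ 2 by rewrite !mulr_gt0 // exprn_gt0.
have [i1 e1] := powv_second_moment k i (r := 1) isT.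
have [i2 e2] := powv_second_moment k i (r := 2) isT.
have i3' l j : rv_integrable P (fun w => powv (E w) 1 (col l U) j 0 ^+ 2).
  by case: (powv_second_moment l j (r := 1) isT).
have i3 : rv_integrable P (fun w => \sum_l \sum_j powv (E w) 1 (col l U) j 0 ^+ 2).
  by do 2! (apply: rv_integrable_sum => ? _).
have i4' j j' : rv_integrable P (fun w => E w j j' ^+ 2) by case: (variance_bound j j').
have i4 : rv_integrable P (fun w => \sum_j \sum_j' E w j j' ^+ 2).
  by do 2! (apply: rv_integrable_sum => ? _).
have i5 : rv_integrable P (fun w => \sum_j E w i j ^+ 2).
  by apply: rv_integrable_sum => ? _.
have i6' l l' : rv_integrable P (fun w => dot (col l U) (E w *m col l' U) ^+ 2).
  by case: (bilinear_second_moment l l').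
have i6 : rv_integrable P (fun w => \sum_l \sum_l' dot (col l U) (E w *m col l' U) ^+ 2).
  by do 2! (apply: rv_integrable_sum => ? _).
have divi X c : rv_integrable P X -> rv_integrable P (fun w => X w / c) /\
    expectR P (fun w => X w / c) = expectR P X / c.
  move=> iX; have -> : (fun w => X w / c) = (fun w => c^-1 * X w).
    by apply/funext => w; rewrite mulrC.
  by rewrite expectRZ // mulrC; split => //; exact: rv_integrableZ.
have [j1 f1] := divi _ ((nu * a) ^+ 2) i1.
have [j2 f2] := divi _ ((nu * a ^+ 2) ^+ 2) i2.
have [j3 f3] := divi _ (n%:R * (nu * a) ^+ 2) i3.
have [j4 f4] := divi _ (n%:R * a ^+ 2) i4.
have [j5 f5] := divi _ (a ^+ 2) i5.
have [j6 f6] := divi _ (n%:R * nu ^+ 4 * a ^+ 2) i6.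
have g1 := rv_integrableD j1 j2.
have g2 := rv_integrableD g1 j3.
have g3 := rv_integrableD g2 j4.
have g4 := rv_integrableD g3 j5.
have iS : rv_integrable P S := rv_integrableD g4 j6.
have eS : expectR P S <= second_moment_const.
  rewrite /S (expectRD g4 j6) (expectRD g3 j5) (expectRD g2 j4) (expectRD g1 j3) (expectRD j1 j2).
  rewrite f1 f2 f3 f4 f5 f6.
  have -> : second_moment_const = 16 + 1296 + 16 * d%:R + 1 + 1 + 2 * d%:R * d%:R + 20.
    by rewrite /second_moment_const !natrD !natrM; ring.
  have h3 : expectR P (fun w => \sum_l \sum_j powv (E w) 1 (col l U) j 0 ^+ 2) <=
      16 * d%:R * (n%:R * (nu * a) ^+ 2).
    rewrite expectR_sum => [|l _]; last by apply: rv_integrable_sum.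
    apply: (le_trans (y := \sum_(l < d) \sum_(j < n) 16 * (nu * a) ^+ 2)).
      apply: ler_sum => l _; rewrite expectR_sum //; apply: ler_sum => j _.
      have [_ h] := powv_second_moment l j (r := 1) isT; apply: le_trans h _.
      by rewrite expr1 le_eqVlt; apply/orP; left; apply/eqP; ring.
    rewrite !sumr_const !card_ord -mulrnA -[leLHS]mulr_natl natrM le_eqVlt; apply/orP; left; apply/eqP; ring.
  have h5' j : expectR P (fun w => \sum_j' E w j j' ^+ 2) <= a ^+ 2.
    rewrite expectR_sum //; apply: (le_trans (y := \sum_(j' < n) a ^+ 2 / n%:R)).
      by apply: ler_sum => j' _; have [_ /andP[]] := variance_bound j j'.
    by rewrite sumr_const card_ord -[leLHS]mulr_natr divfK // gt_eqF.
  have h4 : expectR P (fun w => \sum_j \sum_j' E w j j' ^+ 2) <= n%:R * a ^+ 2.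
    rewrite expectR_sum => [|l _]; last by apply: rv_integrable_sum.
    apply: (le_trans (y := \sum_(j < n) a ^+ 2)); first by apply: ler_sum.
    by rewrite sumr_const card_ord mulr_natl.
  have h6 : expectR P (fun w => \sum_l \sum_l' dot (col l U) (E w *m col l' U) ^+ 2) <=
      2 * d%:R * d%:R * (n%:R * nu ^+ 4 * a ^+ 2).
    rewrite expectR_sum => [|l _]; last by apply: rv_integrable_sum.
    apply: (le_trans (y := \sum_(l < d) \sum_(l' < d) 2 * n%:R * nu ^+ 4 * a ^+ 2)).
      apply: ler_sum => l _; rewrite expectR_sum //; apply: ler_sum => l' _.
      by have [_ h] := bilinear_second_moment l l'.
    rewrite !sumr_const !card_ord -mulrnA -[leLHS]mulr_natl natrM le_eqVlt; apply/orP; left; apply/eqP; ring.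
  have k1 : expectR P (fun w => powv (E w) 1 (col k U) i 0 ^+ 2) / (nu * a) ^+ 2 <= 16.
    rewrite ler_pdivrMr //; apply: le_trans e1 _.
    by rewrite expr1 le_eqVlt; apply/orP; left; apply/eqP; ring.
  have k2 : expectR P (fun w => powv (E w) 2 (col k U) i 0 ^+ 2) / (nu * a ^+ 2) ^+ 2 <= 1296.
    rewrite ler_pdivrMr //; apply: le_trans e2 _.
    by rewrite le_eqVlt; apply/orP; left; apply/eqP; ring.
  have k3 := h3; rewrite -ler_pdivrMr // in k3.
  have k4 : expectR P (fun w => \sum_j \sum_j' E w j j' ^+ 2) / (n%:R * a ^+ 2) <= 1.
    by rewrite ler_pdivrMr // mul1r.
  have k5 : expectR P (fun w => \sum_j E w i j ^+ 2) / a ^+ 2 <= 1.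
    by rewrite ler_pdivrMr // mul1r.
  have k6 := h6; rewrite -ler_pdivrMr // in k6.
  rewrite -[leLHS]addr0; apply: lerD => //.
  by do 4! (apply: lerD => //); apply: lerD.
have Mpos : 0 < M by rewrite divr_gt0 // /second_moment_const ltr0n.
have dpos x c : 0 <= x -> 0 < c -> 0 <= x / c by move=> x0 c0; rewrite divr_ge0 // ltW.
have t1 w : 0 <= powv (E w) 1 (col k U) i 0 ^+ 2 / (nu * a) ^+ 2.
  by apply: dpos => //; exact: sqr_ge0.
have t2 w : 0 <= powv (E w) 2 (col k U) i 0 ^+ 2 / (nu * a ^+ 2) ^+ 2.
  by apply: dpos => //; exact: sqr_ge0.
have t3 w : 0 <= (\sum_l \sum_j powv (E w) 1 (col l U) j 0 ^+ 2) / (n%:R * (nu * a) ^+ 2).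
  by apply: dpos => //; do 2! (apply: sumr_ge0 => ? _); exact: sqr_ge0.
have t4 w : 0 <= (\sum_j \sum_j' E w j j' ^+ 2) / (n%:R * a ^+ 2).
  by apply: dpos => //; do 2! (apply: sumr_ge0 => ? _); exact: sqr_ge0.
have t5 w : 0 <= (\sum_j E w i j ^+ 2) / a ^+ 2.
  by apply: dpos => //; apply: sumr_ge0 => ? _; exact: sqr_ge0.
have t6 w : 0 <= (\sum_l \sum_l' dot (col l U) (E w *m col l' U) ^+ 2) / (n%:R * nu ^+ 4 * a ^+ 2).
  by apply: dpos => //; do 2! (apply: sumr_ge0 => ? _); exact: sqr_ge0.
have Spos w : 0 <= S w by rewrite /S /second_moment_total !addr_ge0.
have mS := rv_integrable_measurable iS.
have mG : measurable [set w | M < S w].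
  rewrite (_ : [set w | _] = S @^-1` `]M, +oo[%classic).
    by rewrite -[X in measurable X]setTI; apply: mS => //; exact: measurable_itv.
  by apply/seteqP; split=> w /=; rewrite in_itv /= andbT.
exists (~` [set w | M < S w]); split; first exact: measurableC.
  rewrite probability_setC // EFinB; apply: leeB => //.
  apply: le_trans (markov_ge0 iS Spos Mpos) _.
  rewrite lee_fin ler_pdivrMr // /M mulrCA divff ?gt_eqF // mulr1 //.
move=> w /negP; rewrite -leNgt => Sw.
have b1 := t1 w; have b2 := t2 w; have b3 := t3 w; have b4 := t4 w; have b5 := t5 w; have b6 := t6 w.
have term x c : 0 < c -> x / c <= S w -> x <= M * c.
  by move=> c0 xS; rewrite -ler_pdivrMr //; apply: le_trans Sw.
have [s1 s2 s3 s4 [s5 s6]] := le_sum6 b1 b2 b3 b4 b5 b6.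
split.
- exact: term s1.
- exact: term s2.
- move=> l; apply: (le_trans (y := \sum_l \sum_j powv (E w) 1 (col l U) j 0 ^+ 2)).
    rewrite (bigD1 l) //=; apply: ler_wpDr.
      by do 2! (apply: sumr_ge0 => ? _); exact: sqr_ge0.
    by apply: ler_sum => j _; rewrite expr2.
  exact: term s3.
- exact: term s4.
split; first exact: term s5.
move=> l l'; apply: (le_trans (y := \sum_l \sum_l' dot (col l U) (E w *m col l' U) ^+ 2)).
  rewrite (bigD1 l) //= (bigD1 l') //= -addrA lerDl addr_ge0 //.
    by apply: sumr_ge0 => ? _; exact: sqr_ge0.
  by do 2! (apply: sumr_ge0 => ? _); exact: sqr_ge0.
exact: term s6.
Qed.

End SecondMoments.

(** * Measurability and asymptotics *)

Section MeasurableMatrices.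
Context (R : realType) d0 (T : measurableType d0).

Definition measurable_mx m n (M : T -> 'M[R]_(m, n)) := forall i j, measurable_fun setT (fun w => M w i j).

Lemma measurable_fun_sumr (I : Type) (s : seq I) (Q : pred I) (f : I -> T -> R) :
  (forall i, measurable_fun setT (f i)) ->
  measurable_fun setT (fun w => \sum_(i <- s | Q i) f i w).
Proof.
move=> mf; elim: s => [|i s IH].
  by under eq_fun do rewrite big_nil; exact: measurable_cst.
under eq_fun do rewrite big_cons.
by case: (Q i) => //; apply: measurable_funD.
Qed.

Lemma measurable_fun_bigmaxr (I : Type) (s : seq I) (f : I -> T -> R) :
  (forall i, measurable_fun setT (f i)) ->
  measurable_fun setT (fun w => \big[Num.max/0]_(i <- s) f i w).
Proof.
move=> mf; elim: s => [|i s IH].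
  by under eq_fun do rewrite big_nil; exact: measurable_cst.
by under eq_fun do rewrite big_cons; apply: measurable_maxr.
Qed.

Lemma measurable_funV (f : T -> R) : measurable_fun setT f ->
  measurable_fun setT (fun w => (f w)^-1).
Proof.
(* [powR] is measurable in its base, and the factor [f w] makes the product vanish at [0], where the
   inverse is [0] by convention. *)
move=> mf; have -> : (fun w => (f w)^-1) = (fun w => f w * powR (f w ^+ 2) (-1)).
  apply/funext => w; rewrite powR_inv1 ?sqr_ge0 //.
  have [->|f0] := eqVneq (f w) 0; first by rewrite invr0 mul0r.
  by field.
apply: measurable_funM => //.
apply: (@measurableT_comp _ _ _ _ _ _ (fun x : R => powR x (-1)) _ (fun w => f w ^+ 2)).
  exact: measurable_powR.
exact: measurable_funX.
Qed.

Lemma measurable_fun_sg (f : T -> R) : measurable_fun setT f ->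
  measurable_fun setT (fun w => Num.sg (f w)).
Proof.
move=> mf; have -> : (fun w => Num.sg (f w)) = (fun w => f w * (`|f w|)^-1).
  apply/funext => w; have [->|f0] := eqVneq (f w) 0; first by rewrite sgr0 mul0r.
  by rewrite {2}[f w]numEsg mulfK // normr_eq0.
apply: measurable_funM => //; apply: measurable_funV.
exact: measurableT_comp.
Qed.

Lemma measurable_mx_cst m n (M : 'M[R]_(m, n)) : measurable_mx (fun=> M).
Proof. by move=> i j; exact: measurable_cst. Qed.

Lemma measurable_mx_mul m n p (A : T -> 'M[R]_(m, n)) (B : T -> 'M[R]_(n, p)) :
  measurable_mx A -> measurable_mx B -> measurable_mx (fun w => A w *m B w).
Proof.
move=> mA mB i j; under eq_fun do rewrite mxE.
by apply: measurable_fun_sumr => k; apply: measurable_funM.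
Qed.

Lemma measurable_mx_add m n (A B : T -> 'M[R]_(m, n)) : measurable_mx A -> measurable_mx B -> measurable_mx (fun w => A w + B w).
Proof. by move=> mA mB i j; under eq_fun do rewrite mxE; apply: measurable_funD. Qed.

Lemma measurable_mx_opp m n (A : T -> 'M[R]_(m, n)) : measurable_mx A -> measurable_mx (fun w => - A w).
Proof. by move=> mA i j; under eq_fun do rewrite mxE; apply: measurableT_comp. Qed.

Lemma measurable_mx_scale m n (c : T -> R) (A : T -> 'M[R]_(m, n)) : measurable_fun setT c -> measurable_mx A ->
  measurable_mx (fun w => c w *: A w).
Proof. by move=> mc mA i j; under eq_fun do rewrite mxE; apply: measurable_funM. Qed.

Lemma measurable_mx_tr m n (A : T -> 'M[R]_(m, n)) : measurable_mx A -> measurable_mx (fun w => (A w)^T).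
Proof. by move=> mA i j; under eq_fun do rewrite mxE; exact: mA. Qed.

Lemma measurable_mx_col m n (A : T -> 'M[R]_(m, n)) k : measurable_mx A -> measurable_mx (fun w => col k (A w)).
Proof. by move=> mA i j; under eq_fun do rewrite mxE; exact: mA. Qed.

Lemma measurable_mx_sum m n (I : Type) (s : seq I) (Q : pred I) (A : I -> T -> 'M[R]_(m, n)) :
  (forall l, measurable_mx (A l)) -> measurable_mx (fun w => \sum_(l <- s | Q l) A l w).
Proof.
move=> mA i j; under eq_fun do rewrite summxE.
by apply: measurable_fun_sumr => l; exact: mA.
Qed.

Lemma measurable_mx_diag n (f : 'I_n -> T -> R) : (forall i, measurable_fun setT (f i)) ->
  measurable_mx (fun w => diag_mx (\row_i f i w)).
Proof.
move=> mf i j; under eq_fun do rewrite !mxE.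
by case: (i == j) => /=; [exact: mf|exact: measurable_cst].
Qed.

Lemma measurable_mx_UAof n p d (V : T -> 'M[R]_n) : measurable_mx V -> measurable_mx (fun w => @UAof R n p d (V w)).
Proof.
move=> mV i j; under eq_fun do rewrite mxE.
by apply: measurable_fun_sumr => l; exact: mV.
Qed.

Lemma measurable_SAof n p d (mu : T -> 'I_n -> R) k :
  (forall i, measurable_fun setT (fun w => mu w i)) ->
  measurable_fun setT (fun w => @SAof R n p d (mu w) k).
Proof. by move=> mm; apply: measurable_fun_sumr => l; exact: mm. Qed.

Lemma measurable_mx_bias_formula n d (U : T -> 'M[R]_(n, d)) (lam : T -> 'I_d -> R) (D : T -> 'M[R]_n) k :
  measurable_mx U -> (forall l, measurable_fun setT (fun w => lam w l)) -> measurable_mx D ->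
  measurable_mx (fun w => bias_formula (U w) (lam w) (D w) k).
Proof.
move=> mU ml mD; apply: measurable_mx_scale.
  by apply: measurable_funV; apply: measurable_funX.
have mUU l : measurable_mx (fun w => col l (U w) *m (col l (U w))^T).
  by apply: measurable_mx_mul; [|apply: measurable_mx_tr]; exact: measurable_mx_col.
apply: measurable_mx_mul; last exact: measurable_mx_col.
apply: measurable_mx_mul => //; apply: measurable_mx_add.
  apply: measurable_mx_add; first exact: measurable_mx_cst.
  by apply: measurable_mx_opp; apply: measurable_mx_scale => //; exact: measurable_cst.
apply: measurable_mx_sum => l; apply: measurable_mx_scale => //.
apply: measurable_funM => //; apply: measurable_funV.
exact: measurable_funB.
Qed.

Lemma measurable_mx_Dhat n (A B : T -> 'M[R]_n) : measurable_mx A -> measurable_mx B -> measurable_mx (fun w => Dhat (A w) (B w)).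
Proof.
move=> mA mB; apply: measurable_mx_diag => i; apply: measurable_fun_sumr => j.
apply: measurable_funX; exact: measurable_funB.
Qed.

Lemma measurable_mx_Phat n p d (V : T -> 'M[R]_n) (mu : T -> 'I_n -> R) : measurable_mx V ->
  (forall i, measurable_fun setT (fun w => mu w i)) ->
  measurable_mx (fun w => @Phat R n p d (V w) (mu w)).
Proof.
move=> mV mm; apply: measurable_mx_mul; last by apply: measurable_mx_tr; exact: measurable_mx_UAof.
apply: measurable_mx_mul; first exact: measurable_mx_UAof.
by apply: measurable_mx_diag => i; exact: measurable_SAof.
Qed.

Lemma measurable_vinf n (v : T -> 'cV[R]_n) : measurable_mx v -> measurable_fun setT (fun w => vinf (v w)).
Proof.
move=> mv; apply: measurable_fun_bigmaxr => i.
by apply: measurableT_comp => //; exact: mv.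
Qed.

Lemma measurable_coordn n (v : T -> 'cV[R]_n) i : measurable_mx v ->
  measurable_fun setT (fun w => coordn (v w) i).
Proof. by move=> mv; apply: measurable_fun_sumr => j; exact: mv. Qed.

Lemma measurable_le_set (f : T -> R) (c : R) : measurable_fun setT f ->
  measurable [set w | f w <= c].
Proof.
move=> mf; rewrite (_ : [set w | _] = f @^-1` `]-oo, c]%classic).
  by rewrite -[X in measurable X]setTI; apply: mf => //; exact: measurable_itv.
by apply/seteqP; split=> w /=; rewrite in_itv.
Qed.

Lemma measurable_gt_set (f : T -> R) (c : R) : measurable_fun setT f ->
  measurable [set w | c < f w].
Proof.
move=> mf; rewrite (_ : [set w | _] = f @^-1` `]c, +oo[%classic).
  by rewrite -[X in measurable X]setTI; apply: mf => //; exact: measurable_itv.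
by apply/seteqP; split=> w /=; rewrite in_itv /= andbT.
Qed.

End MeasurableMatrices.

(** * Inequalities valid for large sizes *)

Section Eventually.
Variable R : realType.

Definition for_large (Q : nat -> Prop) := exists N, forall n, (N <= n)%N -> Q n.

Lemma for_large_and Q Q' : for_large Q -> for_large Q' -> for_large (fun n => Q n /\ Q' n).
Proof.
move=> [N H] [N' H']; exists (maxn N N') => n; rewrite geq_max => /andP[h h'].
by split; [exact: H|exact: H'].
Qed.

Lemma for_large_imp (Q Q' : nat -> Prop) : for_large Q -> (forall n, Q n -> Q' n) -> for_large Q'.
Proof. by move=> [N H] QQ'; exists N => n /H /QQ'. Qed.

Lemma for_large_ge k : for_large (fun n => (k <= n)%N).
Proof. by exists k. Qed.

Lemma for_large_natr (M : R) : for_large (fun n => M <= n%:R).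
Proof.
exists (Num.truncn M).+1 => n h; apply: le_trans (ltW (truncnS_gt M)) _.
by rewrite ler_nat.
Qed.

Lemma for_large_powR (g M : R) : 0 < g -> for_large (fun n => M <= powR n%:R g).
Proof.
move=> g0; pose M' := Num.max M 1; have M'0 : 0 < M' by rewrite lt_max ltr01 orbT.
apply: for_large_imp (for_large_natr (powR M' g^-1)) _ => n h.
have : powR (powR M' g^-1) g <= powR n%:R g.
  by apply: ge0_ler_powR => //; rewrite ?nnegrE ?powR_ge0 // ltW.
rewrite -powRrM mulVf ?gt_eqF // powRr1 ?(ltW M'0) //; apply: le_trans.
by rewrite le_max lexx.
Qed.

Lemma for_large_ln (M : R) : for_large (fun n => M <= ln n%:R).
Proof.
apply: for_large_imp (for_large_natr (expR M)) _ => n h.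
by rewrite -[M]expRK ler_ln ?posrE ?expR_gt0 // (lt_le_trans (expR_gt0 M)).
Qed.

Lemma for_large_lnX (g M : R) k : 0 < g -> for_large (fun n => M * ln n%:R ^+ k <= powR n%:R g).
Proof.
(* [h * k] is at most [g / 2], so half of the exponent beats the power of the logarithm and the
   other half the constants. *)
move=> g0; pose h := g / (2 * (k.+1)%:R).
have k0 : (0 : R) < k.+1%:R by rewrite ltr0n.
have h0 : 0 < h by rewrite divr_gt0 // mulr_gt0.
have g2 : 0 < g / 2 by rewrite divr_gt0.
apply: for_large_imp (for_large_and (for_large_ge 1) (for_large_and (for_large_ln 1) (for_large_powR (`|M| * h^-1 ^+ k) g2))) _.
move=> n [n1 [l1 Mn]].
have n0 : (0 : R) < n%:R by rewrite ltr0n.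
have n1' : (1 : R) <= n%:R by rewrite ler1n.
have l0 : 0 <= ln n%:R :> R by apply: le_trans l1.
have lh : ln n%:R <= h^-1 * powR n%:R h :> R.
  rewrite ler_pdivlMl // -ln_powR; apply: ltW; apply: ln_sublinear.
  exact: powR_gt0.
have lk : ln n%:R ^+ k <= h^-1 ^+ k * powR n%:R (g / 2) :> R.
  apply: (le_trans (y := (h^-1 * powR n%:R h) ^+ k)).
    by apply: lerXn2r; rewrite ?nnegrE // mulr_ge0 ?powR_ge0 ?invr_ge0 ?ltW.
  rewrite exprMn; apply: ler_wpM2l; first by rewrite exprn_ge0 // invr_ge0 ltW.
  rewrite -powR_mulrn ?powR_ge0 // -powRrM; apply: ler_powR => //.
  have -> : h * k%:R = g / 2 * (k%:R / k.+1%:R) by rewrite /h; field; rewrite gt_eqF.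
  rewrite -[leRHS]mulr1; apply: ler_wpM2l; first exact: ltW.
  by rewrite ler_pdivrMr // mul1r ler_nat.
apply: (le_trans (y := `|M| * ln n%:R ^+ k)).
  by rewrite ler_wpM2r ?exprn_ge0 // ler_norm.
apply: (le_trans (ler_wpM2l (normr_ge0 M) lk)).
rewrite mulrA; apply: le_trans (ler_wpM2r (powR_ge0 _ _) Mn) _.
by rewrite -powRD ?(gt_eqF n0) ?implybT // -splitr.
Qed.

End Eventually.

(** * Moments of one noise entry and of its centred square *)

Section EntryMoments.
Context (R : realType) d0 (T : measurableType d0) (P : probability T R).
Variables (n : nat) (rho q C : R) (X : T -> R) (L : nat).
Hypothesis n0 : (0 < n)%N.
Hypothesis rho0 : 0 < rho.
Hypothesis q1 : 1 <= q.
Hypothesis qn : q <= Num.sqrt n%:R.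
Hypothesis C0 : 0 < C.
Hypothesis mX : measurable_fun setT X.
Hypothesis X2 : (\int[P]_w (X w ^+ 2)%:E <= (C * rho)%:E)%E.
Hypothesis Xm : forall m, (3 <= m)%N -> (m <= 2 * L)%N ->
  (\int[P]_w (`|X w| ^+ m)%:E
     <= (C ^+ m * powR (n%:R * rho) (m%:R / 2) / (n%:R * q ^+ (m - 2)))%:E)%E.

Let sr := Num.sqrt (n%:R * rho).
Let npos : (0 : R) < n%:R. Proof. by rewrite ltr0n. Qed.
Let nr0 : 0 < n%:R * rho. Proof. exact: mulr_gt0. Qed.
Let q0 : 0 < q. Proof. exact: lt_le_trans q1. Qed.
Let sr2 : sr ^+ 2 = n%:R * rho. Proof. by rewrite sqr_sqrtr // ltW. Qed.

Lemma powR_half_natr (x : R) m : 0 <= x -> powR x (m%:R / 2) = Num.sqrt x ^+ m.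
Proof.
by move=> x0; rewrite mulrC powRrM powR12_sqrt // powR_mulrn // sqrtr_ge0.
Qed.

(** The powers of [q >= 1] are dropped. The constant is [C + 1] because the case [m = 2] asks for
    [C <= (C + 1) ^ 2]. *)
Lemma entry_moment m : (2 <= m <= L)%N ->
  (\int[P]_w (`|X w| ^+ m)%:E <= (((C + 1) * sr) ^+ m / n%:R)%:E)%E.
Proof.
move=> /andP[m2 mL]; have C1 : C <= C + 1 by lra.
case: (ltngtP 2 m) m2 => // [m3 _|<- _].
  apply: le_trans (Xm m3 _) _; first by apply: leq_trans mL _; rewrite leq_pmull.
  rewrite lee_fin powR_half_natr ?(ltW nr0) // -exprMn.
  apply: ler_pM.
  - by rewrite exprn_ge0 // mulr_ge0 ?sqrtr_ge0 // ltW.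
  - by rewrite invr_ge0 mulr_ge0 ?exprn_ge0 // ltW.
  - apply: lerXn2r; rewrite ?nnegrE.
    + by apply: mulr_ge0; [exact: ltW|exact: sqrtr_ge0].
    + by apply: mulr_ge0; [apply: addr_ge0 => //; exact: ltW|exact: sqrtr_ge0].
    + by apply: ler_wpM2r => //; exact: sqrtr_ge0.
  - rewrite lef_pV2 ?posrE ?mulr_gt0 ?exprn_gt0 //.
    by rewrite ler_peMr ?ler0n // exprn_ege1.
under eq_integral do rewrite -normrX ger0_norm ?sqr_ge0 //.
apply: le_trans X2 _; rewrite lee_fin exprMn sr2 ler_pdivlMr //.
have -> : C * rho * n%:R = C * (n%:R * rho) by ring.
by apply: ler_wpM2r; [exact: ltW|nra].
Qed.

(** [q ^ m <= n ^ (m / 2) <= n ^ (m - 1)], the last step because [m >= 2]. It keeps the centring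
    term below the moments of the square. *)
Lemma natr_powR_bound m : (2 <= m)%N -> n%:R * q ^+ m <= n%:R ^+ m :> R.
Proof.
case: m => [//|[//|m]] _; rewrite [leRHS]exprS; apply: ler_wpM2l; first exact: ltW.
apply: (le_trans (y := q ^+ (2 * m.+1))).
  by apply: ler_weXn2l => //; rewrite mul2n -addnn addnS !ltnS leq_addl.
rewrite exprM; apply: lerXn2r; rewrite ?nnegrE ?exprn_ge0 ?(ltW q0) ?(ltW npos) //.
rewrite -[leRHS](sqr_sqrtr (ltW npos)).
by apply: lerXn2r; rewrite ?nnegrE ?sqrtr_ge0 ?(ltW q0).
Qed.

(** The moment of order [2 m] comes with [q ^ (2 m - 2)], which is at least [q ^ m] as [m >= 2]: a
    gain of [1 / q] per power, the rate at which row sums of squares concentrate. The [4] stems from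
    [|x - s|^m <= 2^m (x^m + s^m)] and [2 <= 2^m]. *)
Lemma square_moment s m : 0 <= s -> s <= C * rho -> (2 <= m <= L)%N ->
  (\int[P]_w (`|X w ^+ 2 - s| ^+ m)%:E <=
    ((4 * (C ^+ 2 + C) * (n%:R * rho / q)) ^+ m / n%:R)%:E)%E.
Proof.
move=> s0 sC /andP[m2 mL].
have m2L : (m * 2 <= 2 * L)%N by rewrite mulnC leq_mul2l.
have m3 : (3 <= m * 2)%N by rewrite (leq_trans (_ : 3 <= 2 * 2)%N) // leq_mul2r m2 orbT.
pose B := (C ^+ 2 + C) * (n%:R * rho / q).
have nrq : 0 < n%:R * rho / q by rewrite divr_gt0.
have B0 : 0 < B by rewrite mulr_gt0 // addr_gt0 // exprn_gt0.
have [i1 e1] : rv_integrable P (fun w => X w ^+ (m * 2)) /\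
    expectR P (fun w => `|X w ^+ (m * 2)|) <= B ^+ m / n%:R.
  apply: rv_integrable_bound; first exact: measurable_funX.
  under eq_integral do rewrite normrX.
  apply: le_trans (Xm m3 m2L) _; rewrite lee_fin powR_half_natr ?(ltW nr0) // -exprMn.
  rewrite -/sr (mulnC m 2).
  have -> : (C * sr) ^+ (2 * m) = (C ^+ 2 * (n%:R * rho)) ^+ m by rewrite exprM (exprMn 2) sr2.
  rewrite invfM [n%:R^-1 * _]mulrC [leLHS]mulrA; apply: ler_wpM2r.
    by rewrite invr_ge0 ltW.
  apply: (le_trans (y := (C ^+ 2 * (n%:R * rho)) ^+ m * (q ^+ m)^-1)).
    apply: ler_wpM2l; first by rewrite exprn_ge0 // mulr_ge0 ?sqr_ge0 // ltW.
    rewrite lef_pV2 ?posrE ?exprn_gt0 //; apply: ler_weXn2l => //.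
    by rewrite mul2n -addnn -addnBA // leq_addr.
  rewrite -exprVn -exprMn; apply: lerXn2r; rewrite ?nnegrE ?(ltW B0) //.
    by rewrite mulr_ge0 ?invr_ge0 ?(ltW q0) // mulr_ge0 ?sqr_ge0 // ltW.
  rewrite /B -[leLHS]mulrA; apply: ler_wpM2r; first exact: ltW.
  by rewrite lerDl ltW.
have e2 : s ^+ m <= B ^+ m / n%:R.
  rewrite ler_pdivlMr //; apply: (le_trans (y := (C * rho) ^+ m * n%:R)).
    rewrite ler_wpM2r ?(ltW npos) //; apply: lerXn2r; rewrite ?nnegrE //.
    by rewrite mulr_ge0 // ltW.
  rewrite -(ler_pM2r (exprn_gt0 m q0)) -mulrA.
  apply: (le_trans (y := (C * rho) ^+ m * n%:R ^+ m)).
    apply: ler_wpM2l; last exact: natr_powR_bound.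
    by rewrite exprn_ge0 // mulr_ge0 // ltW.
  rewrite -!exprMn; apply: lerXn2r; rewrite ?nnegrE.
  - by rewrite !mulr_ge0 // ltW.
  - by rewrite mulr_ge0 ?(ltW B0) ?(ltW q0).
  rewrite /B mulrA divfK ?gt_eqF //.
  have -> : C * rho * n%:R = C * (n%:R * rho) by ring.
  by apply: ler_wpM2r; [exact: ltW|rewrite lerDr sqr_ge0].
have i2 : rv_integrable P (fun w => 2 ^+ m * (X w ^+ (m * 2) + s ^+ m)).
  by apply: rv_integrableZ; apply: rv_integrableD => //; exact: rv_integrable_cst.
apply: (@le_trans _ _ (\int[P]_w (2 ^+ m * (X w ^+ (m * 2) + s ^+ m))%:E)%E).
  have pe w : 0 <= X w ^+ (m * 2) by rewrite mulnC exprM exprn_ge0 // sqr_ge0.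
  apply: ge0_le_integral => //.
  - apply/measurable_EFinP; apply: measurable_funX; apply: measurableT_comp => //.
    by apply: measurable_funB; [exact: measurable_funX|exact: measurable_cst].
  - by apply/measurable_EFinP; exact: rv_integrable_measurable i2.
  move=> w _; rewrite lee_fin mulnC exprM; set x := X w ^+ 2.
  have x0 : 0 <= x by exact: sqr_ge0.
  have [xs|sx] := leP x s.
  - apply: (le_trans (y := s ^+ m)).
      apply: lerXn2r; rewrite ?nnegrE // ler_norml; apply/andP; split; lra.
    rewrite -[leLHS]mul1r; apply: ler_pM => //; first exact: exprn_ge0.
      by apply: exprn_ege1; rewrite ler1n.
    by rewrite lerDr exprn_ge0.
  - apply: (le_trans (y := x ^+ m)).
      apply: lerXn2r; rewrite ?nnegrE // ler_norml; apply/andP; split; lra.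
    rewrite -[leLHS]mul1r; apply: ler_pM => //; first exact: exprn_ge0.
      by apply: exprn_ege1; rewrite ler1n.
    by rewrite lerDl exprn_ge0.
rewrite (integrable_expectR i2) lee_fin expectRZ; last first.
  by apply: rv_integrableD => //; exact: rv_integrable_cst.
rewrite (expectRD i1 (rv_integrable_cst P _)) expectR_cst.
have e1' : expectR P (fun w => X w ^+ (m * 2)) <= B ^+ m / n%:R.
  by apply: le_trans (le_trans (ler_norm _) (expectR_abs i1)) e1.
have -> : 4 * (C ^+ 2 + C) * (n%:R * rho / q) = 2 * (2 * B) by rewrite /B; ring.
rewrite exprMn -[leRHS]mulrA; apply: ler_wpM2l; first exact: exprn_ge0.
apply: (le_trans (lerD e1' e2)); rewrite -mulr2n -[leLHS]mulr_natl mulrA.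
apply: ler_wpM2r; first by rewrite invr_ge0 ltW.
rewrite [leRHS]exprMn; apply: ler_wpM2r; first by rewrite exprn_ge0 // ltW.
by rewrite -[leLHS]expr1; apply: ler_weXn2l; rewrite ?ler1n // (leq_trans _ m2).
Qed.

End EntryMoments.

(** * The random model *)

Section Setting.
Unset Implicit Arguments.
Context (R : realType) (dO : measure_display) (Om : nat -> measurableType dO).
Context (Pr : forall n, probability (Om n) R).
Context (d p : nat) (k : 'I_d) (rho qn : nat -> R).
Context (U : forall n, 'M[R]_(n, d)) (lam : nat -> 'I_d -> R).
Context (E : forall n, Om n -> 'M[R]_n) (N0 : nat).
Context (beta C1 C2 c delta0 eps C A0 Cmu : R).
Local Notation J := (fun n => fun ij : 'I_n * 'I_n => (ij.1 <= ij.2)%N).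
Hypothesis UU : forall n, (N0 <= n)%N -> (U n)^T *m U n = 1%:M.
Hypothesis lam_mono : forall n, (N0 <= n)%N ->
  forall m m' : 'I_d, (m <= m')%N -> lam n m' <= lam n m.
Hypothesis Esym : forall n w (i j : 'I_n), E n w i j = E n w j i.
Hypothesis mE : forall n (i j : 'I_n), measurable_fun setT (fun w => E n w i j).
Hypothesis E0 : forall n (i j : 'I_n),
  (Pr n).-integrable setT (fun w => (E n w i j)%:E) /\
  (\int[Pr n]_w (E n w i j)%:E = 0)%E.
Hypothesis indE : forall n, mutually_independent (Pr n)
  (fun ij : 'I_n * 'I_n => (ij.1 <= ij.2)%N) (fun ij w => E n w ij.1 ij.2).
Hypothesis beta0 : 0 < beta.
Hypothesis C10 : 0 < C1.
Hypothesis C20 : 0 < C2.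
Hypothesis rho01 : forall n, 0 < rho n <= 1.
Hypothesis lam_bound : forall n, (N0 <= n)%N -> forall m : 'I_d,
  C1 * powR (n%:R) beta * Num.sqrt (n%:R * rho n) <= `|lam n m| /\
  `|lam n m| <= C2 * powR (n%:R) beta * Num.sqrt (n%:R * rho n).
Hypothesis delta00 : 0 < delta0.
Hypothesis Delta_min : forall n, (N0 <= n)%N -> delta0 * min_abs (lam n) <= Delta (lam n).
Hypothesis eps0 : 0 < eps <= 1 / 2.
Hypothesis C0 : 0 < C.
Hypothesis A011 : 11 <= A0.
Hypothesis qn_bound : forall n, powR (n%:R) eps <= qn n <= Num.sqrt (n%:R).
Hypothesis E2 : forall n (i j : 'I_n),
  (\int[Pr n]_w ((E n w i j) ^+ 2)%:E <= (C * rho n)%:E)%E.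
Hypothesis Em : forall n (i j : 'I_n) (pp : nat), (3 <= pp)%N ->
  pp%:R <= powR (2 * ln (n%:R)) (A0 * ln (ln (n%:R))) ->
  (\int[Pr n]_w (`|E n w i j| ^+ pp)%:E
     <= (C ^+ pp * powR (n%:R * rho n) (pp%:R / 2)
           / (n%:R * qn n ^+ (pp - 2)))%:E)%E.
Hypothesis Cmu1 : 1 <= Cmu.
Hypothesis U_coh : forall n, (N0 <= n)%N ->
  two_to_inf (U n) <= Cmu * Num.sqrt (d%:R / n%:R).

Context (Pm : forall n, 'M[R]_n) (V : forall n, Om n -> 'M[R]_n) (mu : forall n, Om n -> 'I_n -> R).
Hypothesis PmE : forall n, (N0 <= n)%N -> Pm n = U n *m diagv (lam n) *m (U n)^T.
Hypothesis lam_sign : forall n, (N0 <= n)%N -> forall m : 'I_d,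
  ((m < p)%N -> 0 < lam n m) /\ ((p <= m)%N -> lam n m < 0).
Hypothesis VV : forall n w, (V n w)^T *m V n w = 1%:M.
Hypothesis AE : forall n w, Pm n + E n w = V n w *m diagv (mu n w) *m (V n w)^T.
Hypothesis mu_mono : forall n w (i j : 'I_n), (i <= j)%N -> mu n w j <= mu n w i.
Hypothesis mV : forall n (i j : 'I_n), measurable_fun setT (fun w => V n w i j).
Hypothesis mmu : forall n (i : 'I_n), measurable_fun setT (fun w => mu n w i).

Set Implicit Arguments.

Definition sr n := Num.sqrt (n%:R * rho n).
Definition Dl n := Delta (lam n).
Definition kap := Cmu * Num.sqrt d%:R.
Definition nu n := kap / Num.sqrt (n%:R : R).
Definition lam_ratio := C2 / (delta0 * C1).
Definition sig2 n (i j : 'I_n) := varR (Pr n) (fun w => E n w i j).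

Let d_gt0 : (0 < d)%N. Proof. exact: leq_ltn_trans (ltn_ord k). Qed.

Let rho0 n : 0 < rho n. Proof. by case/andP: (rho01 n). Qed.

Lemma kap_gt0 : 0 < kap.
Proof. by rewrite mulr_gt0 ?sqrtr_gt0 ?ltr0n // (lt_le_trans ltr01). Qed.

Lemma vp_gt0 : 0 < lam_ratio. Proof. by rewrite divr_gt0 // mulr_gt0. Qed.

Lemma sr_gt0 n : (0 < n)%N -> 0 < sr n.
Proof. by move=> n0; rewrite sqrtr_gt0 mulr_gt0 // ltr0n. Qed.

Lemma sr_sqr n : sr n ^+ 2 = n%:R * rho n.
Proof. by rewrite sqr_sqrtr // mulr_ge0 // ltW. Qed.

Lemma nu_gt0 n : (0 < n)%N -> 0 < nu n.
Proof. by move=> n0; rewrite divr_gt0 ?kap_gt0 // sqrtr_gt0 ltr0n. Qed.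

Lemma nu_sqr n : (0 < n)%N -> n%:R * nu n ^+ 2 = kap ^+ 2.
Proof.
move=> n0; rewrite expr_div_n sqr_sqrtr // mulrCA divff ?mulr1 //.
by rewrite pnatr_eq0 -lt0n.
Qed.

Lemma U_entry n (l : 'I_d) (i : 'I_n) : (N0 <= n)%N -> `|U n i l| <= nu n.
Proof.
move=> nN; apply: (le_trans (y := Num.sqrt (\sum_(j < d) U n i j ^+ 2))).
  rewrite -sqrtr_sqr; apply: ler_wsqrtr; rewrite (bigD1 l) //= lerDl.
  by apply: sumr_ge0 => j _; exact: sqr_ge0.
apply: le_trans (le_trans (U_coh n nN) _).
  exact: (le_bigmax _ (fun i => Num.sqrt (\sum_(j < d) U n i j ^+ 2))).
by rewrite /nu /kap sqrtrM // sqrtrV // mulrA.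
Qed.

Lemma min_abs_ge n x : (forall l, x <= `|lam n l|) -> x <= min_abs (lam n).
Proof.
move=> H; apply: le_bigmin => [|l _]; last exact: H.
(* The minimum has the largest [|lam n l|] as default value; it is bounded below because the index
   [k] exists. *)
by apply: le_trans (H k) _; exact: (le_bigmax _ (fun l => `|lam n l|)).
Qed.

Lemma Dl_lower n : (N0 <= n)%N -> delta0 * C1 * powR n%:R beta * sr n <= Dl n.
Proof.
move=> nN; apply: le_trans (Delta_min n nN); rewrite -!mulrA ler_wpM2l ?(ltW delta00) //.
apply: min_abs_ge => l; have [h _] := lam_bound n nN l; by rewrite mulrA.
Qed.

Lemma Dl_gt0 n : (N0 <= n)%N -> (0 < n)%N -> 0 < Dl n.
Proof.
move=> nN n0; apply: lt_le_trans (Dl_lower nN).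
by rewrite !mulr_gt0 ?sr_gt0 // powR_gt0 // ltr0n.
Qed.

Lemma Dl_lam n l : Dl n <= `|lam n l|.
Proof.
apply: le_trans (bigmin_le _ l _) _.
by rewrite ge_min lexx.
Qed.

Lemma lam_Dl n l : (N0 <= n)%N -> `|lam n l| <= lam_ratio * Dl n.
Proof.
move=> nN; have [_ h] := lam_bound n nN l; apply: le_trans h _.
apply: (le_trans (y := lam_ratio * (delta0 * C1 * powR n%:R beta * sr n))).
  rewrite /lam_ratio le_eqVlt; apply/orP; left; apply/eqP; rewrite -/(sr n); field.
  by rewrite !gt_eqF.
by rewrite ler_wpM2l ?Dl_lower // ltW // vp_gt0.
Qed.

(** [Delta] controls consecutive gaps only. Since [lam] is monotone, the gap just above the larger
    index lies within the gap between [l] and [l']. *)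
Lemma Dl_gap n (l l' : 'I_d) : (N0 <= n)%N -> l != l' -> Dl n <= `|lam n l - lam n l'|.
Proof.
move=> nN; wlog ll' : l l' / (l < l')%N => [H|_].
  case: (ltngtP l l') => [lt|lt|/val_inj ->]; last by rewrite eqxx.
    exact: H.
  by rewrite eq_sym distrC; exact: H.
have l'0 : (l'.-1 < d)%N by apply: leq_ltn_trans (leq_pred _) (ltn_ord l').
pose l1 := Ordinal l'0.
have l1E : (l1 : nat).+1 == l' by rewrite /= prednK // (leq_ltn_trans _ ll').
apply: le_trans (bigmin_le _ l' _) _.
rewrite ge_min; apply/orP; right.
apply: (le_trans (bigmin_le_cond _ _ l1E)).
have h1 : lam n l' <= lam n l1 by apply: (lam_mono n nN) => /=; exact: leq_pred.
have h2 : lam n l1 <= lam n l by apply: (lam_mono n nN) => /=; rewrite -ltnS prednK // (leq_ltn_trans _ ll').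
rewrite !ger0_norm ?subr_ge0 //; first by rewrite lerD2r.
exact: le_trans h2.
Qed.

(** Noise-to-signal ratio. The target scale [sqrt n rho / Dl ^ 2] equals [rr ^ 2 nu / kap]. *)
Definition rr n := sr n / Dl n.

Lemma rr_le n : (N0 <= n)%N -> (0 < n)%N -> rr n <= (delta0 * C1)^-1 * (powR n%:R beta)^-1.
Proof.
move=> nN n0; have b0 : 0 < powR (n%:R : R) beta by rewrite powR_gt0 // ltr0n.
rewrite ler_pdivrMr ?Dl_gt0 // -invfM mulrC -[leLHS]mul1r ler_pdivlMr ?mulr_gt0 //.
by rewrite mul1r mulrC Dl_lower.
Qed.

Lemma E_int n (i j : 'I_n) : rv_integrable (Pr n) (fun w => E n w i j) /\
  expectR (Pr n) (fun w => E n w i j) = 0.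
Proof. by have [h1 h2] := E0 n i j; split => //; rewrite /expectR h2. Qed.

Lemma E2_int n (i j : 'I_n) : rv_integrable (Pr n) (fun w => E n w i j ^+ 2) /\
  expectR (Pr n) (fun w => E n w i j ^+ 2) = sig2 i j.
Proof.
split.
  apply: (rv_integrable_bound (b := C * rho n) _ _).1; first exact: measurable_funX.
  by under eq_integral do rewrite ger0_norm ?sqr_ge0 //.
rewrite /sig2 /varR (E_int i j).2; congr expectR; apply/funext => w.
by rewrite subr0.
Qed.

Lemma sig2_bound n (i j : 'I_n) : 0 <= sig2 i j <= C * rho n.
Proof.
rewrite -(E2_int i j).2 expectR_ge0 /= => [|w]; last exact: sqr_ge0.
by rewrite -lee_fin -integrable_expectR ?E2 //; case: (E2_int i j).
Qed.

Lemma qn_ge1 n : (0 < n)%N -> 1 <= qn n.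
Proof.
move=> n0; have /andP[h _] := qn_bound n; apply: le_trans h.
rewrite -[leLHS](powRr0 (n%:R : R)); apply: ler_powR; first by rewrite ler1n.
by case/andP: eps0 => /ltW.
Qed.

(** * The high-probability event of the model *)

Definition good_noise K1 N n w :=
  [/\ forall x, dot (E n w *m x) (E n w *m x) <= (K1 * (sr n * ln n%:R)) ^+ 2 * dot x x,
      forall l r i, (r <= N)%N ->
        `|powv (E n w) r (col l (U n)) i 0| <= (K1 * (sr n * ln n%:R)) ^+ r * nu n &
      forall i, `|\sum_j E n w i j ^+ 2 - \sum_j sig2 i j| <=
        K1 * (n%:R * rho n / qn n * ln n%:R)].

(** Log-convexity is iterated along powers of two, so the moment order is rounded up to one, at the
    cost of a factor two. *)
Lemma pow2_between (x : R) : 1 <= x -> exists t, x <= (2 ^ t)%:R <= 2 * x.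
Proof.
move=> x1; have ex : exists t, x <= (2 ^ t)%:R.
  exists (Num.truncn x).+1; apply: le_trans (ltW (truncnS_gt x)) _.
  by rewrite ler_nat; apply: ltnW; exact: ltn_expl.
exists (ex_minn ex); case: ex_minnP => t xt tmin; rewrite xt /=.
case: t xt tmin => [|t] xt tmin; first by rewrite expn0; lra.
have : ~~ (x <= (2 ^ t)%:R) by apply/negP => /tmin; rewrite ltnn.
by rewrite -ltNge expnS natrM => /ltW h; rewrite ler_wpM2l.
Qed.

(** The outer factor [2] serves the moments of squared entries. Once [ln (ln n) >= 1] the exponent
    is at least [2], and [(2 ln n) ^ 2] dominates the left side as soon as [2 N <= ln n]; the
    threshold [expR 1 + 2 N] ensures both. *)
Lemma moment_range N : for_large (fun n => forall t, (2 ^ t)%:R <= 2 * ln (n%:R : R) ->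
   (2 * (N * (2 * 2 ^ t)))%:R <= powR (2 * ln (n%:R : R)) (A0 * ln (ln n%:R))).
Proof.
apply: for_large_imp (for_large_ln (expR 1 + (2 * N)%:R)) _ => n hl t ht.
set l := ln (n%:R : R) in hl ht *.
have e1 : 1 <= expR 1 :> R by rewrite -expR0 ler_expR.
have l1 : 1 <= l by apply: le_trans hl; apply: le_trans e1 _; rewrite lerDl.
have ll : 1 <= ln l.
  rewrite -[leLHS](expRK 1) ler_ln ?posrE ?expR_gt0 //; last exact: lt_le_trans l1.
  by apply: le_trans hl; rewrite lerDl.
apply: (le_trans (y := powR (2 * l) 2)); last first.
  apply: ler_powR; first lra.
  apply: (le_trans (y := 11 * 1)); first lra.
  by apply: ler_pM.
rewrite powR_mulrn; last lra.
have -> : (2 * (N * (2 * 2 ^ t)))%:R = 2 * (2 * N)%:R * (2 ^ t)%:R :> R.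
  by rewrite !natrM; ring.
have N2l : (2 * N)%:R <= l :> R by apply: le_trans hl; rewrite lerDr expR_ge0.
apply: (le_trans (y := 2 * l * (2 * l))); last by rewrite expr2.
by apply: ler_pM => //; apply: ler_wpM2l.
Qed.

(** The sum in the Markov bound has at most [n ^ 2] terms. The base [expR (cc + 1)] to a power at
    least [2 ln n] yields [n ^ (- 2 (cc + 1))], which pays for them and leaves [n ^ (- 2 cc)]. *)
Lemma prob_bound N (cc : R) : 0 < cc -> for_large (fun n => forall t, ln (n%:R : R) <= (2 ^ t)%:R ->
  (N * d * n + 2 * n)%:R * (expR (cc + 1))^-1 ^+ (2 * 2 ^ t) <= powR (n%:R : R) (- cc)).
Proof.
move=> cc0; apply: for_large_imp (for_large_and (for_large_ge 1) (for_large_ge (N * d + 2))) _ => n [n0 nN] t ht.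
have n1 : (1 : R) <= n%:R by rewrite ler1n.
have npos : (0 : R) < n%:R by rewrite ltr0n.
have h1 : (N * d * n + 2 * n)%:R <= powR (n%:R : R) 2.
  by rewrite powR_mulrn ?(ltW npos) // expr2 -natrM ler_nat -mulnDl leq_mul2r nN orbT.
have h2 : (expR (cc + 1))^-1 ^+ (2 * 2 ^ t) <= powR (n%:R : R) (- (2 * (cc + 1))).
  rewrite exprVn powRN lef_pV2 ?posrE ?exprn_gt0 ?expR_gt0 ?powR_gt0 //.
  rewrite /powR (gt_eqF npos) -expRM_natl ler_expR natrM -!mulrA; apply: ler_wpM2l => //.
  by rewrite mulrC; apply: ler_wpM2r => //; rewrite addr_ge0 // ltW.
have h0 : 0 <= (expR (cc + 1))^-1 ^+ (2 * 2 ^ t) by rewrite exprn_ge0 // invr_ge0 expR_ge0.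
apply: le_trans (ler_pM (ler0n _ _) h0 h1 h2) _.
rewrite -powRD; last by rewrite (gt_eqF npos) implybT.
apply: ler_powR => //; lra.
Qed.

Lemma G_event (cc : R) N : 0 < cc -> (0 < N)%N -> exists2 K1, 0 < K1 & for_large (fun n =>
  exists G : set (Om n), [/\ measurable G, ((1 - powR n%:R (- cc))%:E <= Pr n G)%E &
    forall w, G w -> good_noise K1 N w]).
Proof.
move=> cc0 N1; pose b := expR (cc + 1).
have b1 : 1 <= b by rewrite -expR0 ler_expR addr_ge0 // ltW.
have b0 : 0 < b by exact: expR_gt0.
pose KY := 4 * (C ^+ 2 + C).
have KY0 : 0 < KY by rewrite mulr_gt0 // addr_gt0 // exprn_gt0.
(* One constant for the three bounds: [b] from Markov, [4 N + 2] from [L.+2 <= (4 N + 2) ln n], and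
   [C + 1] and [KY] from the moments of an entry and of its centred square. *)
pose K1 := b * (4 * N%:R + 2) * (C + 1 + KY).
have NN : 0 < 4 * N%:R + 2 :> R by rewrite ltr_wpDl // mulr_ge0.
have K10 : 0 < K1 by rewrite !mulr_gt0 // !addr_gt0.
exists K1 => //.
apply: for_large_imp (for_large_and (for_large_and (for_large_ge N0) (for_large_ge 1)) (for_large_and (for_large_ln 1)
  (for_large_and (moment_range N) (prob_bound N cc0)))) _ => n [[nN n0] [l1 [mr pb]]].
have [t /andP[t1 t2]] := pow2_between l1.
have npos : (0 : R) < n%:R by rewrite ltr0n.
have q1 := qn_ge1 n0.
have q0 : 0 < qn n by exact: lt_le_trans q1.
have qs : qn n <= Num.sqrt n%:R by case/andP: (qn_bound n).
pose L := (N * (2 * 2 ^ t))%N.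
have a0 : 0 < (C + 1) * sr n by rewrite mulr_gt0 ?sr_gt0 // addr_gt0.
have aY0 : 0 < KY * (n%:R * rho n / qn n) by rewrite mulr_gt0 // divr_gt0 // mulr_gt0.
have Em' i j m : (3 <= m)%N -> (m <= 2 * L)%N ->
  (\int[Pr n]_w (`|E n w i j| ^+ m)%:E
     <= (C ^+ m * powR (n%:R * rho n) (m%:R / 2) / (n%:R * qn n ^+ (m - 2)))%:E)%E.
  move=> m3 mL; apply: Em => //; apply: le_trans (mr t t2).
  by rewrite ler_nat.
have mom i j m := @entry_moment _ _ _ (Pr n) n (rho n) (qn n) C (fun w => E n w i j) L n0
  (rho0 n) q1 C0 (E2 n i j) (Em' i j) m.
have momY i j m (mL : (2 <= m <= L)%N) :=
  @square_moment _ _ _ (Pr n) n (rho n) (qn n) C (fun w => E n w i j) L n0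
  (rho0 n) q1 qs C0 (mE n i j) (Em' i j) (sig2 i j) m
  (proj1 (andP (sig2_bound i j))) (proj2 (andP (sig2_bound i j))) mL.
have [G [mG PG HG]] := good_event (N := N) (t := t) n0 (Esym n) (mE n) (@E_int n) (@E2_int n)
  (indE n) a0 aY0 mom momY (nu_gt0 n0) b1 (fun i l => U_entry l i nN) (leqnn _) N1.
exists G; split => //.
  by apply: le_trans PG; rewrite lee_fin lerD2l lerN2 pb.
have L2 : L.+2%:R <= (4 * N%:R + 2) * ln n%:R :> R.
  have -> : L.+2%:R = 2 * N%:R * (2 ^ t)%:R + 2 :> R.
    by rewrite -addn2 natrD !natrM; ring.
  rewrite [leRHS]mulrDl; apply: lerD; last lra.
  have -> : 4 * N%:R * ln n%:R = 2 * N%:R * (2 * ln n%:R) :> R by ring.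
  by rewrite ler_wpM2l.
have lpos : 0 <= ln n%:R :> R by exact: le_trans l1.
have tauK : b * ((C + 1) * sr n * L.+2%:R) <= K1 * (sr n * ln n%:R).
  have -> : K1 * (sr n * ln n%:R) = b * ((C + 1 + KY) * sr n * ((4 * N%:R + 2) * ln n%:R)).
    by rewrite /K1; ring.
  apply: ler_wpM2l; first exact: ltW.
  apply: ler_pM => //; first exact: ltW.
  by apply: ler_wpM2r; [rewrite ltW ?sr_gt0|rewrite lerDl ltW].
have tauYK : b * (KY * (n%:R * rho n / qn n) * L.+2%:R) <= K1 * (n%:R * rho n / qn n * ln n%:R).
  have -> : K1 * (n%:R * rho n / qn n * ln n%:R) =
      b * ((C + 1 + KY) * (n%:R * rho n / qn n) * ((4 * N%:R + 2) * ln n%:R)).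
    by rewrite /K1; ring.
  apply: ler_wpM2l; first exact: ltW.
  apply: ler_pM => //; first exact: ltW.
  apply: ler_wpM2r; first by rewrite ltW // divr_gt0 // mulr_gt0.
  by rewrite lerDr addr_ge0 // ltW.
have tau0 : 0 <= b * ((C + 1) * sr n * L.+2%:R).
  by rewrite mulr_ge0 ?(ltW b0) // mulr_ge0 // ltW.
move=> w /HG[h1 h2 h3]; split.
- move=> x; apply: le_trans (h1 x) _; apply: ler_wpM2r; first exact: dot_ge0.
  by apply: lerXn2r; rewrite ?nnegrE // (le_trans tau0).
- move=> l r i rN; apply: le_trans (h2 l r i rN) _; apply: ler_wpM2r; first by rewrite ltW ?nu_gt0.
  by apply: lerXn2r; rewrite ?nnegrE // (le_trans tau0).
- by move=> i; apply: le_trans (h3 i) _.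
Qed.

Lemma rr_gt0 n : (N0 <= n)%N -> (0 < n)%N -> 0 < rr n.
Proof. by move=> nN n0; rewrite divr_gt0 ?sr_gt0 ?Dl_gt0. Qed.

(** The signal exceeds the noise by a factor of order [n ^ beta], which absorbs any power of the
    logarithm. *)
Lemma rr_ln_small (e : R) j : 0 < e -> for_large (fun n => rr n * ln n%:R ^+ j <= e).
Proof.
move=> e0; pose K := (delta0 * C1)^-1.
have K0 : 0 < K by rewrite invr_gt0 mulr_gt0.
apply: for_large_imp (for_large_and (for_large_and (for_large_ge N0) (for_large_ge 1)) (for_large_and (for_large_ln (0 : R))
  (for_large_lnX (K / e) j beta0))) _ => n [[nN n0] [l0 h]].
have b0 : 0 < powR (n%:R : R) beta by rewrite powR_gt0 // ltr0n.
apply: (le_trans (ler_wpM2r (exprn_ge0 j l0) (rr_le nN n0))).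
rewrite -/K mulrAC ler_pdivrMr // -ler_pdivrMl //; apply: le_trans h.
by rewrite mulrA [_ / e]mulrC.
Qed.

Lemma ln_qn_small (e : R) : 0 < e -> for_large (fun n => ln (n%:R : R) / qn n <= e).
Proof.
move=> e0; have ee : 0 < eps by case/andP: eps0.
apply: for_large_imp (for_large_and (for_large_ge 1) (for_large_lnX e^-1 1 ee)) _ => n [n0 h].
have q0 : 0 < qn n by apply: lt_le_trans (qn_ge1 n0).
rewrite ler_pdivrMr // -ler_pdivrMl //.
rewrite expr1 in h; apply: le_trans h _; by case/andP: (qn_bound n).
Qed.

Lemma inv_sqrt_le n : (0 < n)%N -> (Num.sqrt (n%:R : R))^-1 <= (qn n)^-1.
Proof.
move=> n0; have q0 : 0 < qn n by apply: lt_le_trans (qn_ge1 n0).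
rewrite lef_pV2 ?posrE //; last by rewrite sqrtr_gt0 ltr0n.
by case/andP: (qn_bound n).
Qed.

Definition tau K1 n := K1 * (sr n * ln n%:R).

Lemma tau_Dl K1 n : tau K1 n / Dl n = K1 * (rr n * ln n%:R).
Proof. by rewrite /tau /rr; ring. Qed.

(* Chosen so that [(tau / Dl)^(Npow - 3)], of order [n^(-beta (Npow - 3))] up to
   logarithms, is negligible with respect to [nu]. *)
Definition Npow := (Num.truncn (2 / beta) + 4)%N.

Lemma Npow_ge3 : (3 <= Npow)%N. Proof. by rewrite /Npow; apply: leq_trans (leq_addl _ 4). Qed.

(** Half of the exponent [beta] absorbs the logarithm in [tau], so [M.+1 > 2 / beta] factors are
    worth [1 / n]. This is below [nu] by a factor of order [n ^ (1 / 2)], enough for the constant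
    [2 ^+ Npow / kap]. *)
Lemma remainder_small K1 : 0 < K1 -> for_large (fun n =>
  (2 * (tau K1 n / Dl n)) ^+ Npow <= (tau K1 n / Dl n) ^+ 3 * nu n).
Proof.
move=> K10; set M := Num.truncn (2 / beta).
have Kb : 0 < K1 * (delta0 * C1)^-1 by rewrite mulr_gt0 // invr_gt0 mulr_gt0.
have b2 : 0 < beta / 2 by rewrite divr_gt0.
have half0 : 0 < 1 / 2 :> R by rewrite divr_gt0.
apply: for_large_imp (for_large_and (for_large_and (for_large_ge N0) (for_large_ge 1)) (for_large_and (for_large_ln (0 : R))
  (for_large_and (for_large_lnX (K1 * (delta0 * C1)^-1) 1 b2)
  (for_large_powR (2 ^+ Npow / kap) half0)))) _ => n [[nN n0] [l0 [h hk]]].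
have npos : (0 : R) < n%:R by rewrite ltr0n.
have n1 : (1 : R) <= n%:R by rewrite ler1n.
set D := tau K1 n / Dl n.
have D0 : 0 <= D.
  by rewrite /D tau_Dl mulr_ge0 ?(ltW K10) // mulr_ge0 // ltW // rr_gt0.
have Dle : D <= powR (n%:R : R) (- (beta / 2)).
  rewrite /D tau_Dl; have bp : 0 < powR (n%:R : R) beta by rewrite powR_gt0.
  have -> : powR (n%:R : R) (- (beta / 2)) = powR n%:R (beta / 2) / powR n%:R beta.
    rewrite -powRN -powRD; last by rewrite (gt_eqF npos) implybT.
    by congr powR; field.
  rewrite ler_pdivlMr //; apply: le_trans h; rewrite expr1.
  have := ler_wpM2r (ltW bp) (rr_le nN n0); rewrite -[leRHS]mulrA mulVf ?gt_eqF // mulr1 => h2.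
  have -> : K1 * (rr n * ln n%:R) * powR n%:R beta = K1 * (rr n * powR n%:R beta) * ln n%:R by ring.
  by apply: ler_wpM2r => //; apply: ler_wpM2l => //; exact: ltW.
have DM : D ^+ M.+1 <= n%:R^-1.
  apply: (le_trans (y := powR (n%:R : R) (- (beta / 2)) ^+ M.+1)).
    by apply: lerXn2r; rewrite ?nnegrE ?powR_ge0.
  rewrite -powR_mulrn ?powR_ge0 // -powRrM -(powR_inv1 (ltW npos)); apply: ler_powR => //.
  rewrite mulNr lerN2; have := truncnS_gt (2 / beta).
  rewrite -/M ltr_pdivrMr // => hM; lra.
have NE : Npow = (3 + M.+1)%N by rewrite /Npow -/M addnC !addSn add0n.
have -> : (2 * D) ^+ Npow = D ^+ 3 * (2 ^+ Npow * D ^+ M.+1).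
  by rewrite exprMn mulrCA NE [D ^+ (3 + _)]exprD.
apply: ler_wpM2l; first exact: exprn_ge0.
apply: (le_trans (y := 2 ^+ Npow * n%:R^-1)).
  by apply: ler_wpM2l => //; exact: exprn_ge0.
rewrite /nu ler_pdivlMr ?sqrtr_gt0 //.
have -> : 2 ^+ Npow / n%:R * Num.sqrt n%:R = 2 ^+ Npow / Num.sqrt (n%:R : R).
  rewrite -{1}(sqr_sqrtr (ltW npos)); field; by rewrite gt_eqF // sqrtr_gt0.
rewrite ler_pdivrMr ?sqrtr_gt0 // -ler_pdivrMl ?kap_gt0 // mulrC.
by apply: le_trans hk _; rewrite div1r powR12_sqrt // ltW.
Qed.

Definition regime K1 n (w : Om n) :=
  [/\ (N0 <= n)%N, (0 < n)%N, 0 <= tau K1 n <= Dl n / 4,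
      (2 * (tau K1 n / Dl n)) ^+ Npow <= (tau K1 n / Dl n) ^+ 3 * nu n & good_noise K1 Npow w].

Definition uhat n (w : Om n) (l : 'I_d) := col l (@UAof R n p d (V n w)).

(* Agrees with [Num.sg] except at [0], where it is [1]; it is invertible. *)
Definition sgn n (w : Om n) (l : 'I_d) : R :=
  (-1) ^+ (dot (col l (U n)) (uhat w l) < 0)%R.

(** * Deterministic estimates on the event *)

Section Conf.
Variables (K1 : R) (S : forall n, Om n -> Prop).
Hypothesis HS : forall n (w : Om n), S w -> regime K1 w.

(** The configuration lemmas are instantiated at all pairs of a size and an outcome in the event, so
    their constants depend on neither. [S] may impose more than [regime]. *)
Let T := {x : {n : nat & Om n} | S (projT2 x)}.
Let cn (x : T) : nat := projT1 (sval x).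
Let cw (x : T) : Om (cn x) := projT2 (sval x).
Let mk n (w : Om n) (h : S w) : T := exist (fun x : {n : nat & Om n} => S (projT2 x)) (existT _ n w) h.

Let hb x : regime K1 (cw x). Proof. exact: HS (proj2_sig x). Qed.
Let h1 x : (N0 <= cn x)%N. Proof. by case: (hb x). Qed.
Let h2 x : (0 < cn x)%N. Proof. by case: (hb x). Qed.
Let h3 x : 0 <= tau K1 (cn x) <= Dl (cn x) / 4. Proof. by case: (hb x). Qed.
Let h4 x : (2 * (tau K1 (cn x) / Dl (cn x))) ^+ Npow <= (tau K1 (cn x) / Dl (cn x)) ^+ 3 * nu (cn x).
Proof. by case: (hb x). Qed.
Let h5 x : good_noise K1 Npow (cw x). Proof. by case: (hb x). Qed.

Let AE' x : U (cn x) *m diagv (lam (cn x)) *m (U (cn x))^T + E (cn x) (cw x) =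
  V (cn x) (cw x) *m diagv (mu (cn x) (cw x)) *m (V (cn x) (cw x))^T.
Proof. by rewrite -PmE ?h1 // AE. Qed.

Let Est x : (E (cn x) (cw x))^T = E (cn x) (cw x).
Proof. by apply/matrixP => i j; rewrite mxE Esym. Qed.

Let Eop x v : dot (E (cn x) (cw x) *m v) (E (cn x) (cw x) *m v) <= tau K1 (cn x) ^+ 2 * dot v v.
Proof. by case: (h5 x) => h _ _; exact: h. Qed.

Let Epw x l r i : (r < Npow)%N ->
  `|powv (E (cn x) (cw x)) r (col l (U (cn x))) i 0| <= tau K1 (cn x) ^+ r * nu (cn x).
Proof. by move=> rN; case: (h5 x) => _ h _; apply: h; exact: ltnW. Qed.

Lemma conf_coef : exists2 K, 0 <= K & forall n (w : Om n) l, S w ->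
  `|1 - `|dot (col l (U n)) (uhat w l)| | <= K * (tau K1 n / Dl n) ^+ 2.
Proof.
have [K K0 HK] := @coef_main R T d p cn (fun x => U (cn x)) (fun x => lam (cn x))
  (fun x => E _ (cw x)) (fun x => V _ (cw x)) (fun x => mu _ (cw x)) (fun x => Dl (cn x))
  (fun x => tau K1 (cn x)) Npow (fun x => UU _ (h1 x)) (fun x => VV _ (cw x)) AE'
  (fun x => lam_sign _ (h1 x)) (fun x => lam_mono _ (h1 x)) (fun x => mu_mono _ (cw x))
  (fun x => Dl_gt0 (h1 x) (h2 x)) (fun x => @Dl_lam (cn x)) (fun x l l' => @Dl_gap (cn x) l l' (h1 x))
  h3 Eop Npow_ge3.
by exists K => // n w l h; exact: (HK l (mk h)).
Qed.

Lemma conf_second_order (gam : nat -> R) :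
  (forall n (w : Om n), S w -> 0 <= gam n /\ gam n <= tau K1 n / Dl n) ->
  (forall n (w : Om n), S w -> forall l l',
     `|dot (col l (U n)) (E n w *m col l' (U n))| <= gam n * Dl n) ->
  exists2 K, 0 <= K & forall n (w : Om n) (i : 'I_n), S w ->
  `|(sgn w k *: uhat w k - col k (U n)
     - (lam n k)^-1 *: corr (U n) (lam n) k 1 (E n w *m col k (U n))
     - (lam n k ^+ 2)^-1 *: corr (U n) (lam n) k (3 / 2) (E n w *m (E n w *m col k (U n)))) i 0|
  <= K * ((tau K1 n / Dl n * gam n + (tau K1 n / Dl n) ^+ 3) * nu n).
Proof.
move=> g1 g2.
have [K K0 HK] := @second_order_expansion R T d p cn (fun x => U (cn x)) (fun x => lam (cn x))
  (fun x => E _ (cw x)) (fun x => V _ (cw x)) (fun x => mu _ (cw x)) (fun x => Dl (cn x))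
  (fun x => tau K1 (cn x)) (fun x => nu (cn x)) lam_ratio Npow (fun x => UU _ (h1 x)) (fun x => VV _ (cw x))
  Est AE'
  (fun x => lam_sign _ (h1 x)) (fun x => lam_mono _ (h1 x)) (fun x => mu_mono _ (cw x))
  (fun x => Dl_gt0 (h1 x) (h2 x)) (fun x => @Dl_lam (cn x)) (fun x l => lam_Dl l (h1 x))
  (fun x l l' => @Dl_gap (cn x) l l' (h1 x))
  h3 Eop (fun x => ltW (nu_gt0 (h2 x))) Npow_ge3 (fun x l r j => @Epw x l r j) h4 k
  (fun x => gam (cn x)) (fun x => proj1 (g1 _ _ (proj2_sig x))) (fun x => proj2 (g1 _ _ (proj2_sig x)))
  (fun x => g2 _ _ (proj2_sig x)).
by exists K => // n w i h; exact: (HK (mk h) i).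
Qed.

Definition Dvec n : 'cV[R]_n := \col_i \sum_j sig2 i j.
(** [C + 1] makes [Bn] dominate both the row sums of variances, at most [C n rho], and [n rho]
    itself. *)
Definition Bn n : R := (C + 1) * (n%:R * rho n).

Lemma conf_bias (eta : nat -> R) :
  (forall n (w : Om n), S w -> [/\ 0 <= eta n <= 1, tau K1 n / Dl n <= eta n,
     tau K1 n * nu n <= Num.sqrt (Bn n) * eta n &
     K1 * (n%:R * rho n / qn n * ln n%:R) <= Bn n * eta n]) ->
  exists2 K, 0 <= K & forall n (w : Om n) (i : 'I_n), S w ->
  `|(sgn w k *: bias_formula (@UAof R n p d (V n w)) (@SAof R n p d (mu n w))
       (Dhat (Pm n + E n w) (@Phat R n p d (V n w) (mu n w))) k
     - bias_formula (U n) (lam n) (diag_mx (\row_j Dvec n j 0)) k) i 0|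
  <= K * (Bn n / Dl n ^+ 2 * nu n * eta n).
Proof.
move=> He.
have He' (x : T) := He _ _ (proj2_sig x).
have Bn0 n : 0 <= Bn n by rewrite mulr_ge0 ?addr_ge0 ?(ltW C0) // mulr_ge0 // ltW.
have e1 x : 0 <= eta (cn x) <= 1 by case: (He' x).
have e2 x : tau K1 (cn x) / Dl (cn x) <= eta (cn x) by case: (He' x).
have e3 x : tau K1 (cn x) * nu (cn x) <= Num.sqrt (Bn (cn x)) * eta (cn x) by case: (He' x).
have e4 x (j : 'I_(cn x)) : `|\sum_j' E _ (cw x) j j' ^+ 2 - Dvec (cn x) j 0| <= Bn (cn x) * eta (cn x).
  rewrite mxE; case: (h5 x) => _ _ h; apply: le_trans (h j) _; by case: (He' x).
have e5 x (j : 'I_(cn x)) : 0 <= Dvec (cn x) j 0 <= Bn (cn x).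
  rewrite mxE; apply/andP; split; first by apply: sumr_ge0 => j' _; case/andP: (sig2_bound j j').
  apply: (le_trans (y := \sum_(j' < cn x) C * rho (cn x))).
    by apply: ler_sum => j' _; case/andP: (sig2_bound j j').
  rewrite sumr_const card_ord -[leLHS]mulr_natl /Bn.
  have -> : (cn x)%:R * (C * rho (cn x)) = C * ((cn x)%:R * rho (cn x)) by ring.
  apply: ler_wpM2r; last by rewrite lerDl.
  by rewrite mulr_ge0 // ltW.
have [K K0 HK] := @bias_estimate R T d p cn (fun x => U (cn x)) (fun x => lam (cn x))
  (fun x => E _ (cw x)) (fun x => V _ (cw x)) (fun x => mu _ (cw x)) (fun x => Dl (cn x))
  (fun x => tau K1 (cn x)) (fun x => nu (cn x)) lam_ratio Npow (fun x => UU _ (h1 x)) (fun x => VV _ (cw x))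
  AE'
  (fun x => lam_sign _ (h1 x)) (fun x => lam_mono _ (h1 x)) (fun x => mu_mono _ (cw x))
  (fun x => Dl_gt0 (h1 x) (h2 x)) (fun x => @Dl_lam (cn x)) (fun x l => lam_Dl l (h1 x))
  (fun x l l' => @Dl_gap (cn x) l l' (h1 x))
  h3 Eop (fun x => ltW (nu_gt0 (h2 x))) Npow_ge3 (fun x l r j => @Epw x l r j) h4
  (fun x => eta (cn x)) (fun x => Bn (cn x)) (fun x => Dvec (cn x))
  (fun x l j => U_entry l j (h1 x)) e1 e2 (fun x => Bn0 (cn x)) e3 e5 e4 k.
exists K => // n w i h; rewrite PmE; first exact: (HK (mk h) i).
by case: (HS h).
Qed.

End Conf.

Lemma tau_small K1 (e : R) : 0 < K1 -> 0 < e -> for_large (fun n => tau K1 n / Dl n <= e).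
Proof.
move=> K10 e0; have e1 : 0 < e / K1 by rewrite divr_gt0.
apply: (for_large_imp (rr_ln_small 1 e1)) => n; rewrite expr1 tau_Dl => h.
by rewrite -ler_pdivlMl // [_^-1 * _]mulrC.
Qed.

Lemma regime_large K1 : 0 < K1 ->
  for_large (fun n => forall w : Om n, good_noise K1 Npow w -> regime K1 w).
Proof.
move=> K10; have e0 : 0 < 1 / 4 :> R by rewrite divr_gt0.
apply: for_large_imp (for_large_and (for_large_and (for_large_ge N0) (for_large_ge 1)) (for_large_and (for_large_ln (0 : R))
  (for_large_and (tau_small K10 e0) (remainder_small K10)))) _.
move=> n [[nN n0] [l0 [h1 h2]]] w Gw; split => //.
have D0 := Dl_gt0 nN n0; apply/andP; split.
  by rewrite /tau mulr_ge0 ?(ltW K10) // mulr_ge0 // ltW // sr_gt0.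
by move: h1; rewrite ler_pdivrMr // mulrC mulrA mulr1.
Qed.

(** The overlap tends to [1] in absolute value. The bound keeps it away from [0], where [Num.sg] and
    [sgn] differ, and leaves room for subtracting the estimated bias. *)
Lemma sgn_large K1 : 0 < K1 -> for_large (fun n => forall w : Om n, good_noise K1 Npow w ->
  1 / 2 <= `|dot (col k (U n)) (uhat w k)|).
Proof.
move=> K10; have [K K0 HK] := @conf_coef K1 (fun n w => regime K1 w) (fun n w h => h).
have e0 : 0 < 1 / 2 / (K + 1) by rewrite divr_gt0 // ?divr_gt0 // ltr_wpDl.
have e1 : 0 < 1 / 2 :> R by rewrite divr_gt0.
apply: for_large_imp (for_large_and (regime_large K10) (for_large_and (tau_small K10 e1) (tau_small K10 e0))) _.
move=> n [hb [h1 h2]] w /hb bw; have := HK _ _ k bw.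
have [nN n0 /andP[t0 _] _ _] := bw.
have D0 : 0 <= tau K1 n / Dl n by rewrite divr_ge0 // ltW // Dl_gt0.
move: h1 h2 D0; set D := tau K1 n / Dl n => h1 h2 D0.
rewrite ler_pdivlMr in h2; last by rewrite ltr_wpDl.
rewrite ler_norml => /andP[_ h3].
have h4 : K * D ^+ 2 <= K * D.
  rewrite ler_wpM2l // expr2 -[leRHS]mulr1 ler_wpM2l //; lra.
have h5 : D * (K + 1) = K * D + D by ring.
lra.
Qed.

Lemma sgn_sg n (w : Om n) : 1 / 2 <= `|dot (col k (U n)) (uhat w k)| ->
  Num.sg (dot (col k (U n)) (uhat w k)) = sgn w k.
Proof.
move=> h; rewrite /sgn neqr0_sign // -normr_eq0; apply/eqP => h0.
rewrite h0 in h; lra.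
Qed.

(** * The estimated bias *)

Definition Dn n := Dof (fun i j : 'I_n => varR (Pr n) (fun w => E n w i j)).
Definition bk n := bias_formula (U n) (lam n) (Dn n) k.
Definition bhat n (w : Om n) :=
  bias_formula (@UAof R n p d (V n w)) (@SAof R n p d (mu n w))
    (Dhat (Pm n + E n w) (@Phat R n p d (V n w) (mu n w))) k.

Lemma Dn_diag n : Dn n = diag_mx (\row_j Dvec n j 0).
Proof. by congr diag_mx; apply/rowP => j; rewrite !mxE. Qed.

Lemma measurable_mx_uhat n : measurable_mx (fun w : Om n => uhat w k).
Proof. by apply: measurable_mx_col; apply: measurable_mx_UAof; exact: mV. Qed.

Lemma measurable_mx_bhat n : measurable_mx (@bhat n).
Proof.
apply: measurable_mx_bias_formula; first by apply: measurable_mx_UAof; exact: mV.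
  by move=> l; apply: measurable_SAof; exact: mmu.
apply: measurable_mx_Dhat; last by apply: measurable_mx_Phat; [exact: mV|exact: mmu].
by apply: measurable_mx_add; [exact: measurable_mx_cst|exact: mE].
Qed.

Definition mq n := Num.max (qn n)^-1 (rr n).

(** Relative error of the estimated bias. The factor [1 + kap] covers both the terms with constant
    [K1] and those where [nu] brings in [kap]. *)
Definition eta K1 n := K1 * (1 + kap) * (mq n * ln n%:R).

Lemma eta_small K1 (e : R) : 0 < K1 -> 0 < e -> for_large (fun n => eta K1 n <= e).
Proof.
move=> K10 e0; have Ke : 0 < K1 * (1 + kap) by rewrite mulr_gt0 // addr_gt0 // kap_gt0.
have e1 : 0 < (K1 * (1 + kap))^-1 * e by rewrite mulr_gt0 // invr_gt0.
apply: for_large_imp (for_large_and (ln_qn_small e1) (rr_ln_small 1 e1)) _ => n [h1 h2].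
rewrite /eta -ler_pdivlMl // /mq /Num.max; case: ifP => _; first by rewrite expr1 in h2.
by rewrite mulrC.
Qed.

(** In the third estimate, [q_n <= sqrt n] converts the entry size [kap / sqrt n] into [1 / q_n]. *)
Lemma eta_conditions K1 n : 0 < K1 -> (N0 <= n)%N -> (0 < n)%N -> 0 <= ln (n%:R : R) ->
  [/\ 0 <= eta K1 n, tau K1 n / Dl n <= eta K1 n,
     tau K1 n * nu n <= Num.sqrt (Bn n) * eta K1 n &
     K1 * (n%:R * rho n / qn n * ln n%:R) <= Bn n * eta K1 n].
Proof.
move=> K10 nN n0 l0; have kp := kap_gt0.
have q0 : 0 < qn n by apply: lt_le_trans (qn_ge1 n0).
have npos : (0 : R) < n%:R by rewrite ltr0n.
have mq1 : (qn n)^-1 <= mq n by rewrite /mq le_max lexx.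
have mq2 : rr n <= mq n by rewrite /mq le_max lexx orbT.
have mq0 : 0 < mq n by apply: lt_le_trans mq1; rewrite invr_gt0.
have C1' : 1 <= C + 1 by rewrite lerDr ltW.
have nr : 0 <= n%:R * rho n by rewrite mulr_ge0 // ltW.
have K1k : K1 <= K1 * (1 + kap) by rewrite -[leLHS]mulr1 ler_wpM2l ?(ltW K10) // lerDl ltW.
have Kk : K1 * kap <= K1 * (1 + kap) by rewrite ler_wpM2l ?(ltW K10) // lerDr.
have Ke : 0 <= K1 * (1 + kap) by apply: le_trans K1k; exact: ltW.
have ml : 0 <= mq n * ln n%:R by rewrite mulr_ge0 // ltW.
split.
- by rewrite /eta mulr_ge0.
- rewrite tau_Dl /eta; apply: ler_pM => //; first exact: ltW.
    by rewrite mulr_ge0 // ltW // rr_gt0.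
  exact: ler_wpM2r.
- have -> : tau K1 n * nu n = sr n * (K1 * kap * ((Num.sqrt n%:R)^-1 * ln n%:R)).
    by rewrite /tau /nu; ring.
  have -> : Num.sqrt (Bn n) = sr n * Num.sqrt (C + 1).
    by rewrite /Bn sqrtrM ?addr_ge0 ?(ltW C0) // mulrC.
  rewrite -[leRHS]mulrA; apply: ler_wpM2l; first by rewrite ltW // sr_gt0.
  apply: (le_trans (y := 1 * eta K1 n)); last first.
    apply: ler_wpM2r; first by rewrite /eta mulr_ge0.
    by rewrite -[leLHS]sqrtr1 ler_wsqrtr.
  rewrite mul1r /eta; apply: ler_pM => //; first by rewrite mulr_ge0 // ltW.
    by rewrite mulr_ge0 // invr_ge0 sqrtr_ge0.
  apply: ler_wpM2r => //; exact: le_trans (inv_sqrt_le n0) mq1.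
- have -> : K1 * (n%:R * rho n / qn n * ln n%:R) = n%:R * rho n * (K1 * ((qn n)^-1 * ln n%:R)) by ring.
  apply: ler_pM => //; first by rewrite mulr_ge0 ?(ltW K10) // mulr_ge0 // invr_ge0 ltW.
    by rewrite /Bn ler_peMl.
  rewrite /eta; apply: ler_pM => //; first exact: ltW.
    by rewrite mulr_ge0 // invr_ge0 ltW.
  exact: ler_wpM2r.
Qed.

Lemma bias_large K1 : 0 < K1 -> exists2 K, 0 <= K &
  for_large (fun n => forall w : Om n, good_noise K1 Npow w -> forall i,
    `|(sgn w k *: bhat w - bk n) i 0| <= K * (Bn n / Dl n ^+ 2 * nu n * eta K1 n)).
Proof.
move=> K10; pose S n (w : Om n) := regime K1 w /\ 0 <= ln (n%:R : R) /\ eta K1 n <= 1.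
have [K K0 HK] := @conf_bias K1 S (fun n w h => proj1 h) (eta K1)
  (fun n w h => let: conj b (conj l e) := h in
   let: And5 nN n0 _ _ _ := b in
   let: And4 a1 a2 a3 a4 := eta_conditions K10 nN n0 l in
   And4 (introT andP (conj a1 e)) a2 a3 a4).
exists K => //.
apply: for_large_imp (for_large_and (regime_large K10) (for_large_and (for_large_ln (0 : R)) (eta_small K10 ltr01))) _.
move=> n [hb [hl he]] w /hb bw i; rewrite /bhat /bk Dn_diag; exact: HK.
Qed.

Theorem bias_estimate_prob (xi : R) : 1 < xi ->
  OtildeP Pr
    (fun n w => vinf (Num.sg (((col k (U n))^T *m uhat w k) 0 0) *: bhat w - bk n))
    (fun n => Num.sqrt (n%:R) * rho n / Dl n ^+ 2
              * Num.max (qn n)^-1 (Num.sqrt (n%:R * rho n) / Dl n)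
              * powR (ln (n%:R)) xi).
Proof.
move=> xi1 cc cc0.
have [K1 K10 [N1 HG]] := @G_event cc Npow cc0 (leq_trans (isT : 0 < 3)%N Npow_ge3).
have [K K0 HK] := bias_large K10.
exists (K * (C + 1) * kap * (K1 * (1 + kap))).
have [N2 H] := for_large_and (for_large_and (for_large_ge N0) (for_large_and (for_large_ge 1) (for_large_ge N1)))
  (for_large_and (for_large_ln (1 : R)) (for_large_and (sgn_large K10) HK)).
exists N2 => n /H [[nN [n0 n1]] [l1 [hs hK]]].
have [G [mG PG GG]] := HG n n1; apply: le_trans PG _.
have mX : measurable_fun setT (fun w : Om n =>
    `|vinf (Num.sg (((col k (U n))^T *m uhat w k) 0 0) *: bhat w - bk n)|).
  apply: measurableT_comp => //; apply: measurable_vinf; apply: measurable_mx_add; last exact: measurable_mx_cst.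
  apply: measurable_mx_scale; last exact: measurable_mx_bhat.
  apply: measurable_fun_sg; apply: measurable_mx_mul; [exact: measurable_mx_cst|exact: measurable_mx_uhat].
apply: le_measure; rewrite ?inE //; first exact: measurable_le_set.
move=> w /GG gw /=; rewrite dotE sgn_sg; last exact: hs.
have kp := kap_gt0; have npos : (0 : R) < n%:R by rewrite ltr0n.
have sn : 0 < Num.sqrt (n%:R : R) by rewrite sqrtr_gt0.
have mq0 : 0 <= mq n by rewrite /mq le_max invr_ge0 ltW // (lt_le_trans _ (qn_ge1 n0)).
set Y := _ * powR _ _.
have hY : K * (Bn n / Dl n ^+ 2 * nu n * eta K1 n) <= K * (C + 1) * kap * (K1 * (1 + kap)) * Y.
  have -> : K * (Bn n / Dl n ^+ 2 * nu n * eta K1 n) = K * (C + 1) * kap * (K1 * (1 + kap)) *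
      (Num.sqrt n%:R * rho n / Dl n ^+ 2 * mq n * ln n%:R).
    rewrite /Bn /nu /eta -{1}(sqr_sqrtr (ltW npos)); field.
    by rewrite !gt_eqF // Dl_gt0.
  apply: ler_wpM2l.
    have Cp : 0 <= C + 1 by rewrite addr_ge0 // ltW.
    have kp1 : 0 <= 1 + kap by rewrite addr_ge0 // ltW.
    have [kp0 K1p] := (ltW kp, ltW K10).
    exact: (mulr_ge0 (mulr_ge0 (mulr_ge0 K0 Cp) kp0) (mulr_ge0 K1p kp1)).
  rewrite /Y; apply: ler_wpM2l.
    rewrite mulr_ge0 // divr_ge0 ?sqr_ge0 // mulr_ge0 ?(ltW sn) //; exact: ltW.
  (* The estimate carries a single logarithm, which is at least [1], so its power [xi] dominates
     it. *)
  rewrite -[leLHS]powRr1 ?(le_trans _ l1) //; apply: ler_powR => //; exact: ltW.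
have vb : vinf (sgn w k *: bhat w - bk n) <= K * (C + 1) * kap * (K1 * (1 + kap)) * Y.
  apply: le_trans hY; apply: bigmax_le => [|i _]; last exact: hK.
  rewrite mulr_ge0 // mulr_ge0 //; last first.
    by case: (eta_conditions K10 nN n0 (le_trans ler01 l1)).
  rewrite mulr_ge0 ?(ltW (nu_gt0 n0)) // divr_ge0 ?sqr_ge0 //.
  by rewrite /Bn mulr_ge0 ?addr_ge0 ?(ltW C0) // mulr_ge0 // ltW.
by rewrite ger0_norm //; apply: bigmax_ge_id.
Qed.

(** * Size of the correction operator *)

Definition corr_const : R := 3 / 2 + d%:R * lam_ratio.

Lemma corr_const_ge0 : 0 <= corr_const.
Proof. by rewrite addr_ge0 ?divr_ge0 // mulr_ge0 // ltW // vp_gt0. Qed.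

(** The eigengap bounds each ratio [lam_l / (lam_k - lam_l)] by [lam_ratio], and each projection
    contributes an entry of [U], hence [nu n]; [corr_const] adds up the coefficients. *)
Lemma corr_bound n (i : 'I_n) c0 (y : 'cV[R]_n) b0 b : (N0 <= n)%N -> 0 <= c0 <= 3 / 2 ->
  `|y i 0| <= b0 -> (forall l, `|dot (col l (U n)) y| <= b) ->
  `|corr (U n) (lam n) k c0 y i 0| <= b0 + corr_const * (nu n * b).
Proof.
move=> nN /andP[c00 c02] yb0 yb; have n0 : (0 < n)%N by apply: leq_ltn_trans (ltn_ord i).
have nu0 := ltW (nu_gt0 n0); have D0 := Dl_gt0 nN n0.
have bb : 0 <= b by apply: le_trans (yb k).
rewrite corrE /corr_const mulrDl addrA; apply: le_trans (ler_normD _ _) _; apply: lerD.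
  apply: le_trans (ler_normB _ _) _; apply: lerD => //.
  rewrite !normrM (ger0_norm c00) -mulrA; apply: ler_pM => //.
  by rewrite mulrC; apply: ler_pM => //; exact: U_entry.
apply: le_trans (ler_norm_sum _ _ _) _.
apply: (le_trans (y := \sum_(l < d) lam_ratio * (nu n * b))); last first.
  by rewrite sumr_const card_ord -[leLHS]mulr_natl mulrA.
rewrite [leRHS](bigD1 k) //= -[leLHS]add0r; apply: lerD.
  by rewrite mulr_ge0 ?(ltW vp_gt0) // mulr_ge0.
apply: ler_sum => l lk; set r := lam n l / _.
have rv : `|r| <= lam_ratio.
  rewrite /r normrM normfV ler_pdivrMr; last first.
    by apply: lt_le_trans D0 _; apply: Dl_gap => //; rewrite eq_sym.
  apply: le_trans (lam_Dl l nN) _; apply: ler_wpM2l; first exact: ltW vp_gt0.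
  by apply: Dl_gap => //; rewrite eq_sym.
move: r rv => {}r rv; rewrite !normrM -mulrA; apply: ler_pM => //.
by rewrite mulrC; apply: ler_pM => //; exact: U_entry.
Qed.

(** A diagonal matrix keeps [u_k] spread out, so each projection is at most [n nu^2 B = kap^2 B]. *)
Lemma corr_diag_bound n (i : 'I_n) c0 (s : 'I_n -> R) B : (N0 <= n)%N -> 0 <= c0 <= 3 / 2 ->
  (forall j, `|s j| <= B) ->
  `|corr (U n) (lam n) k c0 (\col_j (s j * U n j k)) i 0|
    <= (1 + corr_const * kap ^+ 2) * (B * nu n).
Proof.
move=> nN c02 sB; have n0 : (0 < n)%N by apply: leq_ltn_trans (ltn_ord i).
have nu0 := ltW (nu_gt0 n0); have B0 : 0 <= B by apply: le_trans (sB i).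
have -> : (1 + corr_const * kap ^+ 2) * (B * nu n) =
    B * nu n + corr_const * (nu n * (n%:R * (nu n ^+ 2 * B))).
  by rewrite -(nu_sqr n0); ring.
apply: corr_bound => //; first by rewrite mxE normrM; apply: ler_pM => //; exact: U_entry.
move=> l; apply: le_trans (ler_norm_sum _ _ _) _.
apply: (le_trans (y := \sum_(j < n) nu n ^+ 2 * B)); last first.
  by rewrite sumr_const card_ord mulr_natl.
apply: ler_sum => j _; rewrite !mxE !normrM expr2 -mulrA; apply: ler_pM => //.
  exact: U_entry.
by rewrite mulrC; apply: ler_pM => //; exact: U_entry.
Qed.

(** Linearity in [y], written so as to exhibit the coefficients that [linE] and [quadE] require. *)
Lemma corr_sum n c0 (y : 'cV[R]_n) i : corr (U n) (lam n) k c0 y i 0 =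
  \sum_j y j 0 * corr (U n) (lam n) k c0 (unitv R j) i 0.
Proof.
have yE : y = \sum_j y j 0 *: unitv R j.
  apply/colP => j'; rewrite summxE (bigD1 j') //= big1 => [|j jj']; rewrite !mxE ?eqxx ?mulr1 ?addr0 //.
  by rewrite eq_sym (negbTE jj') mulr0.
rewrite {1}yE; apply: (big_ind2 (fun (x : 'cV[R]_n) (z : R) => corr (U n) (lam n) k c0 x i 0 = z)).
- have h := corrZ (U n) (lam n) k c0 0 0; rewrite !scale0r in h; by rewrite h mxE.
- by move=> x1 z1 x2 z2 <- <-; rewrite corrD mxE.
- by move=> j _; rewrite corrZ mxE.
Qed.

(** * The linear and quadratic forms in the noise *)

Definition offdiag n (M : 'M[R]_n) : 'cV[R]_n :=
  \col_j \sum_l \sum_(l' < n | l' != j) M j l * M l l' * U n l' k.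

Lemma offdiagE n (M : 'M[R]_n) : (forall i j, M i j = M j i) ->
  offdiag M = M *m (M *m col k (U n)) - \col_j ((\sum_l M j l ^+ 2) * U n j k).
Proof.
move=> Ms; apply/colP => j; rewrite !mxE mulr_suml -sumrB; apply: eq_bigr => l _.
rewrite !mxE mulr_sumr [X in _ = X - _](bigD1 j) //= !mxE (Ms l j) expr2.
have -> : M j l * (M j l * U n j k) = M j l * M j l * U n j k by ring.
rewrite [X in _ = X]addrC addKr; apply: eq_bigr => l' _.
by rewrite !mxE mulrA.
Qed.

Definition Lcoef n (i j l : 'I_n) : R :=
  (lam n k)^-1 * corr (U n) (lam n) k 1 (unitv R j) i 0 * U n l k.

(* The coefficients of [(E^2 u_k)_j] with the terms [E_jl E_lj] removed. *)
Definition Qcoef n (i j l j' l' : 'I_n) : R :=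
  if (l == j') && (l' != j) then
    (lam n k ^+ 2)^-1 * corr (U n) (lam n) k (3 / 2) (unitv R j) i 0 * U n l' k
  else 0.

Lemma linE_corr n (M : 'M[R]_n) :
  linE (@Lcoef n) M = (lam n k)^-1 *: corr (U n) (lam n) k 1 (M *m col k (U n)).
Proof.
apply/colP => i; rewrite mxE [RHS]mxE corr_sum mulr_sumr; apply: eq_bigr => j _.
rewrite mxE mulr_suml mulr_sumr; apply: eq_bigr => l _.
rewrite mxE /Lcoef; ring.
Qed.

Lemma quadE_corr n (M : 'M[R]_n) :
  quadE (@Qcoef n) M = (lam n k ^+ 2)^-1 *: corr (U n) (lam n) k (3 / 2) (offdiag M).
Proof.
apply/colP => i; rewrite mxE [RHS]mxE corr_sum mulr_sumr; apply: eq_bigr => j _.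
rewrite mxE mulr_suml mulr_sumr; apply: eq_bigr => l _.
rewrite (bigD1 l) //= [X in _ + X]big1 ?addr0 => [|j' jl].
  rewrite mulr_suml mulr_sumr [RHS]big_mkcond; apply: eq_bigr => l' _.
  rewrite /Qcoef eqxx /=; case: ifP => _; [ring|by rewrite !mul0r].
by apply: big1 => l' _; rewrite /Qcoef eq_sym (negbTE jl) !mul0r.
Qed.

(** Two edges that share [l] coincide only if their other ends agree. A path [j, l, l'] that does
    not return thus uses two distinct edges, and its product has mean zero. *)
Lemma upper_edge_inj n (j l l' : 'I_n) : l' != j -> upper_edge j l != upper_edge l l'.
Proof.
apply: contra; rewrite /upper_edge => /eqP h; apply/eqP; move: h.
by case: ifP => _; case: ifP => _ [] *; congruence.
Qed.

Lemma quadE_mean n (i : 'I_n) : (\int[Pr n]_w ((quadE (@Qcoef n) (E n w)) i 0)%:E = 0)%E.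
Proof.
pose X (j l j' l' : 'I_n) (w : Om n) := Qcoef i j l j' l' * (E n w j l * E n w j' l').
have HX j l j' l' : rv_integrable (Pr n) (X j l j' l') /\ expectR (Pr n) (X j l j' l') = 0.
  rewrite /X /Qcoef; case: ifP => [/andP[/eqP <- lj]|_]; last first.
    rewrite (_ : (fun w => _) = (fun=> 0)); last by apply/funext => w; rewrite mul0r.
    by split; [exact: rv_integrable_cst|rewrite expectR_cst].
  have [h1 h2] := uncorrelated (Esym n) (mE n) (@E_int n) (indE n) (upper_edge_inj l lj).
  by split; [exact: rv_integrableZ|rewrite expectRZ // h2 mulr0].
have -> : (fun w => ((quadE (@Qcoef n) (E n w)) i 0)%:E) =
    (fun w => (\sum_j \sum_l \sum_j' \sum_l' X j l j' l' w)%:E).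
  apply/funext => w; congr EFin; rewrite mxE; do 4! (apply: eq_bigr => ? _).
  by rewrite /X mulrA.
have I1 j l j' : rv_integrable (Pr n) (fun w => \sum_l' X j l j' l' w).
  by apply: rv_integrable_sum => l' _; case: (HX j l j' l').
have I2 j l : rv_integrable (Pr n) (fun w => \sum_j' \sum_l' X j l j' l' w).
  by apply: rv_integrable_sum => j' _.
have I3 j : rv_integrable (Pr n) (fun w => \sum_l \sum_j' \sum_l' X j l j' l' w).
  by apply: rv_integrable_sum => j' _.
have I4 : rv_integrable (Pr n) (fun w => \sum_j \sum_l \sum_j' \sum_l' X j l j' l' w).
  by apply: rv_integrable_sum => j' _.
rewrite integrable_expectR // expectR_sum // big1 // => j _.
rewrite expectR_sum // big1 // => l _; rewrite expectR_sum // big1 // => j' _.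
rewrite expectR_sum => [|l' _]; last by case: (HX j l j' l').
by rewrite big1 // => l' _; case: (HX j l j' l').
Qed.

(** * Bounds without logarithm at a fixed entry *)

Definition second_bounds m n (i : 'I_n) (w : Om n) :=
  let a := (C + 1) * sr n in
  [/\ `|(E n w *m col k (U n)) i 0| <= m * (nu n * a),
      `|(E n w *m (E n w *m col k (U n))) i 0| <= m * (nu n * a ^+ 2),
      forall l, dot (E n w *m col l (U n)) (E n w *m col l (U n)) <= m * (n%:R * (nu n * a) ^+ 2),
      \sum_j \sum_j' E n w j j' ^+ 2 <= m * (n%:R * a ^+ 2) &
      \sum_j E n w i j ^+ 2 <= m * a ^+ 2 /\
      forall l l', `|dot (col l (U n)) (E n w *m col l' (U n))| <= m * (Num.sqrt n%:R * nu n ^+ 2 * a)].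

(** [m + 1] serves as a rational substitute for [sqrt m]. *)
Lemma norm_le_of_sqr (x m b : R) : 0 <= m -> 0 <= b -> x ^+ 2 <= m * b ^+ 2 -> `|x| <= (m + 1) * b.
Proof.
move=> m0 b0 h; have mb : 0 <= (m + 1) * b by rewrite mulr_ge0 // addr_ge0.
rewrite -(ger0_norm mb) -ler_sqr ?nnegrE // !real_normK ?num_real //.
apply: le_trans h _; rewrite exprMn ler_wpM2r ?sqr_ge0 //.
have -> : (m + 1) ^+ 2 = m + (m ^+ 2 + m + 1) by ring.
by rewrite lerDl !addr_ge0 // sqr_ge0.
Qed.

Lemma second_bounds_event (e : R) : 0 < e -> exists2 m, 0 <= m & for_large (fun n => forall i : 'I_n,
  exists G : set (Om n), [/\ measurable G, ((1 - e)%:E <= Pr n G)%E & forall w, G w -> second_bounds m i w]).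
Proof.
move=> e0; pose M := second_moment_const R d / e.
have M0 : 0 <= M by rewrite divr_ge0 ?(ltW e0) // /second_moment_const ler0n.
exists (M + 1); first by rewrite addr_ge0.
apply: for_large_imp (for_large_and (for_large_and (for_large_ge N0) (for_large_ge 1)) (for_large_and (for_large_ln (1 : R)) (moment_range 1))) _.
move=> n [[nN n0] [l1 mr]] i.
have npos : (0 : R) < n%:R by rewrite ltr0n.
have q1 := qn_ge1 n0.
have a0 : 0 < (C + 1) * sr n by rewrite mulr_gt0 ?sr_gt0 // addr_gt0.
have nu0 := nu_gt0 n0.
have Em' i' j m : (3 <= m)%N -> (m <= 2 * 4)%N ->
  (\int[Pr n]_w (`|E n w i' j| ^+ m)%:E
     <= (C ^+ m * powR (n%:R * rho n) (m%:R / 2) / (n%:R * qn n ^+ (m - 2)))%:E)%E.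
  (* [moment_range 1] at [t = 1] gives the order [8 = 2 * 4]. *)
  move=> m3 mL; apply: Em => //; apply: le_trans (mr 1%N _); first by rewrite ler_nat.
  by rewrite expn1 -[leLHS]mulr1 ler_wpM2l.
have mom i' j m := @entry_moment _ _ _ (Pr n) n (rho n) (qn n) C (fun w => E n w i' j) 4 n0
  (rho0 n) q1 C0 (E2 n i' j) (Em' i' j) m.
have [G [mG PG HG]] := second_event n0 (Esym n) (mE n) (@E_int n) (indE n) a0 mom nu0
  (fun i l => U_entry l i nN) k i e0.
exists G; split => // w /HG; rewrite -/M => -[h1 h2 h3 h4 [h5 h6]].
have Ml : M <= M + 1 by rewrite lerDl.
have nua : 0 <= nu n * ((C + 1) * sr n) by rewrite mulr_ge0 // ltW.
split.
- exact: norm_le_of_sqr.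
- by apply: norm_le_of_sqr => //; rewrite mulr_ge0 ?sqr_ge0 // ltW.
- by move=> l; apply: le_trans (h3 l) _; rewrite ler_wpM2r // mulr_ge0 ?sqr_ge0 // ltW.
- by apply: le_trans h4 _; rewrite ler_wpM2r // mulr_ge0 ?sqr_ge0 // ltW.
- split; first by apply: le_trans h5 _; rewrite ler_wpM2r // sqr_ge0.
  move=> l l'; apply: norm_le_of_sqr => //.
    by rewrite mulr_ge0 ?(ltW a0) // mulr_ge0 ?sqr_ge0 // sqrtr_ge0.
  apply: le_trans (h6 l l') _; rewrite le_eqVlt; apply/orP; left; apply/eqP.
  by rewrite -{1}(sqr_sqrtr (ltW npos)); ring.
Qed.

Lemma sqrt_nu n : (0 < n)%N -> Num.sqrt (n%:R : R) * nu n = kap.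
Proof. by move=> n0; rewrite mulrC divfK // gt_eqF // sqrtr_gt0 ltr0n. Qed.

Lemma nu_le_kap n : (0 < n)%N -> nu n <= kap.
Proof.
move=> n0; rewrite -(sqrt_nu n0) ler_peMl ?(ltW (nu_gt0 n0)) //.
by rewrite -[leLHS]sqrtr1 ler_wsqrtr // ler1n.
Qed.

Lemma lam_inv_le n : (N0 <= n)%N -> (0 < n)%N -> `|(lam n k)^-1| <= (Dl n)^-1.
Proof.
move=> nN n0; have D0 := Dl_gt0 nN n0.
rewrite normfV lef_pV2 ?posrE //; first exact: Dl_lam.
exact: lt_le_trans D0 (Dl_lam n k).
Qed.

(** The projections of [E u_k] are bilinear forms of size [sqrt n nu^2 a]; multiplied by an entry of
    [U] they stay, up to a constant, below the size [nu a] of an entry of [E u_k]. *)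
Lemma psi_bound m n (i : 'I_n) (w : Om n) : 0 <= m -> (N0 <= n)%N -> second_bounds m i w ->
  `|linE (@Lcoef n) (E n w) i 0| <=
  m * (1 + corr_const * kap ^+ 2) * (C + 1) * kap * (Num.sqrt (rho n) / Dl n).
Proof.
move=> m0 nN [h1 _ _ _ [_ h6]]; have n0 : (0 < n)%N by apply: leq_ltn_trans (ltn_ord i).
have c1 : 0 <= (1 : R) <= 3 / 2 by lra.
have a0 : 0 <= (C + 1) * sr n by rewrite mulr_ge0 ?(ltW (sr_gt0 n0)) // addr_ge0 // ltW.
rewrite linE_corr mxE normrM.
have h := corr_bound nN c1 h1 (fun l => h6 l k).
have cb : `|corr (U n) (lam n) k 1 (E n w *m col k (U n)) i 0| <=
    m * (1 + corr_const * kap ^+ 2) * (nu n * ((C + 1) * sr n)).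
  apply: le_trans h _.
  set X := nu n * ((C + 1) * sr n).
  have -> : m * (1 + corr_const * kap ^+ 2) * X = m * X + corr_const * (m * (kap ^+ 2 * X)) by ring.
  rewrite lerD2l; apply: ler_wpM2l; first exact: corr_const_ge0.
  rewrite mulrCA; apply: ler_wpM2l => //.
  have -> : nu n * (Num.sqrt n%:R * nu n ^+ 2 * ((C + 1) * sr n)) =
    (Num.sqrt n%:R * nu n) * nu n * X by rewrite /X; ring.
  rewrite (sqrt_nu n0) expr2; apply: ler_wpM2r; first by rewrite mulr_ge0 // ltW // nu_gt0.
  by apply: ler_wpM2l; [exact: ltW kap_gt0|exact: nu_le_kap].
apply: le_trans (ler_pM _ _ (lam_inv_le nN n0) cb) _ => //.
rewrite le_eqVlt; apply/orP; left; apply/eqP.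
have -> : sr n = Num.sqrt n%:R * Num.sqrt (rho n) by rewrite /sr sqrtrM.
have -> : nu n * ((C + 1) * (Num.sqrt n%:R * Num.sqrt (rho n))) =
  (C + 1) * (Num.sqrt n%:R * nu n) * Num.sqrt (rho n) by ring.
by rewrite (sqrt_nu n0); ring.
Qed.

Lemma lam_inv2_le n : (N0 <= n)%N -> (0 < n)%N -> `|(lam n k ^+ 2)^-1| <= (Dl n ^+ 2)^-1.
Proof.
move=> nN n0; rewrite -!exprVn normrX; apply: lerXn2r; rewrite ?nnegrE //.
  by rewrite invr_ge0 ltW // Dl_gt0.
exact: lam_inv_le.
Qed.

(** The projections are [<E u_l, E u_k>] minus a weighted sum of the squared entries of [E], so
    bounds on the norms [|E u_l|] and on that sum suffice. The operator norm would cost a logarithm,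
    which the quadratic term cannot afford. *)
Lemma offdiag_bound m n (i : 'I_n) (w : Om n) : 0 <= m -> (N0 <= n)%N -> second_bounds m i w ->
  `|corr (U n) (lam n) k (3 / 2) (offdiag (E n w)) i 0| <=
  m * (2 + 2 * corr_const * kap ^+ 2) * (nu n * ((C + 1) * sr n) ^+ 2).
Proof.
move=> m0 nN [h1 h2 h3 h4 [h5 _]]; have n0 : (0 < n)%N by apply: leq_ltn_trans (ltn_ord i).
have nu0 := ltW (nu_gt0 n0).
have a0 : 0 <= (C + 1) * sr n by rewrite mulr_ge0 ?(ltW (sr_gt0 n0)) // addr_ge0 // ltW.
move: a0 h1 h2 h3 h4 h5; set a := (C + 1) * sr n => a0 h1 h2 h3 h4 h5.
have c1 : 0 <= (3 / 2 : R) <= 3 / 2 by lra.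
have b1 : `|offdiag (E n w) i 0| <= 2 * m * (nu n * a ^+ 2).
  rewrite offdiagE; last exact: Esym.
  rewrite mxE; apply: le_trans (ler_normD _ _) _; rewrite -mulrA mulrDl mul1r; apply: lerD => //.
  rewrite !mxE normrN normrM mulrC mulrCA; apply: ler_pM => //; first exact: U_entry.
  by rewrite ger0_norm //; apply: sumr_ge0 => j _; exact: sqr_ge0.
have b2 l : `|dot (col l (U n)) (offdiag (E n w))| <= 2 * m * (kap ^+ 2 * a ^+ 2).
  rewrite offdiagE; last exact: Esym.
  rewrite dotBr -mulrA; apply: le_trans (ler_normB _ _) _; rewrite mulrDl mul1r; apply: lerD.
    have Et : (E n w)^T = E n w by apply/matrixP => x y; rewrite mxE Esym.
    rewrite dot_mulmx Et.
    pose b := Num.sqrt m * (Num.sqrt n%:R * (nu n * a)).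
    have b0 : 0 <= b := mulr_ge0 (sqrtr_ge0 _) (mulr_ge0 (sqrtr_ge0 _) (mulr_ge0 nu0 a0)).
    have hb l' : dot (E n w *m col l' (U n)) (E n w *m col l' (U n)) <= b ^+ 2.
      by rewrite /b exprMn sqr_sqrtr // exprMn sqr_sqrtr.
    apply: le_trans (dot_le b0 b0 (hb l) (hb k)) _.
    rewrite -expr2 /b exprMn sqr_sqrtr // exprMn sqr_sqrtr // -(nu_sqr n0) le_eqVlt.
    by apply/orP; left; apply/eqP; ring.
  apply: le_trans (ler_norm_sum _ _ _) _.
  apply: (le_trans (y := nu n ^+ 2 * \sum_j \sum_j' E n w j j' ^+ 2)).
    rewrite mulr_sumr; apply: ler_sum => j _; rewrite !mxE !normrM.
    rewrite mulrCA mulrC expr2; apply: ler_pM => //.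
      by apply: ler_pM => //; exact: U_entry.
    by rewrite ger0_norm //; apply: sumr_ge0 => j' _; exact: sqr_ge0.
  apply: le_trans (ler_wpM2l (sqr_ge0 _) h4) _; rewrite -(nu_sqr n0) le_eqVlt.
  by apply/orP; left; apply/eqP; ring.
apply: le_trans (corr_bound nN c1 b1 b2) _; rewrite le_eqVlt.
by apply/orP; left; apply/eqP; ring.
Qed.

Lemma quad_bound m n (i : 'I_n) (w : Om n) : 0 <= m -> (N0 <= n)%N -> second_bounds m i w ->
  `|quadE (@Qcoef n) (E n w) i 0| <=
  m * (2 + 2 * corr_const * kap ^+ 2) * (C + 1) ^+ 2 * kap * (Num.sqrt n%:R * rho n / Dl n ^+ 2).
Proof.
move=> m0 nN h; have n0 : (0 < n)%N by apply: leq_ltn_trans (ltn_ord i).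
have npos : (0 : R) < n%:R by rewrite ltr0n.
rewrite quadE_corr mxE normrM.
apply: le_trans (ler_pM _ _ (lam_inv2_le nN n0) (offdiag_bound m0 nN h)) _ => //.
rewrite le_eqVlt; apply/orP; left; apply/eqP.
have -> : nu n * ((C + 1) * sr n) ^+ 2 = (C + 1) ^+ 2 * (nu n * (n%:R * rho n)).
  by rewrite -sr_sqr; ring.
have -> : nu n * (n%:R * rho n) = kap * (Num.sqrt n%:R * rho n).
  by rewrite -(sqrt_nu n0) -{1}(sqr_sqrtr (ltW npos)); ring.
by ring.
Qed.

Lemma sg_perturb (x y : R) : `|y| < `|x| -> Num.sg (x - y) = Num.sg x.
Proof.
move=> h; have [x0|x0|x0] := ltrgtP x 0.
- by rewrite (ltr0_norm x0) ltr_norml in h; rewrite (ltr0_sg x0) ltr0_sg //; lra.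
- by rewrite (gtr0_norm x0) ltr_norml in h; rewrite (gtr0_sg x0) gtr0_sg //; lra.
- by rewrite x0 normr0 normr_lt0 in h.
Qed.

Lemma Bn_nu n : (0 < n)%N ->
  Bn n / Dl n ^+ 2 * nu n = (C + 1) * kap * (Num.sqrt n%:R * rho n / Dl n ^+ 2).
Proof.
move=> n0; have npos : (0 : R) <= n%:R by [].
rewrite -(sqrt_nu n0) /Bn -{1}(sqr_sqrtr npos); ring.
Qed.

Lemma bk_bound n (i : 'I_n) : (N0 <= n)%N ->
  `|bk n i 0| <= (1 + corr_const * kap ^+ 2) * (Bn n / Dl n ^+ 2 * nu n).
Proof.
move=> nN; have n0 : (0 < n)%N by apply: leq_ltn_trans (ltn_ord i).
have c1 : 0 <= (3 / 2 : R) <= 3 / 2 by lra.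
have sB j : `|\sum_j' @sig2 n j j'| <= Bn n.
  rewrite ger0_norm; last by apply: sumr_ge0 => j' _; case/andP: (sig2_bound j j').
  apply: (le_trans (y := \sum_(j' < n) C * rho n)).
    by apply: ler_sum => j' _; case/andP: (sig2_bound j j').
  rewrite sumr_const card_ord -[leLHS]mulr_natl mulrCA /Bn; apply: ler_wpM2r; last by rewrite lerDl.
  by rewrite mulr_ge0 // ltW.
rewrite /bk bias_formulaE mxE normrM.
have -> : Dn n *m col k (U n) = \col_j ((\sum_j' sig2 j j') * U n j k).
  by apply/colP => j; rewrite /Dn /Dof diag_mx_colE !mxE.
apply: le_trans (ler_pM _ _ (lam_inv2_le nN n0) (corr_diag_bound i nN c1 sB)) _ => //.
by rewrite le_eqVlt; apply/orP; left; apply/eqP; ring.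
Qed.

Lemma sgn_norm n (w : Om n) l : `|sgn w l| = 1.
Proof. by rewrite /sgn normrX normrN normr1 expr1n. Qed.

(** The overlap of [u_k] with [uhat] is at least [1 / 2], whereas subtracting [bhat] changes it by
    at most [K4 * rr n ^+ 2], which tends to [0]; the correction cannot flip the sign. *)
Lemma sgn_corrected K1 : 0 < K1 -> for_large (fun n => forall w : Om n, good_noise K1 Npow w ->
  Num.sg (((col k (U n))^T *m (uhat w k - bhat w)) 0 0) = sgn w k).
Proof.
move=> K10; have [K K0 HK] := bias_large K10.
pose K3 := K + (1 + corr_const * kap ^+ 2).
have K30 : 0 <= K3.
  by rewrite !addr_ge0 // mulr_ge0 ?corr_const_ge0 // exprn_ge0 // ltW // kap_gt0.
pose K4 := K3 * kap ^+ 2 * (C + 1).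
have K40 : 0 <= K4.
  exact: (mulr_ge0 (mulr_ge0 K30 (sqr_ge0 _)) (addr_ge0 (ltW C0) ler01)).
have e0 : 0 < (4 * (K4 + 1))^-1 by rewrite invr_gt0 mulr_gt0 // ltr_wpDl.
apply: for_large_imp (for_large_and (for_large_and (for_large_ge N0) (for_large_ge 1)) (for_large_and (sgn_large K10)
  (for_large_and HK (for_large_and (eta_small K10 ltr01) (for_large_and (rr_ln_small 0 e0) (for_large_ln (0 : R))))))) _.
move=> n [[nN n0] [hs [hb [he [hr l0]]]]] w Gw; have hw := hs w Gw.
rewrite dotE dotBr sg_perturb ?sgn_sg //; apply: lt_le_trans hw.
have B0 : 0 <= Bn n / Dl n ^+ 2 * nu n.
  rewrite mulr_ge0 ?(ltW (nu_gt0 n0)) // divr_ge0 ?sqr_ge0 //.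
  by rewrite /Bn mulr_ge0 ?addr_ge0 ?(ltW C0) // mulr_ge0 // ltW.
have [et0 _ _ _] := eta_conditions K10 nN n0 l0.
have bi i : `|bhat w i 0| <= K3 * (Bn n / Dl n ^+ 2 * nu n).
  have -> : `|bhat w i 0| = `|(sgn w k *: bhat w - bk n) i 0 + bk n i 0|.
    have split_scale s (a b : 'cV[R]_n) : (s *: a - b) i 0 + b i 0 = s * a i 0.
      by rewrite !mxE addrNK.
    by rewrite split_scale normrM sgn_norm mul1r.
  apply: le_trans (ler_normD _ _) _; rewrite mulrDl; apply: lerD; last exact: bk_bound.
  apply: le_trans (hb w Gw i) _; apply: ler_wpM2l => //.
  by rewrite -[leRHS]mulr1; apply: ler_wpM2l.
have h1 : `|dot (col k (U n)) (bhat w)| <= K4 * rr n ^+ 2.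
  apply: le_trans (ler_norm_sum _ _ _) _.
  apply: (le_trans (y := \sum_(i < n) nu n * (K3 * (Bn n / Dl n ^+ 2 * nu n)))).
    by apply: ler_sum => i _; rewrite normrM mxE; apply: ler_pM => //; exact: U_entry.
  rewrite sumr_const card_ord -[leLHS]mulr_natl le_eqVlt; apply/orP; left; apply/eqP.
  have -> : rr n ^+ 2 = n%:R * rho n / Dl n ^+ 2 by rewrite /rr expr_div_n sr_sqr.
  by rewrite /K4 -(nu_sqr n0) /Bn; ring.
have r0 := ltW (rr_gt0 nN n0).
rewrite expr0 mulr1 in hr; apply: le_lt_trans h1 _.
move: hr r0; set r := rr n => hr r0.
have K1' : 0 < 4 * (K4 + 1) by rewrite -invr_gt0.
have hr' : r * (4 * (K4 + 1)) <= 1 by rewrite -ler_pdivlMr // div1r.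
have r1 : r <= 1.
  by apply: le_trans hr _; rewrite invf_le1 //; lra.
have h3 : K4 * r ^+ 2 <= K4 * r.
  by rewrite ler_wpM2l // expr2 -[leRHS]mulr1 ler_wpM2l.
have h4 : r * (4 * (K4 + 1)) = 4 * (K4 * r) + 4 * r by ring.
lra.
Qed.

(** Size of [<u_l, E u_l'>] in units of [Dl]. It is of order [rr / sqrt n], against [rr ln n] for
    what the operator norm would give. *)
Definition gam m n : R := m * (Num.sqrt n%:R * nu n ^+ 2 * ((C + 1) * sr n)) / Dl n.

Lemma gam_large m K1 : 0 <= m -> 0 < K1 -> for_large (fun n => 0 <= gam m n /\ gam m n <= tau K1 n / Dl n).
Proof.
move=> m0 K10; have kp := kap_gt0.
apply: for_large_imp (for_large_and (for_large_and (for_large_ge N0) (for_large_ge 1)) (for_large_ln (m * (C + 1) * kap ^+ 2 / K1))) _.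
move=> n [[nN n0] hl]; have D0 := Dl_gt0 nN n0.
have s0 := sr_gt0 n0; have nu0 := nu_gt0 n0.
split.
  rewrite divr_ge0 ?(ltW D0) // mulr_ge0 // mulr_ge0 //.
    by rewrite mulr_ge0 ?sqrtr_ge0 // sqr_ge0.
  by rewrite mulr_ge0 ?(ltW s0) // addr_ge0 // ltW.
rewrite ler_wpM2r ?invr_ge0 ?(ltW D0) //.
rewrite /tau ler_pdivrMr // in hl *.
have -> : m * (Num.sqrt n%:R * nu n ^+ 2 * ((C + 1) * sr n)) =
   sr n * (m * (C + 1) * (Num.sqrt n%:R * nu n * nu n)) by ring.
have -> : K1 * (sr n * ln n%:R) = sr n * (ln n%:R * K1) by ring.
apply: ler_wpM2l; first exact: ltW.
apply: le_trans hl; rewrite (sqrt_nu n0) expr2; apply: ler_wpM2l.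
  by rewrite mulr_ge0 // addr_ge0 // ltW.
by apply: ler_wpM2l; [exact: ltW|exact: nu_le_kap].
Qed.

Definition remainder n (w : Om n) : 'cV[R]_n :=
  Num.sg (((col k (U n))^T *m (uhat w k - bhat w)) 0 0) *: (uhat w k - bhat w)
  - col k (U n) - linE (@Lcoef n) (E n w) - quadE (@Qcoef n) (E n w).

(** Three errors add up: that of the second-order expansion, the fluctuation of the diagonal of
    [E^2] about [D], and that of the estimated bias. Relative to the target scale they are bounded
    by multiples of [ln n / q_n], [rr (ln n) ^ 3] and [eta], which all tend to [0]. *)
Lemma remainder_bound K1 m (e : R) : 0 < K1 -> 0 <= m -> 0 < e ->
  for_large (fun n => forall (i : 'I_n) (w : Om n), good_noise K1 Npow w -> second_bounds m i w ->
    `|remainder w i 0| <= e * (Num.sqrt n%:R * rho n / Dl n ^+ 2)).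
Proof.
move=> K10 m0 e0; have kp := kap_gt0; have kp0 := ltW kp; have W0 := corr_const_ge0.
have Cp : 0 <= C + 1 by rewrite addr_ge0 // ltW.
pose S n (w : Om n) := [/\ regime K1 w, 0 <= gam m n /\ gam m n <= tau K1 n / Dl n &
  forall l l', `|dot (col l (U n)) (E n w *m col l' (U n))| <= gam m n * Dl n].
have [Ks Ks0 HKs] := @conf_second_order K1 S (fun n w h => let: And3 a _ _ := h in a) (gam m)
  (fun n w h => let: And3 _ b _ := h in b) (fun n w h => let: And3 _ _ c := h in c).
have [Kb Kb0 HKb] := bias_large K10.
pose W1 := 1 + corr_const * kap ^+ 2.
have W10 : 0 <= W1 by rewrite addr_ge0 // mulr_ge0 // sqr_ge0.
pose K := Ks * (K1 * m * (C + 1) * kap ^+ 3 + K1 ^+ 3 * kap) + W1 * (K1 * kap) + Kb * ((C + 1) * kap).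
have K0 : 0 <= K.
  have k1 := ltW K10; have k3 : 0 <= kap ^+ 3 by exact: exprn_ge0.
  have k13 : 0 <= K1 ^+ 3 by exact: exprn_ge0.
  exact: (addr_ge0 (addr_ge0 (mulr_ge0 Ks0 (addr_ge0 (mulr_ge0 (mulr_ge0 (mulr_ge0 k1 m0) Cp) k3)
    (mulr_ge0 k13 kp0))) (mulr_ge0 W10 (mulr_ge0 k1 kp0))) (mulr_ge0 Kb0 (mulr_ge0 Cp kp0))).
have e1 : 0 < e / (K + 1) by rewrite divr_gt0 // ltr_wpDl.
apply: for_large_imp (for_large_and (for_large_and (for_large_ge N0) (for_large_ge 1)) (for_large_and (for_large_and (regime_large K10)
  (for_large_and (sgn_corrected K10) (for_large_and HKb (gam_large m0 K10))))
  (for_large_and (for_large_and (for_large_ln (0 : R)) (rr_ln_small 3 e1)) (for_large_and (ln_qn_small e1) (eta_small K10 e1))))) _.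
move=> n [[nN n0] [[hb [hsg [hB hg]]] [[l0 hr] [hq he]]]] i w Gw Sw.
have bw := hb w Gw; have D0 := Dl_gt0 nN n0; have nu0 := ltW (nu_gt0 n0).
have c1 : 0 <= (3 / 2 : R) <= 3 / 2 by lra.
have npos : (0 : R) < n%:R by rewrite ltr0n.
have sn0 : 0 < Num.sqrt (n%:R : R) by rewrite sqrtr_gt0.
have SS : S n w.
  split => // l l'; rewrite /gam divfK ?gt_eqF //; by case: Sw => _ _ _ _ [].
have A1 := HKs n w i SS.
have A3 := hB w Gw i.
have A2 : `|(lam n k ^+ 2)^-1 * corr (U n) (lam n) k (3 / 2)
    (\col_j ((\sum_l E n w j l ^+ 2 - \sum_l sig2 j l) * U n j k)) i 0|
    <= (Dl n ^+ 2)^-1 * (W1 * (K1 * (n%:R * rho n / qn n * ln n%:R) * nu n)).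
  rewrite normrM; apply: ler_pM => //; first exact: lam_inv2_le.
  apply: corr_diag_bound => // j; by case: Gw => _ _.
set g := Num.sqrt n%:R * rho n / Dl n ^+ 2.
have g0 : 0 <= g by rewrite divr_ge0 ?sqr_ge0 // mulr_ge0 ?(ltW sn0) // ltW.
set eps1 := e / (K + 1) in e1 hr hq he.
have B1 : tau K1 n / Dl n * gam m n * nu n <= K1 * m * (C + 1) * kap ^+ 3 * (g * eps1).
  have -> : tau K1 n / Dl n * gam m n * nu n =
      K1 * m * (C + 1) * kap ^+ 3 * (g * (ln n%:R * (Num.sqrt n%:R)^-1)).
    rewrite /gam /tau /g -(sqrt_nu n0).
    have -> : K1 * (sr n * ln n%:R) / Dl n *
      (m * (Num.sqrt n%:R * nu n ^+ 2 * ((C + 1) * sr n)) / Dl n) * nu n =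
      K1 * ln n%:R / Dl n * (m * (Num.sqrt n%:R * nu n ^+ 2 * (C + 1)) / Dl n) * nu n * sr n ^+ 2 by ring.
    rewrite sr_sqr -[X in X * rho n](sqr_sqrtr (ltW npos)); field.
    by rewrite !gt_eqF.
  apply: ler_wpM2l; first exact: (mulr_ge0 (mulr_ge0 (mulr_ge0 (ltW K10) m0) Cp) (exprn_ge0 3 kp0)).
  apply: ler_wpM2l => //; apply: le_trans hq; apply: ler_wpM2l => //; exact: inv_sqrt_le.
have B2 : (tau K1 n / Dl n) ^+ 3 * nu n <= K1 ^+ 3 * kap * (g * eps1).
  have -> : (tau K1 n / Dl n) ^+ 3 * nu n = K1 ^+ 3 * kap * (g * (rr n * ln n%:R ^+ 3)).
    rewrite tau_Dl /g -(sqrt_nu n0).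
    have -> : (K1 * (rr n * ln n%:R)) ^+ 3 * nu n = K1 ^+ 3 * rr n * ln n%:R ^+ 3 * nu n * rr n ^+ 2 by ring.
    have -> : rr n ^+ 2 = n%:R * rho n / Dl n ^+ 2 by rewrite /rr expr_div_n sr_sqr.
    rewrite -[X in X * rho n](sqr_sqrtr (ltW npos)); ring.
  apply: ler_wpM2l; first exact: (mulr_ge0 (exprn_ge0 3 (ltW K10)) kp0).
  exact: ler_wpM2l.
have B3 : (Dl n ^+ 2)^-1 * (W1 * (K1 * (n%:R * rho n / qn n * ln n%:R) * nu n)) <=
    W1 * (K1 * kap) * (g * eps1).
  have -> : (Dl n ^+ 2)^-1 * (W1 * (K1 * (n%:R * rho n / qn n * ln n%:R) * nu n)) =
      W1 * (K1 * kap) * (g * (ln n%:R / qn n)).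
    rewrite /g -(sqrt_nu n0) -[X in X * rho n](sqr_sqrtr (ltW npos)); ring.
  apply: ler_wpM2l; first exact: (mulr_ge0 W10 (mulr_ge0 (ltW K10) kp0)).
  exact: ler_wpM2l.
have B4 : Bn n / Dl n ^+ 2 * nu n * eta K1 n <= (C + 1) * kap * (g * eps1).
  rewrite (Bn_nu n0) -mulrA; apply: ler_wpM2l; first by rewrite mulr_ge0.
  exact: ler_wpM2l.
(* The expansion contains all of [E^2], the quadratic form only its off-diagonal part. The diagonal
   part minus its mean is the second summand; the mean itself gives [bk], which the third summand
   compares with the estimated bias. *)
have tE : remainder w i 0 =
  (sgn w k *: uhat w k - col k (U n)
     - (lam n k)^-1 *: corr (U n) (lam n) k 1 (E n w *m col k (U n))
     - (lam n k ^+ 2)^-1 *: corr (U n) (lam n) k (3 / 2) (E n w *m (E n w *m col k (U n)))) i 0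
  + (lam n k ^+ 2)^-1 * corr (U n) (lam n) k (3 / 2)
    (\col_j ((\sum_l E n w j l ^+ 2 - \sum_l sig2 j l) * U n j k)) i 0
  - (sgn w k *: bhat w - bk n) i 0.
  rewrite /remainder hsg // linE_corr quadE_corr offdiagE; last exact: Esym.
  rewrite /bk bias_formulaE.
  have -> : Dn n *m col k (U n) = \col_j ((\sum_j' sig2 j j') * U n j k).
    by apply/colP => j; rewrite /Dn /Dof diag_mx_colE !mxE.
  set x := E n w *m (E n w *m _); set y := \col_j _; set v := \col_j _; set z := \col_j _.
  have -> : v = y - z by apply/colP => j; rewrite !mxE mulrBl.
  have cB a b : corr (U n) (lam n) k (3 / 2) (a - b) =
      corr (U n) (lam n) k (3 / 2) a - corr (U n) (lam n) k (3 / 2) b.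
    by rewrite corrD -scaleN1r corrZ scaleN1r.
  rewrite !cB; move: (corr _ _ _ _ x) (corr _ _ _ _ y) (corr _ _ _ _ z) => cx cy cz.
  by rewrite !mxE; ring.
rewrite tE; apply: le_trans (ler_normB _ _) _; apply: (le_trans (lerD (ler_normD _ _) (lexx _))).
apply: le_trans (lerD (lerD A1 A2) A3) _.
apply: (le_trans (y := K * (g * eps1))).
  have -> : K * (g * eps1) = Ks * (K1 * m * (C + 1) * kap ^+ 3 * (g * eps1) + K1 ^+ 3 * kap * (g * eps1))
      + W1 * (K1 * kap) * (g * eps1) + Kb * ((C + 1) * kap * (g * eps1)) by rewrite /K; ring.
  apply: lerD; last exact: ler_wpM2l.
  apply: lerD => //; apply: ler_wpM2l => //.
  have sum_nu (x y z : R) : (x + y) * z = x * z + y * z by ring.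
  by rewrite sum_nu; apply: lerD.
rewrite mulrCA [leRHS]mulrC; apply: ler_wpM2l => //.
rewrite /eps1 mulrCA -[leRHS]mulr1; apply: ler_wpM2l; first exact: ltW.
by rewrite ler_pdivrMr ?mul1r ?lerDl // ltr_wpDl.
Qed.

(** * From events to bounds in probability *)

Lemma prob_setC_le n (G : set (Om n)) (e : R) : measurable G ->
  ((1 - e)%:E <= Pr n G)%E -> (Pr n (~` G) <= e%:E)%E.
Proof.
move=> mG PG; rewrite probability_setC //.
have fG : Pr n G \is a fin_num by apply: fin_num_measure.
move: PG; rewrite -(fineK fG) -EFinB !lee_fin => h; lra.
Qed.

Lemma prob_gt_le n (X : Om n -> R) (G : set (Om n)) (b e : R) : measurable_fun setT X ->
  measurable G -> ((1 - e)%:E <= Pr n G)%E -> (forall w, G w -> X w <= b) ->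
  (Pr n [set w | (b < X w)%R] <= e%:E)%E.
Proof.
move=> mX mG PG H; apply: le_trans (prob_setC_le mG PG).
apply: le_measure; rewrite ?inE; [exact: measurable_gt_set|exact: measurableC|].
by move=> w /= h1 /H; rewrite leNgt h1.
Qed.

Lemma prob_setI_ge n (G1 G2 : set (Om n)) (e1 e2 : R) : measurable G1 -> measurable G2 ->
  ((1 - e1)%:E <= Pr n G1)%E -> ((1 - e2)%:E <= Pr n G2)%E ->
  ((1 - (e1 + e2))%:E <= Pr n (G1 `&` G2))%E.
Proof.
move=> m1 m2 P1 P2; have mI := measurableI _ _ m1 m2.
have h : (Pr n (~` (G1 `&` G2)) <= (e1 + e2)%:E)%E.
  rewrite setCI; apply: le_trans (measureU2 _ _ _) _; try exact: measurableC.
  by rewrite EFinD; apply: leeD; apply: prob_setC_le.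
have fI : Pr n (G1 `&` G2) \is a fin_num by apply: fin_num_measure.
rewrite probability_setC // in h; move: h.
rewrite -(fineK fI) -EFinB !lee_fin => h; lra.
Qed.

Lemma coordnE n (v : 'cV[R]_n) (i : nat) (h : (i < n)%N) : coordn v i = v (Ordinal h) 0.
Proof. by rewrite /coordn (big_pred1 (Ordinal h)). Qed.

Lemma measurable_mx_linE n (L : 'I_n -> 'I_n -> 'I_n -> R) : measurable_mx (fun w => linE L (E n w)).
Proof.
move=> i j; under eq_fun do rewrite mxE.
apply: measurable_fun_sumr => j1; apply: measurable_fun_sumr => j2.
apply: measurable_funM; [exact: measurable_cst|exact: mE].
Qed.

Lemma measurable_mx_quadE n (Q : 'I_n -> 'I_n -> 'I_n -> 'I_n -> 'I_n -> R) : measurable_mx (fun w => quadE Q (E n w)).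
Proof.
move=> i j; under eq_fun do rewrite mxE.
do 4! (apply: measurable_fun_sumr => ?).
apply: measurable_funM; last exact: mE.
apply: measurable_funM; [exact: measurable_cst|exact: mE].
Qed.

Lemma OP_coord (v : forall n, Om n -> 'cV[R]_n) (Y : nat -> R) (i : nat) :
  (forall n, measurable_mx (v n)) ->
  (forall m, 0 <= m -> exists M, for_large (fun n => forall (i : 'I_n) w, second_bounds m i w ->
     `|v n w i 0| <= M * Y n)) ->
  OP Pr (fun n w => coordn (v n w) i) Y.
Proof.
move=> mv H e e0; have [m m0 HS] := second_bounds_event e0; have [M HM] := H m m0.
(* From size [i.+1] on, [coordn] is a genuine entry and not its default value. *)
exists M; have [N HN] := for_large_and (for_large_ge i.+1) (for_large_and HS HM); exists N => n /HN[hi [hs hm]].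
have [G [mG PG GG]] := hs (Ordinal hi); apply: prob_gt_le mG PG _.
  by apply: measurableT_comp => //; exact: measurable_coordn.
by move=> w /GG h; rewrite coordnE; exact: hm h.
Qed.

Theorem corrected_second_order_bias :
  second_order_bias_is Pr E (fun n => col k (U n)) (fun n w => uhat w k - bhat w) rho Dl
    (fun n => 0).
Proof.
exists Lcoef, Qcoef => psi qq t; split.
- move=> i; apply: OP_coord => [n|m m0]; first exact: measurable_mx_linE.
  exists (m * (1 + corr_const * kap ^+ 2) * (C + 1) * kap).
  by exists N0 => n nN j w; exact: psi_bound.
- move=> i; apply: OP_coord => [n|m m0]; first exact: measurable_mx_quadE.
  exists (m * (2 + 2 * corr_const * kap ^+ 2) * (C + 1) ^+ 2 * kap).
  by exists N0 => n nN j w; exact: quad_bound.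
- move=> i dl dl0 e e0; have e2 : 0 < e / 2 by rewrite divr_gt0.
  (* Half of [e] goes to each event. With exponent [1] the first one fails with probability at most
     [1 / n], which is below [e / 2] for large [n]. *)
  have [K1 K10 HG] := G_event ltr01 (leq_trans (isT : 0 < 3)%N Npow_ge3).
  have [m m0 HS] := second_bounds_event e2.
  have [N HN] := for_large_and (for_large_and (for_large_ge i.+1) (for_large_and (for_large_ge 1) (for_large_natr (e / 2)^-1)))
    (for_large_and (for_large_and HG HS) (remainder_bound K10 m0 dl0)).
  exists N => n /HN[[hi [n0 ne]] [[hg hs] hr]].
  have [G1 [mG1 PG1 GG1]] := hg; have [G2 [mG2 PG2 GG2]] := hs (Ordinal hi).
  have PG1' : ((1 - e / 2)%:E <= Pr n G1)%E.
    apply: le_trans PG1; rewrite lee_fin lerD2l lerN2 powR_inv1 //.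
    by rewrite -[leRHS]invrK lef_pV2 ?posrE ?invr_gt0 // ltr0n.
  have := prob_setI_ge mG1 mG2 PG1' PG2; rewrite -splitr => PG.
  apply: prob_gt_le (measurableI _ _ mG1 mG2) PG _.
    apply: measurableT_comp => //; apply: measurable_coordn.
    apply: measurable_mx_add; last by apply: measurable_mx_opp; exact: measurable_mx_quadE.
    apply: measurable_mx_add; last by apply: measurable_mx_opp; exact: measurable_mx_linE.
    apply: measurable_mx_add; last exact: measurable_mx_cst.
    have mub : measurable_mx (fun w : Om n => uhat w k - bhat w).
      by apply: measurable_mx_add; [exact: measurable_mx_uhat|apply: measurable_mx_opp; exact: measurable_mx_bhat].
    apply: measurable_mx_scale => //; apply: measurable_fun_sg.
    by apply: measurable_mx_mul => //; exact: measurable_mx_cst.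
  by move=> w [/GG1 g1 /GG2 g2]; rewrite coordnE; exact: hr g1 g2.
- by move=> n i; rewrite mxE; exact: quadE_mean.
Qed.
End Setting.

Unset Implicit Arguments.

Theorem theorem4p1
  (R : realType) (dO : measure_display) (Om : nat -> measurableType dO)
  (Pr : forall n, probability (Om n) R)
  (d p q : nat) (k : 'I_d)
  (rho qn : nat -> R)
  (Pm : forall n, 'M[R]_n) (U : forall n, 'M[R]_(n, d)) (lam : forall n, 'I_d -> R)
  (E : forall n, Om n -> 'M[R]_n)
  (V : forall n, Om n -> 'M[R]_n) (mu : forall n, Om n -> 'I_n -> R)
  (N0 : nat)
  (beta C1 C2 c delta0 eps C A0 Cmu : R) :
  (* ---- setting: P_n = U diag(lam) U^T, rank d, p positive / q negative eigenvalues ---- *)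
  d = (p + q)%N -> (k < p)%N ->
  (forall n, (N0 <= n)%N -> Pm n = U n *m diagv (lam n) *m (U n)^T) ->
  (forall n, (N0 <= n)%N -> (U n)^T *m U n = 1%:M) ->
  (forall n, (N0 <= n)%N -> forall m : 'I_d,
      ((m < p)%N -> 0 < lam n m) /\ ((p <= m)%N -> lam n m < 0)) ->
  (forall n, (N0 <= n)%N -> forall m m' : 'I_d, (m <= m')%N -> lam n m' <= lam n m) ->
  (* ---- noise E: symmetric, measurable, mean zero, independent upper-triangular entries ---- *)
  (forall n w (i j : 'I_n), E n w i j = E n w j i) ->
  (forall n (i j : 'I_n), measurable_fun setT (fun w => E n w i j)) ->
  (forall n (i j : 'I_n), (Pr n).-integrable setT (fun w => (E n w i j)%:E) /\
      (\int[Pr n]_w (E n w i j)%:E = 0)%E) ->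
  (forall n, mutually_independent (Pr n)
      (fun ij : 'I_n * 'I_n => (ij.1 <= ij.2)%N) (fun ij w => E n w ij.1 ij.2)) ->
  (* ---- eigendecomposition of A = P + E: orthonormal eigenvectors V (columns),
          eigenvalues mu in nonincreasing order (measurable choice) ---- *)
  (forall n w, (V n w)^T *m V n w = 1%:M) ->
  (forall n w, Pm n + E n w = V n w *m diagv (mu n w) *m (V n w)^T) ->
  (forall n w (i j : 'I_n), (i <= j)%N -> mu n w j <= mu n w i) ->
  (forall n (i j : 'I_n), measurable_fun setT (fun w => V n w i j)) ->
  (forall n (i : 'I_n), measurable_fun setT (fun w => mu n w i)) ->
  (* ---- (A1) ---- *)
  0 < beta -> 0 < C1 -> 0 < C2 -> 0 < c ->
  (forall n, 0 < rho n <= 1) ->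
  (forall M : R, exists N : nat, forall n, (N <= n)%N ->
      M * powR (n%:R) c <= n%:R * rho n) ->
  (forall n, (N0 <= n)%N -> forall m : 'I_d,
      C1 * powR (n%:R) beta * Num.sqrt (n%:R * rho n) <= `|lam n m| /\
      `|lam n m| <= C2 * powR (n%:R) beta * Num.sqrt (n%:R * rho n)) ->
  (* ---- (A2) ---- *)
  0 < delta0 ->
  (forall n, (N0 <= n)%N -> delta0 * min_abs (lam n) <= Delta (lam n)) ->
  (* ---- (A3) ---- *)
  0 < eps <= 1 / 2 -> 0 < C -> 11 <= A0 ->
  (forall n, powR (n%:R) eps <= qn n <= Num.sqrt (n%:R)) ->
  (forall n (i j : 'I_n),
      (\int[Pr n]_w ((E n w i j) ^+ 2)%:E <= (C * rho n)%:E)%E) ->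
  (forall n (i j : 'I_n) (pp : nat), (3 <= pp)%N ->
      pp%:R <= powR (2 * ln (n%:R)) (A0 * ln (ln (n%:R))) ->
      (\int[Pr n]_w (`|E n w i j| ^+ pp)%:E
         <= (C ^+ pp * powR (n%:R * rho n) (pp%:R / 2)
               / (n%:R * qn n ^+ (pp - 2)))%:E)%E) ->
  (* ---- (A4) ---- *)
  1 <= Cmu ->
  (forall n, (N0 <= n)%N -> two_to_inf (U n) <= Cmu * Num.sqrt (d%:R / n%:R)) ->
  (* ---- conclusion ---- *)
  let uk := fun n => col k (U n) in
  let uhat := fun n w => col k (@UAof R n p d (V n w)) in
  let Dl := fun n => Delta (lam n) in
  let Dn := fun n => Dof (fun i j : 'I_n => varR (Pr n) (fun w => E n w i j)) in
  let bk := fun n => bias_formula (U n) (lam n) (Dn n) k in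
  let bhat := fun n w =>
    bias_formula (@UAof R n p d (V n w)) (@SAof R n p d (mu n w))
      (Dhat (Pm n + E n w) (@Phat R n p d (V n w) (mu n w))) k in
  (forall xi : R, 1 < xi ->
     OtildeP Pr
       (fun n w => vinf (Num.sg (((uk n)^T *m uhat n w) 0 0) *: bhat n w - bk n))
       (fun n => Num.sqrt (n%:R) * rho n / Dl n ^+ 2
                 * Num.max (qn n)^-1 (Num.sqrt (n%:R * rho n) / Dl n)
                 * powR (ln (n%:R)) xi))
  /\
  ((fun n : nat => powR (n%:R * rho n) (3 / 2) / Dl n ^+ 2) @ \oo --> (0 : R) ->
     second_order_bias_is Pr E uk (fun n w => uhat n w - bhat n w) rho Dl
       (fun n => 0)).
Proof.
move=> dpq kp PmE UU lam_sign lam_mono Esym mE E0 indE VV AE mu_mono mV mmu beta0 C10 C20 c0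
  rho01 nrho lam_bound delta00 Delta_min eps0 C0 A011 qn_bound E2 Em Cmu1 U_coh uk uhat Dl Dn bk bhat.
split=> [xi xi1|_].
  exact: (@bias_estimate_prob R dO Om Pr d p k rho qn U lam E N0 beta C1 C2 delta0 eps C A0 Cmu).
exact: (@corrected_second_order_bias R dO Om Pr d p k rho qn U lam E N0 beta C1 C2 delta0 eps C A0 Cmu).
Qed.
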